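(* Every nonreal $\lambda\in\mathbb C$ is a regular point of the operator $A$, and for every nonreal $\lambda$ and every $F=(F_1,F_2)\in H_1$ the resolvent $R(\lambda,A):=(\lambda-A)^{-1}$ is given by $R(\lambda,A)F=(u(\cdot,\lambda),(u(\cdot,\lambda))'_\beta)$, where $$u(x,\lambda)=\gamma_1\gamma_2\int_a^cG_1(x,y;\lambda)F_1(y)\,dy+\delta_1\delta_2\int_c^bG_1(x,y;\lambda)F_1(y)\,dy+\frac{\delta_1\delta_2}{\rho}\,(G_1(x,\cdot;\lambda))'_\beta\,F_2 ,$$ and moreover $\|R(\lambda,A)F\|_1\le|\operatorname{Im}\lambda|^{-1}\|F\|_1$. Here $G_1$ is the Green's function defined in the context, and $(G_1(x,\cdot;\lambda))'_\beta=\rho\,\phi(x,\lambda)/w(\lambda)$.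
   Context: Setting. Let $a<c<b$ be real. Let $q$ be real-valued, continuous on $[a,c)$ and on $(c,b]$, with finite limits $q(c\mp 0)$. Let $\alpha_i,\beta_i,\beta_i',\gamma_i,\delta_i$ $(i=1,2)$ be real numbers with $(\alpha_1,\alpha_2)\neq(0,0)$, $\gamma_i\ne 0$, $\delta_i\neq 0$, $\rho:=\beta_1'\beta_2-\beta_1\beta_2'>0$, $\gamma_1\gamma_2>0$ and $\delta_1\delta_2>0$. Write $\tau u:=-u''+q(x)u$, and $$(u)_\beta:=\beta_1u(b)-\beta_2u'(b),\qquad (u)'_\beta:=\beta_1'u(b)-\beta_2'u'(b).$$ Hilbert space. $H_1$ is $L_2[a,b]\oplus\mathbb C$ with inner product $$\langle F,G\rangle_1:=|\gamma_1\gamma_2|\int_a^cF_1\overline{G_1}\,dx+|\delta_1\delta_2|\int_c^bF_1\overline{G_1}\,dx+\frac{|\delta_1\delta_2|}{\rho}F_2\overline{G_2},$$ for $F=(F_1,F_2)$, $G=(G_1,G_2)$, and $\|\cdot\|_1$ is the corresponding norm. Operator. $D(A)$ is the set of all $(F_1,(F_1)'_\beta)\in H_1$ such that $F_1$ and $F_1'$ are absolutely continuous in each of the intervals $[a,c)$ and $(c,b]$ and have finite limits $F_1(c\mp0)$, $F_1'(c\mp0)$, $\tau F_1\in L_2[a,b]$, $\alpha_1F_1(a)+\alpha_2F_1'(a)=0$, $\gamma_1F_1(c-0)=\delta_1F_1(c+0)$, $\gamma_2F_1'(c-0)=\delta_2F_1'(c+0)$. The operator $A:D(A)\subset H_1\to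 H_1$ is $A(F_1,(F_1)'_\beta):=(\tau F_1,-(F_1)_\beta)$. A regular point of $A$ is a point of its resolvent set. Solutions. For $\lambda\in\mathbb C$, $\phi(x,\lambda)$ and $\chi(x,\lambda)$ are the functions on $[a,c)\cup(c,b]$ which solve $\tau u=\lambda u$ on each of the two intervals and satisfy (prime denotes $\partial/\partial x$): $\phi(a,\lambda)=\alpha_2$, $\phi'(a,\lambda)=-\alpha_1$; $\chi(b,\lambda)=\beta_2'\lambda+\beta_2$, $\chi'(b,\lambda)=\beta_1'\lambda+\beta_1$; and both $u=\phi(\cdot,\lambda)$ and $u=\chi(\cdot,\lambda)$ satisfy $\gamma_1u(c-0)=\delta_1u(c+0)$, $\gamma_2u'(c-0)=\delta_2u'(c+0)$. The Wronskian $\phi\chi'-\phi'\chi$ is constant in $x$ on $[a,c)$, equal to $w_1(\lambda)$, and on $(c,b]$, equal to $w_2(\lambda)$, and $w(\lambda):=\gamma_1\gamma_2w_1(\lambda)=\delta_1\delta_2w_2(\lambda)$. Green's function. For $x,y\in[a,c)\cup(c,b]$ and $w(\lambda)\ne0$, $G_1(x,y;\lambda):=\phi(y,\lambda)\chi(x,\lambda)/w(\lambda)$ if $y\le x$ and $G_1(x,y;\lambda):=\phi(x,\lambda)\chi(y,\lambda)/w(\lambda)$ if $x\le y$. In $(G_1(x,\cdot;\lambda))'_\beta$ the functional $(\cdot)'_\beta$ acts on the variable $y$, for fixed $x\in[a,c)\cup(c,b)$, and the value at $x=b$ is understood by the formula $\rho\,\phi(x,\lambda)/w(\lambda)$. 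*)

(* Defs.v *)
From HB Require Import structures.
From mathcomp Require Import all_boot all_order all_algebra.
From mathcomp Require Import all_classical all_reals all_analysis.
From mathcomp Require Import complex.

Set Implicit Arguments.
Unset Strict Implicit.
Unset Printing Implicit Defensive.

Import Order.TTheory GRing.Theory Num.Theory numFieldNormedType.Exports.

Local Open Scope classical_set_scope.
Local Open Scope complex_scope.
Local Open Scope ring_scope.

(* R[i] carries its usual metric topology only through the alias R[i]^o,
   hence the casts. *)
Definition has_limit (R : realType) (F : set_system R) (f : R -> R[i]) : Prop :=
  cvg ((f x : R[i]^o) @[x --> F]).

Definition limit (R : realType) (F : set_system R) (f : R -> R[i]) : R[i] :=
  lim ((f x : R[i]^o) @[x --> F]).

(* The derivative is relative to D, so it is one-sided at an endpoint of an
   interval belonging to D; its value is meaningful only where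
   [derivable_on] holds. *)
Definition diff_quotient (R : realType) (f : R -> R[i]) (x y : R) : R[i] :=
  (f y - f x) / (y - x)%:C.

Definition derivable_on (R : realType) (D : set R) (f : R -> R[i]) (x : R) :
    Prop :=
  has_limit (within D x^') (diff_quotient f x).

Definition deriv_on (R : realType) (D : set R) (f : R -> R[i]) (x : R) : R[i] :=
  limit (within D x^') (diff_quotient f x).

Definition abs_cont (R : realType) (D : set R) (f : R -> R[i]) : Prop :=
  forall e : R, 0 < e -> exists2 d : R, 0 < d &
    forall (n : nat) (s t : 'I_n -> R),
      (forall i, s i <= t i /\ `[s i, t i] `<=` D) ->
      trivIset setT (fun i => `]s i, t i[%classic) ->
      \sum_(i < n) (t i - s i) < d ->
      \sum_(i < n) Normc.normc (f (t i) - f (s i)) < e.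

Definition Cintegral (R : realType) (D : set R) (f : R -> R[i]) : R[i] :=
  (\int[lebesgue_measure]_(x in D) complex.Re (f x)) +i*
  (\int[lebesgue_measure]_(x in D) complex.Im (f x)).

(* Borel representatives: every Lebesgue measurable function agrees almost
   everywhere with a Borel one, so these functions modulo almost everywhere
   equality form the usual complex space L_2(D). *)
Definition L2 (R : realType) (D : set R) (f : R -> R[i]) : Prop :=
  [/\ measurable_fun D (fun x => complex.Re (f x)),
      measurable_fun D (fun x => complex.Im (f x)) &
      (\int[lebesgue_measure]_(x in D) (Normc.normc (f x) ^+ 2)%:E < +oo)%E].

Record problem (R : realType) := Problem {
  pa : R; pc : R; pb : R;
  q : R -> R;
  alpha1 : R; alpha2 : R;
  beta1 : R; beta2 : R; beta1' : R; beta2' : R;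
  gamma1 : R; gamma2 : R;
  delta1 : R; delta2 : R
}.

Definition rho (R : realType) (P : problem R) : R :=
  beta1' P * beta2 P - beta1 P * beta2' P.

Record standing (R : realType) (P : problem R) : Prop := Standing {
  lt_ac : pa P < pc P;
  lt_cb : pc P < pb P;
  q_contl : {within `[pa P, pc P[, continuous (q P)};
  q_contr : {within `]pc P, pb P], continuous (q P)};
  q_liml : cvg (q P x @[x --> (pc P)^'-]);
  q_limr : cvg (q P x @[x --> (pc P)^'+]);
  alpha_neq0 : (alpha1 P, alpha2 P) <> (0, 0);
  gamma1_neq0 : gamma1 P <> 0;
  gamma2_neq0 : gamma2 P <> 0;
  delta1_neq0 : delta1 P <> 0;
  delta2_neq0 : delta2 P <> 0;
  rho_gt0 : 0 < rho P;
  gamma_gt0 : 0 < gamma1 P * gamma2 P;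
  delta_gt0 : 0 < delta1 P * delta2 P
}.

Definition dom (R : realType) (P : problem R) : set R :=
  `[pa P, pc P[ `|` `]pc P, pb P].

Definition D1 (R : realType) (P : problem R) (u : R -> R[i]) : R -> R[i] :=
  deriv_on (dom P) u.

Definition tau (R : realType) (P : problem R) (u : R -> R[i]) (x : R) : R[i] :=
  - D1 P (D1 P u) x + (q P x)%:C * u x.

Definition bform (R : realType) (P : problem R) (u : R -> R[i]) : R[i] :=
  (beta1 P)%:C * u (pb P) - (beta2 P)%:C * D1 P u (pb P).

Definition bform' (R : realType) (P : problem R) (u : R -> R[i]) : R[i] :=
  (beta1' P)%:C * u (pb P) - (beta2' P)%:C * D1 P u (pb P).

Definition transmission (R : realType) (P : problem R) (u : R -> R[i]) : Prop :=
  [/\ has_limit (pc P)^'- u /\ has_limit (pc P)^'+ u,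
      has_limit (pc P)^'- (D1 P u) /\ has_limit (pc P)^'+ (D1 P u),
      (gamma1 P)%:C * limit (pc P)^'- u = (delta1 P)%:C * limit (pc P)^'+ u &
      (gamma2 P)%:C * limit (pc P)^'- (D1 P u) =
      (delta2 P)%:C * limit (pc P)^'+ (D1 P u)].

(* An element of H_1 is a pair (F_1, F_2) whose first component is given by a
   representative; equality in H_1 is [H1eq]. *)
Definition H1rep (R : realType) : Type := ((R -> R[i]) * R[i])%type.

Definition in_H1 (R : realType) (P : problem R) (F : H1rep R) : Prop :=
  L2 `[pa P, pb P] F.1.

Definition H1eq (R : realType) (P : problem R) (F G : H1rep R) : Prop :=
  ae_eq (@lebesgue_measure R) `[pa P, pb P]%classic F.1 G.1 /\ F.2 = G.2.

Definition H1inner (R : realType) (P : problem R) (F G : H1rep R) : R[i] :=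
  (`|gamma1 P * gamma2 P|)%:C *
    Cintegral `[pa P, pc P] (fun x => F.1 x * conjc (G.1 x)) +
  (`|delta1 P * delta2 P|)%:C *
    Cintegral `[pc P, pb P] (fun x => F.1 x * conjc (G.1 x)) +
  (`|delta1 P * delta2 P| / rho P)%:C * (F.2 * conjc G.2).

Definition H1norm (R : realType) (P : problem R) (F : H1rep R) : R :=
  Num.sqrt (complex.Re (H1inner P F F)).

(* f is the absolutely continuous representative of the first component of an
   element of D(A). *)
Definition DA_fun (R : realType) (P : problem R) (f : R -> R[i]) : Prop :=
  [/\ forall x, dom P x -> derivable_on (dom P) f x,
      abs_cont `[pa P, pc P[ f /\ abs_cont `]pc P, pb P] f,
      abs_cont `[pa P, pc P[ (D1 P f) /\ abs_cont `]pc P, pb P] (D1 P f),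
      (exists2 h, L2 `[pa P, pb P] h &
         ae_eq (@lebesgue_measure R) `[pa P, pb P]%classic h (tau P f)) &
      (alpha1 P)%:C * f (pa P) + (alpha2 P)%:C * D1 P f (pa P) = 0 /\
      transmission P f].

Definition with_bform' (R : realType) (P : problem R) (u : R -> R[i]) :
    H1rep R :=
  (u, bform' P u).

(* The graph of A: U belongs to D(A) and A U = V, both in H_1. *)
Definition A_graph (R : realType) (P : problem R) (U V : H1rep R) : Prop :=
  [/\ in_H1 P U, in_H1 P V &
      exists2 f, DA_fun P f &
        H1eq P U (with_bform' P f) /\ H1eq P V (tau P f, - bform P f)].

(* U belongs to D(A) and (lambda - A) U = F. *)
Definition lambda_sub_A (R : realType) (P : problem R) (lambda : R[i])
    (U F : H1rep R) : Prop :=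
  exists2 V, A_graph P U V &
    H1eq P (fun x => lambda * U.1 x - V.1 x, lambda * U.2 - V.2) F.

(* lambda - A maps D(A) bijectively onto H_1, with bounded inverse. *)
Definition regular_point (R : realType) (P : problem R) (lambda : R[i]) :
    Prop :=
  [/\ forall F, in_H1 P F -> exists U, lambda_sub_A P lambda U F,
      forall F U1 U2, in_H1 P F -> lambda_sub_A P lambda U1 F ->
        lambda_sub_A P lambda U2 F -> H1eq P U1 U2 &
      exists M : R, forall F U, in_H1 P F -> lambda_sub_A P lambda U F ->
        H1norm P U <= M * H1norm P F].

(* U represents (lambda - A)^-1 F; at a regular point this determines U up to
   [H1eq]. *)
Definition is_resolvent (R : realType) (P : problem R) (lambda : R[i])
    (F U : H1rep R) : Prop :=
  lambda_sub_A P lambda U F.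

Definition solves (R : realType) (P : problem R) (lambda : R[i])
    (u : R -> R[i]) : Prop :=
  forall x, dom P x ->
    [/\ derivable_on (dom P) u x, derivable_on (dom P) (D1 P u) x &
        tau P u x = lambda * u x].

Definition phi_solution (R : realType) (P : problem R) (lambda : R[i])
    (u : R -> R[i]) : Prop :=
  [/\ solves P lambda u, transmission P u,
      u (pa P) = (alpha2 P)%:C & D1 P u (pa P) = - (alpha1 P)%:C].

Definition chi_solution (R : realType) (P : problem R) (lambda : R[i])
    (u : R -> R[i]) : Prop :=
  [/\ solves P lambda u, transmission P u,
      u (pb P) = (beta2' P)%:C * lambda + (beta2 P)%:C &
      D1 P u (pb P) = (beta1' P)%:C * lambda + (beta1 P)%:C].

Definition wronskian (R : realType) (P : problem R) (u v : R -> R[i]) (x : R) :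
    R[i] :=
  u x * D1 P v x - D1 P u x * v x.

(* The Wronskian is constant on [a, c); its value w_1 is read off at a. *)
Definition w (R : realType) (P : problem R) (phi chi : R -> R[i] -> R[i])
    (lambda : R[i]) : R[i] :=
  (gamma1 P * gamma2 P)%:C * wronskian P (phi^~ lambda) (chi^~ lambda) (pa P).

Definition green (R : realType) (P : problem R) (phi chi : R -> R[i] -> R[i])
    (lambda : R[i]) (x y : R) : R[i] :=
  if y <= x then phi y lambda * chi x lambda / w P phi chi lambda
  else phi x lambda * chi y lambda / w P phi chi lambda.

(* (G_1(x, .; lambda))'_beta. At x = b the one-sided derivative of G_1(b, .)
   would give another value, so the value there is a convention. *)
Definition green_bform' (R : realType) (P : problem R)
    (phi chi : R -> R[i] -> R[i]) (lambda : R[i]) (x : R) : R[i] :=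
  if x == pb P then (rho P)%:C * phi x lambda / w P phi chi lambda
  else bform' P (green P phi chi lambda x).

Definition resolvent_fun (R : realType) (P : problem R)
    (phi chi : R -> R[i] -> R[i]) (lambda : R[i]) (F : H1rep R) (x : R) :
    R[i] :=
  (gamma1 P * gamma2 P)%:C *
    Cintegral `[pa P, pc P] (fun y => green P phi chi lambda x y * F.1 y) +
  (delta1 P * delta2 P)%:C *
    Cintegral `[pc P, pb P] (fun y => green P phi chi lambda x y * F.1 y) +
  (delta1 P * delta2 P / rho P)%:C * green_bform' P phi chi lambda x * F.2.

(* Main.v *)
Require Import Defs.
From HB Require Import structures.
From mathcomp Require Import all_boot all_order all_algebra.
From mathcomp Require Import all_classical all_reals all_analysis.
From mathcomp Require Import measurable_realfun complex ring lra.

Set Implicit Arguments.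
Unset Strict Implicit.
Unset Printing Implicit Defensive.

Import Order.TTheory GRing.Theory Num.Theory numFieldNormedType.Exports.

Local Open Scope classical_set_scope.
Local Open Scope complex_scope.
Local Open Scope ring_scope.

(** The operator is symmetric for the weighted inner product of [H_1], and this
    alone gives the estimate. If [(lambda - A) U = F], integrating
    [Im (tau u * conj u)] over the two intervals leaves the values of
    [Im (u' * conj u)] at the end points. The value at [a] is zero because the
    boundary coefficients are real; the weights [gamma1 gamma2] and
    [delta1 delta2] make the two values at [c] cancel; the value at [b] is
    compensated by the second component, whose weight is [delta1 delta2 / rho].
    Hence [Im lambda * |U|^2 = Im <F, U>], and [|Im lambda| |U| <= |F|]
    ([wint_dom_pieces], [sqnorm_estimate], [H1norm_estimate]). Applied to the
    difference of two solutions with the same [F], the estimate gives uniqueness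
    ([lambda_sub_A_unique]).

    The integration by parts concerns functions whose derivative is only
    absolutely continuous. Such functions are integrals of their almost everywhere
    derivatives ([ac_integral], [ac_FTC2]): the total variation splits them into
    monotone functions, the Lebesgue-Stieltjes measure of a monotone absolutely
    continuous function has a density by the Radon-Nikodym theorem, and the
    Lebesgue differentiation theorem identifies this density. Functions on
    [[a, c)] and [(c, b]] are extended to [c] by their limits, so that all
    arguments take place on closed intervals ([DA_dom_pieces]).

    The estimate also shows that [w lambda] is nonzero ([w_neq0]): otherwise
    [phi] would satisfy the condition at [b] and produce an eigenvector for a
    nonreal eigenvalue.

    Existence is explicit. The candidate is
    [u = w^-1 (chi * Phi + phi * Chi)], where [Phi] and [Chi] are weighted
    primitives of [phi * F] and [- chi * F]; the constants of integration make
    them continuous across [c] and put [F_2] into [Chi]. Variation of parameters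
    ([variation_of_parameters]) yields [lambda u - tau u = F_1] almost everywhere,
    and shows that [u'] is given everywhere by the same formula with [chi'] and
    [phi'] in place of [chi] and [phi]. The conditions at [a] and [c] are
    inherited from [phi] and [chi], and the one at [b] follows from the value of
    the Wronskian there ([resolvent_bform]). *)

(** * Absolutely continuous functions are integrals *)

Section absolutely_continuous_real.
Context {R : realType}.
Implicit Types (f : R -> R) (s t : seq (R * R)).
Notation mu := (@lebesgue_measure R).

(** The last two cases let an interval with empty interior lie anywhere. *)
Definition nonoverlapping (p q : R * R) :=
  [|| p.2 <= q.1, q.2 <= p.1, p.2 <= p.1 | q.2 <= q.1].

Definition subintervals (l r : R) s :=
  all (fun p => [&& l <= p.1, p.1 <= p.2 & p.2 <= r]) s &&
  pairwise nonoverlapping s.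

Definition small_variation (l r : R) f (d e : R) :=
  forall s, subintervals l r s -> \sum_(p <- s) (p.2 - p.1) < d ->
    \sum_(p <- s) `|f p.2 - f p.1| <= e.

(** Absolute continuity on a closed interval, stated with lists of intervals so
    that a family can be refined one interval at a time. *)
Definition ac_itv (l r : R) f :=
  forall e, 0 < e -> exists2 d, 0 < d & small_variation l r f d e.

Fixpoint steps (a : R) (s : seq R) : seq (R * R) :=
  if s is x :: s' then (a, x) :: steps x s' else [::].

Lemma variation_steps a b f (s : seq R) : itv_partition a b s ->
  variation a b f s = \sum_(p <- steps a s) `|f p.2 - f p.1|.
Proof.
elim: s a => [|x s IH] a abs; first by rewrite variation_nil big_nil.
rewrite variation_zip//= !big_cons /= -(variation_zip _ (itv_partition_cons abs)).
by rewrite (IH _ (itv_partition_cons abs)).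
Qed.

Lemma sum_steps a b (s : seq R) : itv_partition a b s ->
  \sum_(p <- steps a s) (p.2 - p.1) = b - a.
Proof.
elim: s a => [|x s IH] a abs.
  by rewrite big_nil (itv_partition_nil abs) subrr.
by rewrite big_cons /= (IH _ (itv_partition_cons abs)); lra.
Qed.

Lemma steps_within a b (s : seq R) : itv_partition a b s ->
  all (fun p : R * R => [&& a <= p.1, p.1 <= p.2 & p.2 <= b]) (steps a s).
Proof.
elim: s a => [|x s IH] a abs //=.
have xbs := itv_partition_cons abs; have xb := itv_partition_le xbs.
have ax : a < x by case: abs => /= /andP[].
rewrite lexx (ltW ax) xb /=; apply: sub_all (IH _ xbs) => p /and3P[xp -> ->].
by rewrite (le_trans (ltW ax) xp).
Qed.

Lemma steps_pairwise a b (s : seq R) : itv_partition a b s ->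
  pairwise nonoverlapping (steps a s).
Proof.
elim: s a => [|x s IH] a abs //=.
have xbs := itv_partition_cons abs; rewrite (IH _ xbs) andbT.
apply: sub_all (steps_within xbs) => p /andP[xp _].
by rewrite /nonoverlapping /= xp.
Qed.

Lemma nonoverlapping_sub (p p' q : R * R) :
  p.1 <= p'.1 -> p'.2 <= p.2 -> nonoverlapping p q -> nonoverlapping p' q.
Proof.
move=> h1 h2; rewrite /nonoverlapping => /or4P[h|h|h|->]; rewrite ?orbT//.
- by rewrite (le_trans h2).
- by rewrite (le_trans h h1) orbT.
- by rewrite (le_trans h2 (le_trans h h1)) !orbT.
Qed.

Lemma nonoverlapping_sym (p q : R * R) :
  nonoverlapping p q -> nonoverlapping q p.
Proof. by rewrite /nonoverlapping => /or4P[] ->; rewrite ?orbT. Qed.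

(** Each interval of [s] may be replaced by an arbitrarily fine partition of it
    without changing the total length, so the bound on increments is also a bound
    on total variations; the list [t] holds the intervals already subdivided. *)
Lemma small_total_variation l r f d e s t : small_variation l r f d e ->
  subintervals l r (s ++ t) -> \sum_(p <- s ++ t) (p.2 - p.1) < d ->
  (\sum_(p <- s) total_variation p.1 p.2 f +
    (\sum_(p <- t) `|f p.2 - f p.1|)%:E <= e%:E)%E.
Proof.
move=> fde; elim: s t => [|p s IH] t /=.
  by move=> st sd; rewrite big_nil add0e lee_fin; exact: fde.
rewrite /subintervals /= => /andP[/andP[/and3P[lp pp pr] st] /andP[ps pst]].
rewrite !big_cons; set X := (\sum_(_ <- _ ++ _) _) => sd.
have st0 : (\sum_(p <- s) total_variation p.1 p.2 f +
    (\sum_(p <- t) `|f p.2 - f p.1|)%:E <= e%:E)%E.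
  apply: IH; first by rewrite /subintervals st.
  by apply: le_lt_trans sd; rewrite -/X lerDr subr_ge0.
set Y := (_ + _)%E in st0.
have Y0 : (0 <= Y)%E.
  rewrite /Y adde_ge0 ?lee_fin ?sumr_ge0// big_seq sume_ge0// => q qs.
  apply: total_variation_ge0; move/allP : st => /(_ q).
  by rewrite mem_cat qs => /(_ isT)/and3P[].
have Yfin : Y \is a fin_num by rewrite ge0_fin_numE// (le_lt_trans st0)// ltry.
rewrite -addeA -/Y -leeBrDr//; apply: ge_ereal_sup => _ [_ [u pu <-] <-].
rewrite leeBrDr// /Y (variation_steps _ pu) addeCA -EFinD -big_cat.
apply: IH.
  rewrite /subintervals catA; apply/andP; split.
    move: st; rewrite !all_cat => /andP[-> ->]; rewrite andbT/=.
    apply: sub_all (steps_within pu) => q /and3P[h1 -> h2].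
    by rewrite (le_trans lp)// (le_trans h2).
  have H v : all (nonoverlapping p) v -> allrel nonoverlapping (steps p.1 u) v.
    move=> /allP pv; apply/allrelP => x y xu yv.
    move/allP : (steps_within pu) => /(_ _ xu)/and3P[x1 _ x2].
    exact: nonoverlapping_sub x1 x2 (pv _ yv).
  move: pst ps; rewrite pairwise_cat all_cat.
  move=> /and3P[stt spw tpw] /andP[pss pst].
  rewrite -catA !pairwise_cat spw tpw (steps_pairwise pu) (H _ pst) /= !andbT.
  rewrite allrel_catr stt andbT; apply/allrelP => x y xs yu.
  by apply/nonoverlapping_sym; move/allrelP : (H _ pss); apply.
apply: le_lt_trans sd; rewrite big_cat/= big_cat/= (sum_steps pu) /X big_cat/=.
lra.
Qed.

Lemma small_variation1 l r f d e x y : small_variation l r f d e ->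
  l <= x -> x <= y -> y <= r -> y - x < d -> (total_variation x y f <= e%:E)%E.
Proof.
move=> fde lx xy yr yxd.
have := @small_total_variation l r f d e [:: (x, y)] [::] fde.
rewrite /subintervals /= !big_cons !big_nil /= lx xy yr /= adde0 addr0 adde0.
by apply.
Qed.

(** An interval of length at most [n d / 2] is cut into [n] pieces, each of
    variation at most [1]. *)
Lemma ac_total_variation_fin l r f : ac_itv l r f ->
  forall x y, l <= x -> x <= y -> y <= r -> total_variation x y f \is a fin_num.
Proof.
move=> /(_ 1 ltr01)[d d0 fd] x y lx xy yr.
rewrite ge0_fin_numE ?total_variation_ge0//.
have d20 : 0 < d / 2 by rewrite divr_gt0.
have [n] : exists n : nat, y - x <= n%:R * (d / 2).
  exists (Num.trunc ((y - x) / (d / 2))).+1.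
  by rewrite -ler_pdivrMr// ltW// truncnS_gt.
elim: n y xy yr => [|n IH] y xy yr.
  rewrite mul0r subr_le0 => yx; have -> : y = x by apply/eqP; rewrite eq_le yx.
  by rewrite total_variationxx.
rewrite -[in X in X -> _]addn1 natrD mulrDl mul1r => yn.
have [h|h] := leP (y - x) (d / 2).
  apply: (@le_lt_trans _ _ 1%:E); last exact: ltry.
  by apply: small_variation1 fd _ _ _ _ => //; lra.
have xz : x <= y - d / 2 by lra.
have zy : y - d / 2 <= y by lra.
rewrite (total_variationD f xz zy) lte_add_pinfty//.
  by apply: IH => //; lra.
apply: (@le_lt_trans _ _ 1%:E); last exact: ltry.
by apply: small_variation1 fd _ _ _ _ => //; lra.
Qed.

Definition variation_fun l f (x : R) := fine (total_variation l x f).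

Lemma variation_funB l r f x y : ac_itv l r f -> l <= x -> x <= y -> y <= r ->
  variation_fun l f y - variation_fun l f x = fine (total_variation x y f).
Proof.
move=> acf lx xy yr; have xr := le_trans xy yr; rewrite /variation_fun.
rewrite (total_variationD f lx xy) fineD ?(ac_total_variation_fin acf)//.
by rewrite addrC addKr.
Qed.

(** This inequality makes both the variation function and its excess over [f]
    nondecreasing. *)
Lemma variation_fun_ge l r f x y : ac_itv l r f -> l <= x -> x <= y -> y <= r ->
  `|f y - f x| <= variation_fun l f y - variation_fun l f x.
Proof.
move=> acf lx xy yr; rewrite (variation_funB acf)// -lee_fin fineK.
  exact: total_variation_ge.
exact: ac_total_variation_fin acf _ _ _ _ _.
Qed.

Lemma ac_variation_fun l r f : ac_itv l r f -> ac_itv l r (variation_fun l f).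
Proof.
move=> acf e e0; have [d d0 fde] := acf _ e0; exists d => // s ss sd.
have := @small_total_variation l r f d e s [::] fde.
rewrite cats0 big_nil adde0 => /(_ ss sd); rewrite -lee_fin; apply: le_trans.
move: ss => /andP[/allP ss _]; rewrite -sumEFin big_seq [leRHS]big_seq.
apply: lee_sum => p /ss/and3P[lp pp pr].
rewrite (variation_funB acf)// ger0_norm; last first.
  by apply: fine_ge0; exact: total_variation_ge0.
by rewrite fineK//; exact: ac_total_variation_fin acf _ _ _ _ _.
Qed.

Lemma ac_itvB l r f g : ac_itv l r f -> ac_itv l r g ->
  ac_itv l r (fun x => f x - g x).
Proof.
move=> acf acg e e0; have e20 : 0 < e / 2 by rewrite divr_gt0.
have [d d0 fd] := acf _ e20; have [d' d'0 gd] := acg _ e20.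
exists (Num.min d d') => [|s ss]; first by rewrite lt_min d0.
rewrite lt_min => /andP[sd sd']; rewrite (splitr e).
apply: le_trans (lerD (fd _ ss sd) (gd _ ss sd')).
rewrite -big_split /=; apply: ler_sum => p _.
rewrite (_ : _ - _ = (f p.2 - f p.1) - (g p.2 - g p.1)); first exact: ler_normB.
by ring.
Qed.

Lemma ac_uniform l r f e : ac_itv l r f -> 0 < e -> exists2 d, 0 < d &
  forall x y, l <= x -> x <= y -> y <= r -> y - x < d -> `|f y - f x| <= e.
Proof.
move=> acf e0; have [d d0 fd] := acf _ e0; exists d => // x y lx xy yr xyd.
have := fd [:: (x, y)]; rewrite /subintervals /= !big_cons !big_nil /= lx xy yr.
by rewrite !addr0; apply.
Qed.

(** The retraction of the line onto [[l, r]], used to extend functions beyond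
    the end points and to bring intervals back into [[l, r]]. *)
Definition clamp (l r x : R) := Num.max l (Num.min x r).

Lemma clamp_in l r x : l <= r -> l <= clamp l r x /\ clamp l r x <= r.
Proof.
by move=> lr; rewrite /clamp le_max lexx ge_max lr ge_min lexx orbT.
Qed.

Lemma clamp_homo l r : {homo clamp l r : x y / x <= y}.
Proof.
move=> x y xy; rewrite /clamp ge_max le_max lexx /= le_max.
by rewrite le_min !ge_min xy lexx !orbT.
Qed.

Lemma clampE l r x : l <= x -> x <= r -> clamp l r x = x.
Proof. by move=> lx xr; rewrite /clamp (min_idPl xr) (max_idPr lx). Qed.

Lemma clamp_lip l r x y : l <= r -> x <= y -> clamp l r y - clamp l r x <= y - x.
Proof. move=> lr xy; rewrite /clamp.
case: (leP x r) => xr; case: (leP y r) => yr; case: (leP l x) => lx;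
  case: (leP l y) => ly; rewrite ?(max_idPr lr); lra. Qed.

Section monotone.
Variables (l r : R) (F : R -> R).
Hypotheses (lr : l <= r) (acF : ac_itv l r F).
Hypothesis ndF : forall x y, l <= x -> x <= y -> y <= r -> F x <= F y.

(** Being constant on both sides of [[l, r]], this extension of [F] defines a
    Lebesgue-Stieltjes measure on the whole line. *)
Let G x := F (clamp l r x).

Let ndG : nondecreasing G.
Proof.
move=> x y xy; apply: ndF; last by have [] := clamp_in y lr.
  by have [] := clamp_in x lr.
exact: clamp_homo.
Qed.

Let rcG : right_continuous G.
Proof.
move=> x; apply/cvgrPdist_le => e e0.
have [d d0 Fd] := ac_uniform acF e0.
near=> y; have xy : x <= y by near: y; exact: nbhs_right_ge.
rewrite distrC; apply: Fd.
- by have [] := clamp_in x lr.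
- exact: clamp_homo.
- by have [] := clamp_in y lr.
apply: le_lt_trans (clamp_lip lr xy) _.
by rewrite ltrBlDr addrC; near: y; apply: nbhs_right_lt; rewrite ltrDl.
Unshelve. all: by end_near. Qed.

HB.instance Definition _ := isCumulative.Build R _ R G ndG rcG.

Let nu := lebesgue_stieltjes_measure (G : cumulative R R).

Let nu_itv x y : x <= y -> nu `]x, y]%classic = (G y - G x)%:E.
Proof.
move=> xy; rewrite /nu /lebesgue_stieltjes_measure /measure_extension.
by rewrite measurable_mu_extE/=; [rewrite wlength_itv_bnd|exact: is_ocitv].
Qed.

(** Unbounded intervals have infinite measure. *)
Let bounded_open_itv (I : set R) : open I -> is_interval I ->
  (mu I < +oo)%E -> exists2 p : R * R, p.1 <= p.2 & I = `]p.1, p.2[%classic.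
Proof.
move=> oI itvI Ioo.
have II : I = I° by apply/esym/interior_id.
have [lbI|nlbI] := pselect (has_lbound I); last first.
  exfalso; move: Ioo; have [ubI|nubI] := pselect (has_ubound I).
    rewrite II (interval_left_unbounded_interior itvI nlbI ubI).
    rewrite (_ : [set r | _] = `]-oo, (sup I)[%classic).
      by rewrite lebesgue_measure_itv/= ltNyr ltxx.
    by apply/seteqP; split => x /=; rewrite in_itv.
  rewrite (interval_unbounded_setT itvI nlbI nubI) -set_itvNyy.
  by rewrite lebesgue_measure_itv/= ?ltry ltxx.
have [ubI|nubI] := pselect (has_ubound I); last first.
  exfalso; move: Ioo; rewrite II (interval_right_unbounded_interior itvI lbI nubI).
  rewrite (_ : [set r | _] = `](inf I), +oo[%classic).
    by rewrite lebesgue_measure_itv/= ?ltry ltxx.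
  by apply/seteqP; split => x /=; rewrite in_itv/= andbT.
have IE : I = `](inf I), (sup I)[%classic.
  rewrite {1}II (interval_bounded_interior itvI lbI ubI).
  by apply/seteqP; split => x /=; rewrite in_itv.
have [h|h] := leP (inf I) (sup I); first by exists (inf I, sup I).
exists (0, 0) => //=; rewrite IE.
rewrite set_itv_ge ?bnd_simp; last by rewrite -leNgt ltW.
by rewrite set_itv_ge// bnd_simp ltxx.
Qed.

(** An open set is a countable disjoint union of open intervals; finitely many
    of them, clamped to [[l, r]], form a family to which the absolute
    continuity of [F] applies. *)
Let nu_openle e : 0 < e -> exists2 d, 0 < d &
  forall U, open U -> (mu U < d%:E)%E -> (nu U <= e%:E)%E.
Proof.
move=> e0; have [d d0 Fd] := acF e0; exists d => // U oU Ud.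
pose I := @open_disjoint_itv _ _ oU.
have oI i : open (I i) by exact: open_disjoint_itv_open.
have mI i : measurable (I i) by exact: measurable_realfun.open_measurable.
have UI : U = \bigcup_i I i by exact: open_disjoint_itv_bigcup.
have muI i : (mu (I i) < +oo)%E.
  apply: (le_lt_trans _ (lt_trans Ud (ltry _))).
  apply: le_measure; rewrite ?inE//; [exact: mI| |].
    exact: measurable_realfun.open_measurable.
  by move=> x Ix; rewrite UI; exists i.
have /boolp.choice[p Ip] : forall i, exists q : R * R,
    q.1 <= q.2 /\ I i = `]q.1, q.2[%classic.
  move=> i.
  have [|q q12 Iq] := @bounded_open_itv (I i) (oI i) _ (muI i); last by exists q.
  exact: open_disjoint_itv_is_interval.
have tI : trivIset setT I by exact: open_disjoint_itv_trivIset.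
have muUE : (mu U = \sum_(0 <= i <oo) mu (I i))%E.
  by rewrite UI measure_semi_bigcup// -UI; exact: measurable_realfun.open_measurable.
have nuUE : (nu U = \sum_(0 <= i <oo) nu (I i))%E.
  have := measure_semi_bigcup (lebesgue_stieltjes_measure (G : cumulative R R))
    mI tI.
  rewrite -UI; apply; exact: measurable_realfun.open_measurable.
rewrite nuUE; apply: lime_le; first exact: is_cvg_nneseries.
apply: nearW => n.
pose cl (q : R * R) := (clamp l r q.1, clamp l r q.2).
pose s := [seq cl (p i) | i <- iota 0 n].
have ss : subintervals l r s.
  apply/andP; split.
    apply/allP => _ /mapP[i _ ->] /=; have [p12 _] := Ip i.
    have [-> _] := clamp_in (p i).1 lr; have [_ ->] := clamp_in (p i).2 lr.
    by rewrite andbT; exact/clamp_homo.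
  rewrite pairwise_map; have := iota_uniq 0 n; rewrite uniq_pairwise.
  apply: sub_pairwise => i j /= ij; rewrite /relpre /=.
  (* Two overlapping components would share the midpoint of their overlap. *)
  have H : nonoverlapping (p i) (p j).
    apply/negPn/negP; rewrite /nonoverlapping !negb_or -!ltNge => /and4P[h1 h2 h3 h4].
    have : I i `&` I j = set0.
      by move/trivIsetP : tI; apply=> //.
    have [_ ->] := Ip i; have [_ ->] := Ip j.
    set m := Num.max (p i).1 (p j).1; set M := Num.min (p i).2 (p j).2.
    have mM : m < M by rewrite gt_max !lt_min h1 h2 h3 h4 //=.
    have [m1 m2] : (p i).1 <= m /\ (p j).1 <= m by rewrite !le_max !lexx orbT.
    have [M1 M2] : M <= (p i).2 /\ M <= (p j).2 by rewrite !ge_min !lexx orbT.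
    move/seteqP => [/(_ ((m + M) / 2)) + _]; apply=> /=; rewrite !in_itv/=.
    by split; apply/andP; split; lra.
  move: H; rewrite /nonoverlapping /= => /or4P[] /(clamp_homo l r) ->;
    by rewrite ?orbT.
have lens : \sum_(q <- s) (q.2 - q.1) < d.
  rewrite -lte_fin; apply: le_lt_trans Ud; rewrite muUE.
  apply: le_trans (nneseries_lim_ge n _) => //.
  rewrite /s big_map -sumEFin -[in X in iota _ X](subn0 n).
  apply: lee_sum => i _; have [p12 ->] := Ip i.
  rewrite lebesgue_measure_itv/= lte_fin.
  have := clamp_lip lr p12; case: ltP => [_|h] hc; first by rewrite -EFinD lee_fin.
  by rewrite lee_fin (le_trans hc)// subr_le0.
have := Fd _ ss lens; rewrite -lee_fin; apply: le_trans.
rewrite /s big_map -sumEFin -[in X in iota _ X](subn0 n).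
apply: lee_sum => i _; have [p12 Ii] := Ip i.
have -> : (`|F (cl (p i)).2 - F (cl (p i)).1|%:E = nu `](p i).1, (p i).2])%E.
  by rewrite nu_itv// ger0_norm// subr_ge0; exact: ndG.
apply: le_measure; rewrite ?inE//.
  exact: mI.
by rewrite Ii; apply: subset_itvl; rewrite bnd_simp.
Qed.

(** By outer regularity, a null set lies in open sets of arbitrarily small
    measure. *)
Let nu_dominated (A : set R) : measurable A -> mu A = 0%E -> nu A = 0%E.
Proof.
move=> mA A0; apply/eqP; rewrite eq_le measure_ge0 andbT.
apply/lee_addgt0Pr => e e0; rewrite add0e.
have [d d0 nud] := nu_openle e0.
have Aoo : (mu A < +oo)%E by rewrite A0.
have [U [oU AU UA]] := lebesgue_regularity_outer mA Aoo d0.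
have mU : measurable U by exact: measurable_realfun.open_measurable.
have Ud : (mu U < d%:E)%E.
  suff -> : (mu U = mu A + mu (U `\` A))%E by rewrite A0 add0e.
  rewrite -measureU ?setDUK ?setDIK//.
  exact: measurableD.
apply: le_trans (nud _ oU Ud); apply: le_measure; rewrite ?inE//.
Qed.

(** The Lebesgue-Stieltjes measure of a nondecreasing absolutely continuous
    function is absolutely continuous with respect to the Lebesgue measure; its
    Radon-Nikodym density is the function sought. *)
Lemma ac_nondecreasing_integral : exists2 k : R -> R,
  mu.-integrable `[l, r] (EFin \o k) &
  forall x, l <= x -> x <= r -> F x - F l = \int[mu]_(t in `[l, x]) k t.
Proof.
have mD : measurable (`]l, r]%classic : set (measurableTypeR R)) by exact: measurable_itv.
have nuD : (nu `]l, r] < +oo)%E by rewrite nu_itv// ltry.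
pose nu' : {finite_measure set (measurableTypeR R) -> \bar R} := mfrestr mD nuD.
have dom' : nu' `<< mu.
  apply/null_content_dominatesP => A mA A0.
  rewrite /nu' /= /mfrestr /mrestr; apply/eqP; rewrite eq_le measure_ge0 andbT.
  rewrite -(nu_dominated mA A0); apply: le_measure; rewrite ?inE//.
  exact: measurableI.
have [g [g0 gfin intg nug]] := radon_nikodym_sigma_finite dom'.
exists (fine \o g).
  apply: eq_integrable (integrableS measurableT _ _ intg) => //= x _.
  by rewrite fineK.
move=> x lx xr; apply: EFin_inj; rewrite /Rintegral fineK; last first.
  apply: integrable_fin_num => //.
  apply: eq_integrable (integrableS measurableT _ _ intg) => //= y _.
  by rewrite fineK.
under eq_integral do rewrite /= fineK//.
rewrite -integral_itv_obnd_cbnd; last first.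
  by apply: measurable_funS (measurable_int _ intg).
rewrite -nug// /nu' /= /mfrestr /mrestr setIidl; last first.
  by apply: subset_itvl; rewrite bnd_simp.
by rewrite -[RHS]/(nu _) nu_itv// /G !clampE.
Qed.

End monotone.

(** The Lebesgue fundamental theorem of calculus: an absolutely continuous
    function is the difference of two nondecreasing ones, its variation and the
    excess of its variation over itself. *)
Lemma ac_integral l r f : l <= r -> ac_itv l r f -> exists2 k : R -> R,
  mu.-integrable `[l, r] (EFin \o k) &
  forall x, l <= x -> x <= r -> f x - f l = \int[mu]_(t in `[l, x]) k t.
Proof.
move=> lr acf; have acv := ac_variation_fun acf.
have [k ik Ek] := ac_nondecreasing_integral lr acv (fun x y lx xy yr =>
  ltac:(by rewrite -subr_ge0; apply: le_trans (variation_fun_ge acf lx xy yr))).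
have ndv x y : l <= x -> x <= y -> y <= r ->
    variation_fun l f x - f x <= variation_fun l f y - f y.
  move=> lx xy yr; have := variation_fun_ge acf lx xy yr.
  by move=> /(le_trans (ler_norm _)); lra.
have [k' ik' Ek'] := ac_nondecreasing_integral lr (ac_itvB acv acf) ndv.
exists (fun x => k x - k' x).
  by apply: eq_integrable (integrableB _ ik ik').
move=> x lx xr.
have sub : `[l, x]%classic `<=` `[l, r]%classic.
  by apply: subset_itvl; rewrite bnd_simp.
rewrite RintegralB//; [|exact: integrableS ik|exact: integrableS ik'].
by rewrite -Ek// -Ek'//; ring.
Qed.

End absolutely_continuous_real.

(** * Almost everywhere derivatives of absolutely continuous functions *)

Section ac_fundamental_theorem.
Context {R : realType}.
Implicit Types (f k h : R -> R).
Notation mu := (@lebesgue_measure R).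

(** Makes the filter lemmas available for properties that hold almost
    everywhere. *)
#[global] Instance ae_lebesgue_filter : Filter (almost_everywhere mu).
Proof. exact: (ae_filter_ringOfSetsType mu). Qed.

Lemma ae_imp (P Q : R -> Prop) : (forall x, P x -> Q x) ->
  {ae mu, forall x, P x} -> {ae mu, forall x, Q x}.
Proof. by move=> PQ; apply: filterS. Qed.

Lemma ae_imp2 (P Q S : R -> Prop) : (forall x, P x -> Q x -> S x) ->
  {ae mu, forall x, P x} -> {ae mu, forall x, Q x} -> {ae mu, forall x, S x}.
Proof. by move=> PQS; apply: filterS2. Qed.

Lemma ae_imp3 (P Q S T : R -> Prop) : (forall x, P x -> Q x -> S x -> T x) ->
  {ae mu, forall x, P x} -> {ae mu, forall x, Q x} -> {ae mu, forall x, S x} ->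
  {ae mu, forall x, T x}.
Proof. by move=> PQST; apply: filterS3. Qed.

Lemma ae_neq (a : R) : {ae mu, forall x, x != a}.
Proof.
exists [set a]; split => //; first exact: lebesgue_measure_set1.
by move=> x /= /negP; rewrite negbK => /eqP.
Qed.

Lemma ae_itvoo_cc (l r : R) (P : R -> Prop) :
  {ae mu, forall x, l < x < r -> P x} ->
  {ae mu, forall x, `[l, r]%classic x -> P x}.
Proof.
move=> aeP; apply: ae_imp3 aeP (ae_neq l) (ae_neq r) => x + xl xr /=.
rewrite in_itv/= => h /andP[lx xr']; apply: h.
by rewrite !lt_neqAle eq_sym xl lx xr xr'.
Qed.

Lemma ae_eq_Rintegral (l r : R) f g :
  mu.-integrable `[l, r] (EFin \o f) -> mu.-integrable `[l, r] (EFin \o g) ->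
  {ae mu, forall x, l < x < r -> f x = g x} ->
  \int[mu]_(x in `[l, r]) f x = \int[mu]_(x in `[l, r]) g x.
Proof.
move=> fi gi fg; congr fine; apply: ae_eq_integral => //.
- exact: measurable_int fi.
- exact: measurable_int gi.
- by apply: ae_imp (ae_itvoo_cc fg) => x h /h ->.
Qed.

Lemma near_itvoo (l r x : R) : l < x -> x < r -> \forall y \near x, l < y < r.
Proof.
move=> lx xr; have : x \in `]l, r[ by rewrite in_itv/= lx.
by move=> /near_in_itvoo; apply: filterS => y; rewrite in_itv.
Qed.

(** The Lebesgue differentiation theorem, for [k] extended by zero outside
    [[l, r]]. *)
Lemma integral_ae_derive (l r C : R) f k :
  mu.-integrable `[l, r] (EFin \o k) ->
  (forall x, l <= x -> x <= r -> f x = C + \int[mu]_(t in `[l, x]) k t) ->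
  {ae mu, forall x, l < x < r -> is_derive x 1 f (k x)}.
Proof.
move=> ki fE; pose k0 := k \_ `[l, r].
have k0i : mu.-integrable setT (EFin \o k0).
  by rewrite /k0 -restrict_EFin; apply/integrable_restrict => //; rewrite setTI.
have k0y (y : R) : mu.-integrable `[l, y] (EFin \o k0).
  by apply: (integrableS measurableT) => //; exact: measurable_itv.
set F := fun x => \int[mu]_(t in `[l, x]) k0 t.
have := FTC1 k0y (open_integrable_locally openT k0i); rewrite -/F.
move=> aeF; apply: ae_imp aeF => x dFx /andP[lx xr].
have [|dF F'] := dFx; first by rewrite /= lte_fin.
have : is_derive x 1 F (k x).
  apply: DeriveDef => //; rewrite -derive1E F' /k0 patchE mem_set//=.
  by rewrite in_itv/= !ltW.
move=> dF'; have : is_derive x 1 (fun y => C + F y) (k x).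
  by rewrite -[k x]add0r; apply: is_deriveD.
apply: near_eq_is_derive; near=> y.
have /andP[ly yr] : l < y < r by near: y; exact: near_itvoo.
rewrite fE ?ltW// /F; congr (_ + _); apply: eq_Rintegral => t.
rewrite inE /= in_itv/= => /andP[lt ty].
by rewrite /k0 patchE mem_set//= in_itv/= lt (le_trans ty (ltW yr)).
Unshelve. all: by end_near. Qed.

(** The derivative exists almost everywhere, so it is enough that [h] agree
    with it wherever it exists. *)
Lemma ac_FTC2 (l r : R) f h : l <= r -> ac_itv l r f ->
  mu.-integrable `[l, r] (EFin \o h) ->
  {ae mu, forall x, l < x < r -> forall d, is_derive x 1 f d -> d = h x} ->
  f r - f l = \int[mu]_(t in `[l, r]) h t.
Proof.
move=> lr acf hi f'h; have [k ki kE] := ac_integral lr acf.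
rewrite kE//; apply: ae_eq_Rintegral => //.
have fE x : l <= x -> x <= r -> f x = f l + \int[mu]_(t in `[l, x]) k t.
  by move=> lx xr; rewrite -kE//; ring.
apply: ae_imp2 f'h (integral_ae_derive ki fE) => x h1 h2 lxr.
by apply: h1 => //; exact: h2.
Qed.

Lemma ac_ae_derivable (l r : R) f : l <= r -> ac_itv l r f ->
  {ae mu, forall x, l < x < r -> derivable f x 1}.
Proof.
move=> lr acf; have [k ki kE] := ac_integral lr acf.
have fE x : l <= x -> x <= r -> f x = f l + \int[mu]_(t in `[l, x]) k t.
  by move=> lx xr; rewrite -kE//; ring.
by apply: ae_imp (integral_ae_derive ki fE) => x h /h [].
Qed.

Lemma ac_lipschitz (l r M : R) f : l <= r -> 0 <= M -> ac_itv l r f ->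
  {ae mu, forall x, l < x < r -> forall d, is_derive x 1 f d -> `|d| <= M} ->
  `|f r - f l| <= M * (r - l).
Proof.
move=> lr M0 acf f'M; have [k ki kE] := ac_integral lr acf.
have fE x : l <= x -> x <= r -> f x = f l + \int[mu]_(t in `[l, x]) k t.
  by move=> lx xr; rewrite -kE//; ring.
have kM : {ae mu, forall x, l < x < r -> `|k x| <= M}.
  apply: ae_imp2 f'M (integral_ae_derive ki fE) => x h1 h2 lxr.
  by apply: h1 => //; exact: h2.
rewrite kE//; apply: le_trans (le_normr_Rintegral _ ki) _ => //.
have mk := measurable_int _ ki.
have : (\int[mu]_(x in `[l, r]) (`|k x|)%:E <= \int[mu]_(x in `[l, r]) M%:E)%E.
  apply: ae_ge0_le_integral => //.
  - apply/measurable_EFinP; apply: measurableT_comp => //.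
    exact/measurable_EFinP.
  - by apply: ae_imp (ae_itvoo_cc kM) => x h /h; rewrite lee_fin.
have -> : (\int[mu]_(x in `[l, r]) M%:E = (M * (r - l))%:E)%E.
  rewrite integral_cst//= EFinM; congr (_ * _)%E.
  rewrite -[LHS]/(mu _) lebesgue_measure_itv/= lte_fin.
  by move: lr; rewrite le_eqVlt => /predU1P[->|->]; rewrite ?ltxx ?subrr.
move=> h; rewrite -lee_fin /Rintegral fineK//.
by rewrite ge0_fin_numE ?integral_ge0// (le_lt_trans h)// ltry.
Qed.

End ac_fundamental_theorem.

(** * Stability of absolute continuity *)

Section ac_operations.
Context {R : realType}.
Implicit Types (f g k : R -> R) (s : seq (R * R)) (l r : R).
Notation mu := (@lebesgue_measure R).

(** Sums, opposites and products are handled by bounding their increments by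
    those of their operands. *)
Lemma ac_dominated2 l r f g1 g2 (M : R) : 0 <= M ->
  ac_itv l r g1 -> ac_itv l r g2 ->
  (forall x y, l <= x -> x <= y -> y <= r ->
    `|f y - f x| <= M * (`|g1 y - g1 x| + `|g2 y - g2 x|)) ->
  ac_itv l r f.
Proof.
move=> M0 ac1 ac2 fg e e0.
have M1 : 0 < M + 1 by lra.
have e'0 : 0 < e / (M + 1) / 2 by rewrite !divr_gt0.
have [d1 d10 h1] := ac1 _ e'0; have [d2 d20 h2] := ac2 _ e'0.
exists (Num.min d1 d2) => [|s ss]; first by rewrite lt_min d10.
rewrite lt_min => /andP[sd1 sd2].
have := lerD (h1 _ ss sd1) (h2 _ ss sd2); rewrite -big_split/= -splitr => h.
apply: (@le_trans _ _ ((M + 1) * (e / (M + 1)))); last by rewrite mulrC divfK ?gt_eqF.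
apply: le_trans (ler_wpM2l (ltW M1) h).
rewrite mulr_sumr big_seq [leRHS]big_seq; apply: ler_sum => p ps.
case/andP : ss => /allP /(_ _ ps)/and3P[lp pp pr] _.
apply: le_trans (fg _ _ lp pp pr) _; apply: ler_wpM2r; last by lra.
by rewrite addr_ge0.
Qed.

Lemma ac_cst l r (C : R) : ac_itv l r (fun=> C).
Proof.
move=> e e0; exists 1 => // s _ _; rewrite big1 ?ltW// => p _.
by rewrite subrr normr0.
Qed.

Lemma ac_itvD l r f g : ac_itv l r f -> ac_itv l r g ->
  ac_itv l r (fun x => f x + g x).
Proof.
move=> acf acg; apply: (@ac_dominated2 _ _ _ f g 1) => // x y _ _ _.
rewrite mul1r (_ : _ - _ = (f y - f x) + (g y - g x)); last by ring.
exact: ler_normD.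
Qed.

Lemma ac_bounded l r f : l <= r -> ac_itv l r f ->
  exists2 M, 0 <= M & forall x, l <= x -> x <= r -> `|f x| <= M.
Proof.
move=> lr acf; pose V := variation_fun l f.
exists (`|f l| + `|V r - V l|) => [|x lx xr]; first by rewrite addr_ge0.
rewrite -[f x](subrK (f l)) addrC (le_trans (ler_normD _ _))// lerD2l.
have := variation_fun_ge acf (lexx l) lx xr.
have := variation_fun_ge acf lx xr (lexx r) => /(le_trans (normr_ge0 _)) h1 h2.
by apply: le_trans h2 _; apply: le_trans (ler_norm _); rewrite /V; lra.
Qed.

Lemma ac_itvM l r f g : l <= r -> ac_itv l r f -> ac_itv l r g ->
  ac_itv l r (fun x => f x * g x).
Proof.
move=> lr acf acg; have [M M0 fM] := ac_bounded lr acf.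
have [N N0 gN] := ac_bounded lr acg.
apply: (@ac_dominated2 _ _ _ f g (M + N)) => //; first exact: addr_ge0.
move=> x y lx xy yr.
rewrite (_ : _ - _ = (f y - f x) * g y + f x * (g y - g x)); last by ring.
apply: le_trans (ler_normD _ _) _; rewrite !normrM mulrDr; apply: lerD.
  rewrite mulrC ler_wpM2r//; have := gN y (le_trans lx xy) yr; lra.
by rewrite ler_wpM2r//; have := fM x lx (le_trans xy yr); lra.
Qed.

Lemma ac_itvN l r f : ac_itv l r f -> ac_itv l r (fun x => - f x).
Proof.
move=> acf; apply: (@ac_dominated2 _ _ _ f f 1) => // x y _ _ _.
rewrite (_ : _ - _ = - (f y - f x)) ?normrN ?mul1r ?lerDl//.
by rewrite opprB opprK addrC.
Qed.

Lemma ac_lip l r f (M : R) : 0 <= M ->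
  (forall x y, l <= x -> x <= y -> y <= r -> `|f y - f x| <= M * (y - x)) ->
  ac_itv l r f.
Proof.
move=> M0 fM e e0; have M1 : 0 < M + 1 by lra.
exists (e / (M + 1)); first by rewrite divr_gt0.
move=> s /andP[/allP ss _]; rewrite ltr_pdivlMr// => /ltW; apply: le_trans.
rewrite mulrC mulr_sumr big_seq [leRHS]big_seq; apply: ler_sum => p /ss.
move=> /and3P[lp pp pr]; apply: le_trans (fM _ _ lp pp pr) _.
by apply: ler_wpM2r; rewrite ?subr_ge0//; lra.
Qed.

Lemma ac_within_continuous l r f : ac_itv l r f ->
  {within `[l, r], continuous f}.
Proof.
move=> acf; apply/subspace_continuousP => x; rewrite /= in_itv/= => /andP[lx xr].
apply/cvgrPdist_le => e e0; have [d d0 fd] := ac_uniform acf e0.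
near=> y; have : `[l, r]%classic y by near: y; exact: withinT.
have : `|x - y| < d by near: y; apply: cvg_within; exact: nbhsx_ballx.
rewrite /= in_itv/= => xyd /andP[ly yr].
have [xy|/ltW yx] := leP x y; last first.
  by apply: fd => //; apply: le_lt_trans xyd; exact: ler_norm.
rewrite distrC; apply: fd => //.
by apply: le_lt_trans xyd; rewrite distrC; exact: ler_norm.
Unshelve. all: by end_near. Qed.

(** The Lebesgue integral of [`|k|] is small on sets of small measure, in
    particular on a union of intervals of small total length. *)
Lemma ac_parameterized_integral l r k : mu.-integrable `[l, r] (EFin \o k) ->
  ac_itv l r (fun x => \int[mu]_(t in `[l, x]) k t).
Proof.
move=> ki e e0; pose k0 := k \_ `[l, r].
have k0i : mu.-integrable setT (EFin \o k0).
  by rewrite /k0 -restrict_EFin; apply/integrable_restrict => //; rewrite setTI.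
have [d [d0 kd]] := integral_normr_continuous k0i e0.
exists d => // s ss sd.
pose A s := \big[setU/set0]_(p <- s) `]p.1, p.2[%classic.
have mA s' : measurable (A s') by apply: bigsetU_measurable => p _.
have nki (B : set R) : measurable B -> mu.-integrable B (EFin \o (fun x => `|k0 x|)).
  move=> mB; apply: (integrableS measurableT) => //.
  by have := integrable_abse k0i.
have : mu (A s) = (\sum_(p <- s) (p.2 - p.1))%:E /\
  \int[mu]_(x in A s) `|k0 x| =
    \sum_(p <- s) \int[mu]_(x in `]p.1, p.2[) `|k0 x|.
  elim: s ss {sd} => [|p s IH].
    by rewrite /A !big_nil measure0 Rintegral_set0.
  rewrite /subintervals/= => /andP[/andP[/and3P[lp pp pr] st] /andP[ps pst]].
  have [|IH1 IH2] := IH; first by rewrite /subintervals st.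
  have disj : `]p.1, p.2[%classic `&` A s = set0.
    rewrite /A; elim: s ps {st pst IH IH1 IH2} => [|q s IH] /=.
      by rewrite big_nil setI0.
    move=> /andP[pq ps]; rewrite big_cons setIUr IH// setU0.
    apply/seteqP; split => x //=; rewrite !in_itv/=.
    by move=> [/andP[h1 h2] /andP[h3 h4]]; case/or4P : pq; lra.
  rewrite /A !big_cons -/(A s); split.
    have -> : mu (`]p.1, p.2[ `|` A s) = (mu `]p.1, p.2[ + mu (A s))%E.
      by rewrite measureU//; exact: mA.
    rewrite IH1 lebesgue_measure_itv/= lte_fin.
    by move: pp; rewrite le_eqVlt => /predU1P[->|->]; rewrite ?ltxx ?subrr ?add0e ?add0r.
  rewrite Rintegral_setU//.
  - by rewrite IH2.
  - exact: mA.
  - by apply: nki; apply: measurableU => //; exact: mA.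
  - exact/disj_set2P.
move=> [muA intA].
have Ad : (mu (A s) < d%:E)%E by rewrite muA lte_fin.
have := kd (A s) (mA s) Ad; rewrite [X in X < _ -> _]intA => /ltW.
apply: le_trans; rewrite big_seq [leRHS]big_seq; apply: ler_sum => p ps.
case/andP : ss => /allP /(_ _ ps)/and3P[lp pp pr] _.
have kip : mu.-integrable `[l, p.2] (EFin \o k).
  by apply: integrableS ki => //; apply: subset_itvl; rewrite bnd_simp.
rewrite Rintegral_itvB//; [|by rewrite bnd_simp..].
have kip' : mu.-integrable `]p.1, p.2] (EFin \o k).
  apply: integrableS kip => //; apply: subset_itvr; rewrite bnd_simp//.
rewrite -Rintegral_itv_bndo_bndc; last first.
  apply: integrableS kip' => //; apply: subset_itvl; rewrite bnd_simp//.
apply: le_trans (le_normr_Rintegral _ _) _ => //.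
  apply: integrableS kip' => //; apply: subset_itvl; rewrite bnd_simp//.
rewrite le_eqVlt; apply/orP; left; apply/eqP; apply: eq_Rintegral => t.
rewrite inE/= in_itv/= => /andP[pt tp].
rewrite /k0 patchE mem_set//= in_itv/=.
by rewrite (le_trans lp (ltW pt)) (le_trans (ltW tp) pr).
Qed.

End ac_operations.

(** * Complex limits and derivatives *)

Section complex_basics.
Context {R : realType}.
Implicit Types (z w : R[i]) (x y : R) (f g : R -> R[i]).

Local Notation Re := (@complex.Re R).
Local Notation Im := (@complex.Im R).
Local Notation normc := (@Normc.normc R).

Lemma complex_eq z w : Re z = Re w -> Im z = Im w -> z = w.
Proof. by case: z w => [a b] [c d] /= -> ->. Qed.

Lemma sqr_normc z : normc z ^+ 2 = Re z ^+ 2 + Im z ^+ 2.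
Proof. by case: z => a b /=; rewrite sqr_sqrtr// addr_ge0// sqr_ge0. Qed.

Lemma normc_ge0 z : 0 <= normc z.
Proof. by case: z => a b /=; exact: sqrtr_ge0. Qed.

Lemma Re_le_normc z : `|Re z| <= normc z.
Proof.
rewrite -ler_sqr ?nnegrE ?normc_ge0// sqr_normc real_normK ?num_real//.
by rewrite lerDl sqr_ge0.
Qed.

Lemma Im_le_normc z : `|Im z| <= normc z.
Proof.
rewrite -ler_sqr ?nnegrE ?normc_ge0// sqr_normc real_normK ?num_real//.
by rewrite lerDr sqr_ge0.
Qed.

Lemma normc_le z : normc z <= `|Re z| + `|Im z|.
Proof.
rewrite -ler_sqr ?nnegrE ?normc_ge0 ?addr_ge0// sqr_normc sqrrD.
rewrite !real_normK ?num_real// -addrA lerD2l lerDr mulrn_wge0// mulr_ge0//.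
Qed.

Lemma ReM z w : Re (z * w) = Re z * Re w - Im z * Im w.
Proof. by case: z w => [a b] [c d]. Qed.
Lemma ImM z w : Im (z * w) = Re z * Im w + Im z * Re w.
Proof. by case: z w => [a b] [c d]. Qed.
Lemma ReD z w : Re (z + w) = Re z + Re w.
Proof. by case: z w => [a b] [c d]. Qed.
Lemma ImD z w : Im (z + w) = Im z + Im w.
Proof. by case: z w => [a b] [c d]. Qed.
Lemma ReN z : Re (- z) = - Re z.
Proof. by case: z. Qed.
Lemma ImN z : Im (- z) = - Im z.
Proof. by case: z. Qed.
Lemma Re_conj z : Re (conjc z) = Re z.
Proof. by case: z. Qed.
Lemma Im_conj z : Im (conjc z) = - Im z.
Proof. by case: z. Qed.

Lemma normc_norm z : `|z| = (normc z)%:C.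
Proof. by case: z. Qed.

Local Open Scope ring_scope.

Lemma cvg_complexP (T : Type) (F : set_system T) (h : T -> R[i]) (l : R[i]) :
  Filter F ->
  ((h x : R[i]^o) @[x --> F] --> (l : R[i]^o)) <->
  (Re (h x) @[x --> F] --> Re l /\ Im (h x) @[x --> F] --> Im l).
Proof.
move=> FF; split=> [hl|[hr hi]].
  by split; apply/cvgrPdist_lt => e e0;
    have e0' : 0 < e%:C :> R[i] by [rewrite ltcR];
    move/cvgrPdist_lt : hl => /(_ _ e0'); apply: filterS => x;
    rewrite normc_norm ltcR; apply: le_lt_trans;
    [have := Re_le_normc (l - h x); rewrite ReD ReN
    |have := Im_le_normc (l - h x); rewrite ImD ImN].
apply/cvgrPdist_lt => e e0.
have [e1 e2] : 0 < Re e /\ e = (Re e)%:C.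
  by case: e e0 => a b; rewrite ltcE /= => /andP[/eqP -> ->].
have e20 : 0 < Re e / 2 by rewrite divr_gt0.
move/cvgrPdist_lt : hr => /(_ _ e20); move/cvgrPdist_lt : hi => /(_ _ e20).
apply: filterS2 => x h1 h2; rewrite normc_norm e2 ltcR.
apply: le_lt_trans (normc_le _) _; rewrite ReD ImD ReN ImN; lra.
Qed.

Lemma cvg_has_limit (F : set_system R) f (l : R[i]) : ProperFilter F ->
  (f x : R[i]^o) @[x --> F] --> (l : R[i]^o) ->
  has_limit F f /\ limit F f = l.
Proof.
move=> FF fl; split; first by apply/cvg_ex; exists l.
exact: (cvg_lim (@norm_hausdorff _ _) fl).
Qed.

Definition cvgC (F : set_system R) f (l : R[i]) : Prop :=
  (f x : R[i]^o) @[x --> F] --> (l : R[i]^o).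

(** The derivative is an argument here, so that it can be transported between
    functions and sets. *)
Definition has_deriv (D : set R) f x (d : R[i]) : Prop :=
  cvgC (within D x^') (diff_quotient f x) d.

Lemma cvgC_ReIm (F : set_system R) f (l : R[i]) : Filter F ->
  cvgC F f l <-> (Re (f x) @[x --> F] --> Re l /\ Im (f x) @[x --> F] --> Im l).
Proof. exact: cvg_complexP. Qed.

Lemma derivable_on_has_deriv D f x :
  derivable_on D f x -> has_deriv D f x (deriv_on D f x).
Proof. by []. Qed.

Lemma has_deriv_deriv_on D f x (d : R[i]) : ProperFilter (within D x^') ->
  has_deriv D f x d -> derivable_on D f x /\ deriv_on D f x = d.
Proof. by move=> pD /cvg_has_limit[]. Qed.

Lemma has_deriv_transfer D D' f g x (d : R[i]) :
  f x = g x -> (\forall y \near x, D y -> D' y /\ f y = g y) ->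
  has_deriv D' g x d -> has_deriv D f x d.
Proof.
rewrite /has_deriv /cvgC => fgx nr h A hA; have := h A hA.
rewrite /nbhs/= /within/= => {}h.
have nr' : \forall y \near x^', D y -> D' y /\ f y = g y by exact: nbhs_dnbhs.
apply: filterS2 nr' h => y h1 h2 Dy; have [D'y fgy] := h1 Dy.
by have := h2 D'y; rewrite /diff_quotient fgx fgy.
Qed.

(** At interior points, differentiating the two parts separately gives access to
    the rules of real calculus. *)
Definition cderiv f x (d : R[i]) : Prop :=
  is_derive x 1 (fun y => Re (f y)) (Re d) /\
  is_derive x 1 (fun y => Im (f y)) (Im d).

Lemma Re_diff_quotient f x y :
  Re (diff_quotient f x y) = (Re (f y) - Re (f x)) / (y - x).
Proof.
rewrite /diff_quotient -fmorphV ReM ReD ReN /= mulr0 subr0 //.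
Qed.

Lemma Im_diff_quotient f x y :
  Im (diff_quotient f x y) = (Im (f y) - Im (f x)) / (y - x).
Proof.
rewrite /diff_quotient -fmorphV ImM ImD ImN /= mulr0 add0r //.
Qed.

(** Through the slope function of Caratheodory. *)
Lemma is_derive_cvg (h : R -> R) x (d : R) :
  is_derive x 1 h d <-> (h y - h x) / (y - x) @[y --> x^'] --> d.
Proof.
split=> [/is_derive1_caratheodory[g [hg cg <-]]|hd].
  have /continuous_withinNx gx := cg.
  apply: cvg_trans gx; apply: near_eq_cvg; near=> y.
  rewrite hg mulfK// subr_eq0; near: y; exact: nbhs_dnbhs_neq.
apply/is_derive1_caratheodory.
exists (fun y => if y == x then d else (h y - h x) / (y - x)); split.
- move=> z; case: eqP => [->|/eqP zx]; first by rewrite !subrr mulr0.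
  by rewrite divfK// subr_eq0.
- apply/continuous_withinNx; rewrite eqxx; apply: cvg_trans hd.
  apply: near_eq_cvg; near=> y; rewrite ifN//; near: y; exact: nbhs_dnbhs_neq.
- by rewrite eqxx.
Unshelve. all: by end_near. Qed.

Lemma within_nbhs_dnbhs D x : nbhs x D -> within D x^' = x^'.
Proof.
move=> Dx; apply/seteqP; split => A; last by apply: filterS.
rewrite /within/= => h; have : x^' D by exact: nbhs_dnbhs.
by apply: filterS2 h => y DA /DA.
Qed.

Lemma has_deriv_cderiv D f x (d : R[i]) : nbhs x D ->
  has_deriv D f x d <-> cderiv f x d.
Proof.
move=> Dx; rewrite /has_deriv (within_nbhs_dnbhs Dx) cvgC_ReIm.
rewrite /cderiv !is_derive_cvg.
under eq_fun do rewrite Re_diff_quotient.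
by under [in X in _ /\ X]eq_fun do rewrite Im_diff_quotient.
Qed.

Lemma cderiv_near f g x (d : R[i]) : (\forall y \near x, f y = g y) ->
  cderiv f x d -> cderiv g x d.
Proof.
by move=> fg [h1 h2]; split; [apply: near_eq_is_derive h1|
  apply: near_eq_is_derive h2]; apply: filterS fg => y ->.
Qed.

Lemma cderivD f g x (d e : R[i]) : cderiv f x d -> cderiv g x e ->
  cderiv (fun y => f y + g y) x (d + e).
Proof.
move=> [f1 f2] [g1 g2]; split.
  rewrite ReD; under eq_fun do rewrite ReD; exact: is_deriveD.
rewrite ImD; under eq_fun do rewrite ImD; exact: is_deriveD.
Qed.

Lemma cderivN f x (d : R[i]) : cderiv f x d -> cderiv (fun y => - f y) x (- d).
Proof.
move=> [f1 f2]; split.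
  rewrite ReN; under eq_fun do rewrite ReN; exact: is_deriveN.
rewrite ImN; under eq_fun do rewrite ImN; exact: is_deriveN.
Qed.

Lemma cderivM f g x (d e : R[i]) : cderiv f x d -> cderiv g x e ->
  cderiv (fun y => f y * g y) x (d * g x + f x * e).
Proof.
move=> [f1 f2] [g1 g2]; split.
  rewrite ReD !ReM; under eq_fun do rewrite ReM.
  apply: is_derive_eq; rewrite /GRing.scale/=; ring.
rewrite ImD !ImM; under eq_fun do rewrite ImM.
apply: is_derive_eq; rewrite /GRing.scale/=; ring.
Qed.

Lemma cderiv_cst (c : R[i]) x : cderiv (fun=> c) x 0.
Proof. by split; exact: is_derive_cst. Qed.

Lemma cderiv_conj f x (d : R[i]) : cderiv f x d ->
  cderiv (fun y => conjc (f y)) x (conjc d).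
Proof.
move=> [f1 f2]; split.
  by rewrite Re_conj; under eq_fun do rewrite Re_conj.
rewrite Im_conj; under eq_fun do rewrite Im_conj; exact: is_deriveN.
Qed.

End complex_basics.

(** * Complex absolutely continuous functions *)

Section complex_ac.
Context {R : realType}.
Implicit Types (f F : R -> R[i]) (l r : R) (J : set R).
Local Notation Re := (@complex.Re R).
Local Notation Im := (@complex.Im R).
Local Notation normc := (@Normc.normc R).

(** Absolute continuity on a closed interval, for the real and imaginary parts
    separately, so that the real theory applies to each of them. *)
Definition cac l r F :=
  ac_itv l r (fun x => Re (F x)) /\ ac_itv l r (fun x => Im (F x)).

(** Members of a nonoverlapping list have disjoint interiors, hence form an
    admissible indexed family. *)
Lemma abs_cont_seq J f (e : R) : abs_cont J f -> 0 < e -> exists2 d, 0 < d &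
  forall s : seq (R * R), (forall p, p \in s -> p.1 <= p.2) ->
    (forall p, p \in s -> `[p.1, p.2]%classic `<=` J) ->
    pairwise nonoverlapping s ->
    \sum_(p <- s) (p.2 - p.1) < d ->
    \sum_(p <- s) normc (f p.2 - f p.1) < e.
Proof.
move=> acf e0; have [d d0 fd] := acf _ e0; exists d => // s sle sJ sno sd.
pose p0 : R * R := (0, 0).
pose S (i : 'I_(size s)) := (nth p0 s i).1.
pose T (i : 'I_(size s)) := (nth p0 s i).2.
have := fd (size s) S T; rewrite (big_nth p0) big_mkord.
rewrite (big_nth p0) big_mkord in sd; apply => //.
  by move=> i; split; [apply: sle|apply: sJ]; exact: mem_nth.
apply/trivIsetP => i j _ _ ij.
have /(pairwiseP p0) := sno => sno'.
wlog lij : i j ij / (i < j)%N.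
  move=> h; have /orP[|ji] : (i < j)%N || (j < i)%N by rewrite -neq_ltn.
    by move=> ?; apply: h.
  by rewrite setIC; apply: h; rewrite // eq_sym.
have := sno' i j (ltn_ord i) (ltn_ord j) lij.
rewrite -/(S i) /nonoverlapping => no; apply/seteqP; split => x //=.
rewrite !in_itv/= /S /T => -[/andP[h1 h2] /andP[h3 h4]].
by case/or4P : no; lra.
Qed.

(** Moves [[l, r]] into its interior, and tends to the identity as [h] tends to
    [0]. *)
Let shrink l r (h x : R) := clamp (l + h) (r - h) x.

(** The bound is known for intervals inside [J]; a family in [[l, r]] is the
    limit of its images under [shrink], and [F] is continuous up to the end
    points. The real and imaginary parts are the two intended choices of [g]. *)
Lemma ac_of_abs_cont l r J f (g : R[i] -> R) (F : R -> R) :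
  l < r -> abs_cont J f -> `]l, r[%classic `<=` J ->
  (forall z w, `|g z - g w| <= normc (z - w)) ->
  (forall x, l < x < r -> F x = g (f x)) ->
  F y @[y --> l^'+] --> F l -> F y @[y --> r^'-] --> F r -> ac_itv l r F.
Proof.
move=> lr acf lrJ g1 Ff Fl Fr e e0.
have [d d0 fd] := abs_cont_seq acf e0; exists d => // s /andP[/allP ss sno] sd.
have shl x : l <= x <= r -> F (shrink l r h x) @[h --> 0^'+] --> F x.
  move=> /andP[lx xr]; apply/cvgrPdist_lt => eps eps0.
  move/cvgrPdist_lt : Fl => /(_ _ eps0); rewrite near_withinE => /nbhs_ballP[d1 /= d10 hd1].
  move/cvgrPdist_lt : Fr => /(_ _ eps0); rewrite near_withinE => /nbhs_ballP[d2 /= d20 hd2].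
  move: lx xr; rewrite le_eqVlt => /predU1P[<-|lx].
    move=> _; near=> h; have h0 : 0 < h by near: h; exact: nbhs_right_gt.
    have hlr : h < r - l by near: h; apply: nbhs_right_lt; rewrite subr_gt0.
    have hd : h < d1 by near: h; exact: nbhs_right_lt.
    rewrite /shrink /clamp (min_idPl _) ?(max_idPl _); [|lra|lra].
    apply: hd1; last by lra.
    by rewrite /ball/= opprD addNKr normrN gtr0_norm.
  rewrite le_eqVlt => /predU1P[->|xr].
    near=> h; have h0 : 0 < h by near: h; exact: nbhs_right_gt.
    have hlr : h < (r - l) / 2.
      by near: h; apply: nbhs_right_lt; rewrite divr_gt0// subr_gt0.
    have hd : h < d2 by near: h; exact: nbhs_right_lt.
    rewrite /shrink /clamp (min_idPr _) ?(max_idPr _); [|lra|lra].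
    apply: hd2; last by lra.
    by rewrite /ball/= opprB addrC subrK gtr0_norm.
  near=> h; have h0 : 0 < h by near: h; exact: nbhs_right_gt.
  have hlx : h < x - l by near: h; apply: nbhs_right_lt; rewrite subr_gt0.
  have hxr : h < r - x by near: h; apply: nbhs_right_lt; rewrite subr_gt0.
  by rewrite /shrink /clamp (min_idPl _) ?(max_idPr _) ?subrr ?normr0//; lra.
pose Sh h := \sum_(p <- s) `|F (shrink l r h p.2) - F (shrink l r h p.1)|.
have Shcvg : Sh h @[h --> 0^'+] --> \sum_(p <- s) `|F p.2 - F p.1|.
  rewrite /Sh; elim: s ss {sno sd Sh} => [|p s IH] ss.
    by rewrite big_nil; under eq_fun do rewrite big_nil; exact: cvg_cst.
  rewrite big_cons; under eq_fun do rewrite big_cons.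
  have /and3P[lp pp pr] : [&& l <= p.1, p.1 <= p.2 & p.2 <= r].
    by apply: ss; rewrite inE eqxx.
  apply: cvgD; last by apply: IH => q qs; apply: ss; rewrite inE qs orbT.
  apply: cvg_norm; apply: cvgB; apply: shl.
    by rewrite pr (le_trans lp pp).
  by rewrite lp (le_trans pp pr).
rewrite -(cvg_lim _ Shcvg)//; apply: limr_le.
  by apply/cvg_ex; eexists; exact: Shcvg.
near=> h; have h0 : 0 < h by near: h; exact: nbhs_right_gt.
have hlr : h < (r - l) / 2.
  by near: h; apply: nbhs_right_lt; rewrite divr_gt0// subr_gt0.
have shrin x : l < shrink l r h x < r.
  by rewrite /shrink /clamp lt_max gt_max gt_min; apply/andP; split; lra.
pose sh (p : R * R) := (shrink l r h p.1, shrink l r h p.2).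
have sh_le x y : x <= y -> shrink l r h x <= shrink l r h y.
  exact: clamp_homo.
apply: (@le_trans _ _ (\sum_(p <- map sh s) normc (f p.2 - f p.1))).
  rewrite big_map /Sh; apply: ler_sum => p _ /=; rewrite !Ff ?shrin//; exact: g1.
apply/ltW/fd.
- by move=> _ /mapP[p ps ->] /=; apply: sh_le; have /and3P[] := ss _ ps.
- move=> _ /mapP[p ps ->] x; rewrite /= in_itv/= => /andP[h1 h2]; apply: lrJ.
  have /andP[h3 _] := shrin p.1; have /andP[_ h4] := shrin p.2.
  by rewrite /= in_itv/= (lt_le_trans h3 h1) (le_lt_trans h2 h4).
- rewrite pairwise_map; apply: sub_pairwise sno => p q; rewrite /relpre.
  by rewrite /nonoverlapping /= => /or4P[] /sh_le ->; rewrite ?orbT.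
rewrite big_map; apply: le_lt_trans sd; rewrite big_seq [leRHS]big_seq.
apply: ler_sum => p ps /=; have /and3P[lp pp pr] := ss _ ps.
have lhr : l + h <= r - h by lra.
exact: clamp_lip lhr pp.
Unshelve. all: by end_near. Qed.

Lemma abs_cont_of_cac l r J f F : J `<=` `[l, r]%classic ->
  (forall x, J x -> f x = F x) -> cac l r F -> abs_cont J f.
Proof.
move=> Jlr fF [acr aci] e e0; have e30 : 0 < e / 3 by rewrite divr_gt0.
have [d1 d10 h1] := acr _ e30; have [d2 d20 h2] := aci _ e30.
exists (Num.min d1 d2) => [|n S T STJ tST]; first by rewrite lt_min d10.
pose s := [seq (S i, T i) | i <- enum 'I_n].
have SJ i : J (S i) by have [+ h] := STJ i => h'; apply: h; rewrite /= in_itv/= lexx.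
have TJ i : J (T i) by have [+ h] := STJ i => h'; apply: h; rewrite /= in_itv/= lexx andbT.
have ss : subintervals l r s.
  apply/andP; split.
    apply/allP => _ /mapP[i _ ->] /=; have [-> _] := STJ i; rewrite /= andbC.
    have := Jlr _ (SJ i); have := Jlr _ (TJ i); rewrite /= !in_itv/=.
    by move=> /andP[_ ->] /andP[-> _].
  rewrite pairwise_map; have := enum_uniq 'I_n; rewrite uniq_pairwise.
  apply: sub_pairwise => i j /= ij; rewrite /relpre /=.
  apply/negPn/negP; rewrite /nonoverlapping !negb_or -!ltNge/= => /and4P[k1 k2 k3 k4].
  have : `]S i, T i[%classic `&` `]S j, T j[%classic = set0.
    by move/trivIsetP : tST; apply=> //.
  set m := Num.max (S i) (S j); set M := Num.min (T i) (T j).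
  have mM : m < M by rewrite gt_max !lt_min k1 k2 k3 k4 //=.
  have [m1 m2] : S i <= m /\ S j <= m by rewrite !le_max !lexx orbT.
  have [M1 M2] : M <= T i /\ M <= T j by rewrite !ge_min !lexx orbT.
  move/seteqP => [/(_ ((m + M) / 2)) + _]; apply=> /=; rewrite !in_itv/=.
  by split; apply/andP; split; lra.
rewrite lt_min => /andP[sd1 sd2].
have sE (h : R * R -> R) : \sum_(p <- s) h p = \sum_(i < n) h (S i, T i).
  by rewrite /s big_map big_enum.
have := h1 _ ss; have := h2 _ ss; rewrite !sE/= => /(_ sd2) k2 /(_ sd1) k1.
apply: (@le_lt_trans _ _ (e / 3 + e / 3)); last by lra.
apply: le_trans (lerD k1 k2); rewrite -big_split/=; apply: ler_sum => i _.
by rewrite !fF// -ReN -ReD -ImN -ImD; exact: normc_le.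
Qed.

Lemma abs_cont_cvg_right J f (x y : R) : x < y -> `[x, y]%classic `<=` J ->
  abs_cont J f -> cvgC x^'+ f (f x).
Proof.
move=> xy xyJ acf; apply/cvgrPdist_lt => e e0.
have [e1 e2] : 0 < Re e /\ e = (Re e)%:C.
  by case: e e0 => a b; rewrite ltcE /= => /andP[/eqP -> ->].
have [d d0 fd] := abs_cont_seq acf e1; near=> z.
have xz : x < z by near: z; exact: nbhs_right_gt.
have zy : z < y by near: z; exact: nbhs_right_lt.
have zd : z < x + d by near: z; apply: nbhs_right_lt; rewrite ltrDl.
rewrite distrC normc_norm e2 ltcR; have := fd [:: (x, z)].
rewrite !big_cons !big_nil /= !addr0; apply => //.
- by move=> p; rewrite inE => /eqP ->; exact: ltW.
- move=> p; rewrite inE => /eqP -> t; rewrite /= in_itv/= => /andP[xt tz].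
  by apply: xyJ; rewrite /= in_itv/= xt (le_trans tz (ltW zy)).
- by lra.
Unshelve. all: by end_near. Qed.

Lemma abs_cont_cvg_left J f (x y : R) : x < y -> `[x, y]%classic `<=` J ->
  abs_cont J f -> cvgC y^'- f (f y).
Proof.
move=> xy xyJ acf; apply/cvgrPdist_lt => e e0.
have [e1 e2] : 0 < Re e /\ e = (Re e)%:C.
  by case: e e0 => a b; rewrite ltcE /= => /andP[/eqP -> ->].
have [d d0 fd] := abs_cont_seq acf e1; near=> z.
have zy : z < y by near: z; exact: nbhs_left_lt.
have xz : x < z by near: z; exact: nbhs_left_gt.
have zd : y - d < z by near: z; apply: nbhs_left_gt; rewrite ltrBlDr ltrDl.
rewrite normc_norm e2 ltcR; have := fd [:: (z, y)].
rewrite !big_cons !big_nil /= !addr0; apply => //.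
- by move=> p; rewrite inE => /eqP ->; exact: ltW.
- move=> p; rewrite inE => /eqP -> t; rewrite /= in_itv/= => /andP[zt ty].
  by apply: xyJ; rewrite /= in_itv/= ty (le_trans (ltW xz) zt).
- by lra.
Unshelve. all: by end_near. Qed.

Lemma cacD l r F G : cac l r F -> cac l r G -> cac l r (fun x => F x + G x).
Proof.
move=> [F1 F2] [G1 G2]; split.
  by under eq_fun do rewrite ReD; exact: ac_itvD.
by under eq_fun do rewrite ImD; exact: ac_itvD.
Qed.

Lemma cacN l r F : cac l r F -> cac l r (fun x => - F x).
Proof.
move=> [F1 F2]; split.
  by under eq_fun do rewrite ReN; exact: ac_itvN.
by under eq_fun do rewrite ImN; exact: ac_itvN.
Qed.

Lemma cacM l r F G : l <= r -> cac l r F -> cac l r G ->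
  cac l r (fun x => F x * G x).
Proof.
move=> lr [F1 F2] [G1 G2]; split.
  by under eq_fun do rewrite ReM; apply: ac_itvB; exact: ac_itvM.
by under eq_fun do rewrite ImM; apply: ac_itvD; exact: ac_itvM.
Qed.

Lemma cac_cst l r (c : R[i]) : cac l r (fun=> c).
Proof. by split; exact: ac_cst. Qed.

Lemma cac_conj l r F : cac l r F -> cac l r (fun x => conjc (F x)).
Proof.
move=> [F1 F2]; split.
  by under eq_fun do rewrite Re_conj.
by under eq_fun do rewrite Im_conj; exact: ac_itvN.
Qed.

End complex_ac.

(** * Square integrable functions *)

Section square_integrable.
Context {R : realType}.
Implicit Types (D : set R) (f g : R -> R[i]).
Notation mu := (@lebesgue_measure R).
Local Notation Re := (@complex.Re R).
Local Notation Im := (@complex.Im R).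
Local Notation normc := (@Normc.normc R).

Lemma intRD D (h k : R -> R) : measurable D -> mu.-integrable D (EFin \o h) ->
  mu.-integrable D (EFin \o k) -> mu.-integrable D (EFin \o (fun x => h x + k x)).
Proof. by move=> mD ih ik; exact: (@integrableD _ _ _ mu D mD _ _ ih ik). Qed.

Lemma intRB D (h k : R -> R) : measurable D -> mu.-integrable D (EFin \o h) ->
  mu.-integrable D (EFin \o k) -> mu.-integrable D (EFin \o (fun x => h x - k x)).
Proof. by move=> mD ih ik; exact: (@integrableB _ _ _ mu D mD _ _ ih ik). Qed.

Lemma intRZ D (c : R) (h : R -> R) : measurable D ->
  mu.-integrable D (EFin \o h) -> mu.-integrable D (EFin \o (fun x => c * h x)).
Proof. by move=> mD ih; exact: (@integrableZl _ _ _ mu D mD c _ ih). Qed.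

Lemma intR_cst D (c : R) : measurable D -> (mu D < +oo)%E ->
  mu.-integrable D (EFin \o (fun=> c)).
Proof.
move=> mD Doo; apply/integrableP; split; first exact/measurable_EFinP.
rewrite (_ : (fun _ => _) = cst `|c|%:E)// integral_cst// lte_mul_pinfty//.
Qed.

Lemma measurable_sqr_normc D f : measurable D ->
  measurable_fun D (fun x => Re (f x)) -> measurable_fun D (fun x => Im (f x)) ->
  measurable_fun D (fun x => normc (f x) ^+ 2).
Proof.
move=> mD fr fi; under eq_fun do rewrite sqr_normc.
by apply: measurable_funD; apply: measurable_funX.
Qed.

Lemma L2_integrable D f : measurable D -> L2 D f ->
  mu.-integrable D (EFin \o (fun x => normc (f x) ^+ 2)).
Proof.
move=> mD [fr fi foo]; apply/integrableP; split.
  by apply/measurable_EFinP; exact: measurable_sqr_normc.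
apply: le_lt_trans foo; rewrite le_eqVlt; apply/orP; left; apply/eqP.
by apply: eq_integral => x _ /=; rewrite ger0_norm// sqr_ge0.
Qed.

Lemma integrable_L2 D f :
  measurable_fun D (fun x => Re (f x)) -> measurable_fun D (fun x => Im (f x)) ->
  mu.-integrable D (EFin \o (fun x => normc (f x) ^+ 2)) -> L2 D f.
Proof.
move=> fr fi /integrableP[_ foo]; split => //; apply: le_lt_trans foo.
rewrite le_eqVlt; apply/orP; left; apply/eqP.
by apply: eq_integral => x _ /=; rewrite ger0_norm// sqr_ge0.
Qed.

Lemma L2_subset D D' f : measurable D -> measurable D' -> D' `<=` D ->
  L2 D f -> L2 D' f.
Proof.
move=> mD mD' sub L; have ff := L2_integrable mD L; case: L => fr fi _.
apply: integrable_L2; [exact: measurable_funS fr|exact: measurable_funS fi|].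
exact: integrableS ff.
Qed.

Lemma integrable_dominated D (h k : R -> R) : measurable D ->
  measurable_fun D h -> mu.-integrable D (EFin \o k) ->
  (forall x, D x -> `|h x| <= k x) -> mu.-integrable D (EFin \o h).
Proof.
move=> mD mh ik hk; apply: (@le_integrable _ _ _ mu D mD _ _ _ _ ik); first exact/measurable_EFinP.
by move=> x Dx /=; rewrite lee_fin (le_trans (hk _ Dx))// ler_norm.
Qed.

(** From the pointwise bound [|f g| <= |f|^2 + |g|^2]. *)
Lemma L2_mul_integrable D f g : measurable D -> L2 D f -> L2 D g ->
  mu.-integrable D (EFin \o (fun x => Re (f x * g x))) /\
  mu.-integrable D (EFin \o (fun x => Im (f x * g x))).
Proof.
move=> mD Lf Lg; have ff := L2_integrable mD Lf; have gg := L2_integrable mD Lg.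
case: Lf Lg => fr fi _ [gr gi _].
have fg : mu.-integrable D (EFin \o (fun x => normc (f x) ^+ 2 + normc (g x) ^+ 2)).
  exact: intRD.
have bnd x : `|Re (f x * g x)| <= normc (f x) ^+ 2 + normc (g x) ^+ 2 /\
    `|Im (f x * g x)| <= normc (f x) ^+ 2 + normc (g x) ^+ 2.
  rewrite !sqr_normc ReM ImM !ler_norml.
  move: (Re (f x)) (Im (f x)) (Re (g x)) (Im (g x)) => a b c d.
  have := sqr_ge0 (a + c); have := sqr_ge0 (a - c).
  have := sqr_ge0 (b + d); have := sqr_ge0 (b - d).
  have := sqr_ge0 (a + d); have := sqr_ge0 (a - d).
  have := sqr_ge0 (b + c); have := sqr_ge0 (b - c).
  have := sqr_ge0 a; have := sqr_ge0 b; have := sqr_ge0 c; have := sqr_ge0 d.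
  move=> *; split; apply/andP; split; nra.
split; apply: integrable_dominated fg _ => //.
- under eq_fun do rewrite ReM.
  by apply: measurable_funB; exact: measurable_funM.
- by move=> x _; have [] := bnd x.
- under eq_fun do rewrite ImM.
  by apply: measurable_funD; exact: measurable_funM.
- by move=> x _; have [] := bnd x.
Qed.

Lemma L2_conj D f : L2 D f -> L2 D (fun x => conjc (f x)).
Proof.
move=> [fr fi foo]; split.
- by under eq_fun do rewrite Re_conj.
- under eq_fun do rewrite Im_conj; exact: measurableT_comp (@oppr_measurable R setT) fi.
- apply: le_lt_trans foo; rewrite le_eqVlt; apply/orP; left; apply/eqP.
  by apply: eq_integral => x _; rewrite !sqr_normc Re_conj Im_conj sqrrN.
Qed.

Lemma L2D D f g : measurable D -> L2 D f -> L2 D g -> L2 D (fun x => f x + g x).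
Proof.
move=> mD Lf Lg; have ff := L2_integrable mD Lf; have gg := L2_integrable mD Lg.
case: Lf Lg => fr fi _ [gr gi _].
have fg : mu.-integrable D
    (EFin \o (fun x => 2 * (normc (f x) ^+ 2 + normc (g x) ^+ 2))).
  by apply: intRZ => //; exact: intRD.
have mr : measurable_fun D (fun x => Re (f x + g x)).
  by under eq_fun do rewrite ReD; exact: measurable_funD.
have mi : measurable_fun D (fun x => Im (f x + g x)).
  by under eq_fun do rewrite ImD; exact: measurable_funD.
apply: integrable_L2 => //; apply: integrable_dominated fg _ => //.
  exact: measurable_sqr_normc.
move=> x _; rewrite ger0_norm ?sqr_ge0// !sqr_normc ReD ImD.
by have := sqr_ge0 (Re (f x) - Re (g x)); have := sqr_ge0 (Im (f x) - Im (g x)); nra.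
Qed.

Lemma L2_bounded D f (M : R) : measurable D -> (mu D < +oo)%E ->
  measurable_fun D (fun x => Re (f x)) -> measurable_fun D (fun x => Im (f x)) ->
  (forall x, D x -> normc (f x) <= M) -> L2 D f.
Proof.
move=> mD Doo fr fi fM; apply: integrable_L2 => //.
apply: (@integrable_dominated D _ (fun=> M ^+ 2)) => //.
- exact: measurable_sqr_normc.
- exact: intR_cst.
- move=> x Dx; rewrite ger0_norm ?sqr_ge0// ler_sqr ?nnegrE ?normc_ge0 ?fM//.
  exact: le_trans (normc_ge0 _) (fM _ Dx).
Qed.

Lemma L2_mul_bounded D f g (M : R) : measurable D ->
  measurable_fun D (fun x => Re (f x)) -> measurable_fun D (fun x => Im (f x)) ->
  (forall x, D x -> normc (f x) <= M) -> L2 D g -> L2 D (fun x => f x * g x).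
Proof.
move=> mD fr fi fM Lg; have gg := L2_integrable mD Lg; case: Lg => gr gi _.
have mr : measurable_fun D (fun x => Re (f x * g x)).
  under eq_fun do rewrite ReM.
  by apply: measurable_funB; exact: measurable_funM.
have mi : measurable_fun D (fun x => Im (f x * g x)).
  under eq_fun do rewrite ImM.
  by apply: measurable_funD; exact: measurable_funM.
apply: integrable_L2 => //.
apply: (@integrable_dominated D _ (fun x => M ^+ 2 * normc (g x) ^+ 2)) => //.
- exact: measurable_sqr_normc.
- exact: intRZ.
- move=> x Dx; rewrite ger0_norm ?sqr_ge0// !sqr_normc ReM ImM.
  have : Re (f x) ^+ 2 + Im (f x) ^+ 2 <= M ^+ 2.
    rewrite -sqr_normc ler_sqr ?nnegrE ?normc_ge0 ?fM//.
    exact: le_trans (normc_ge0 _) (fM _ Dx).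
  move: (Re (f x)) (Im (f x)) (Re (g x)) (Im (g x)) => a b c d h.
  rewrite (_ : _ + _ = (a ^+ 2 + b ^+ 2) * (c ^+ 2 + d ^+ 2)); last by ring.
  by apply: ler_wpM2r => //; rewrite addr_ge0 ?sqr_ge0.
Qed.

Lemma L2Z D f (c : R[i]) : measurable D -> L2 D f -> L2 D (fun x => c * f x).
Proof. by move=> mD Lf; apply: (@L2_mul_bounded D (fun=> c) f (normc c)). Qed.

Lemma L2N D f : measurable D -> L2 D f -> L2 D (fun x => - f x).
Proof.
by move=> mD /(L2Z (- 1) mD); congr L2; apply/funext => x; rewrite mulN1r.
Qed.

Lemma L2B D f g : measurable D -> L2 D f -> L2 D g -> L2 D (fun x => f x - g x).
Proof. by move=> mD Lf Lg; apply: L2D => //; exact: L2N. Qed.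

Lemma mu_itv_fin (l r : R) : (mu `[l, r] < +oo)%E.
Proof. by rewrite lebesgue_measure_itv/=; case: ifP; rewrite ?ltry. Qed.

End square_integrable.

(** * The Green identity on one interval *)

Section pieces.
Context {R : realType}.
Implicit Types (f F v : R -> R[i]) (l r : R).
Notation mu := (@lebesgue_measure R).
Local Notation Re := (@complex.Re R).
Local Notation Im := (@complex.Im R).
Local Notation normc := (@Normc.normc R).

Lemma cac_measurable l r F : cac l r F ->
  measurable_fun `[l, r] (fun x => Re (F x)) /\
  measurable_fun `[l, r] (fun x => Im (F x)).
Proof.
by move=> [F1 F2]; split; apply: subspace_continuous_measurable_fun => //;
  exact: ac_within_continuous.
Qed.

Lemma cac_bounded l r F : l <= r -> cac l r F ->
  exists2 M, 0 <= M & forall x, l <= x -> x <= r -> normc (F x) <= M.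
Proof.
move=> lr [F1 F2]; have [M1 M10 h1] := ac_bounded lr F1.
have [M2 M20 h2] := ac_bounded lr F2.
exists (M1 + M2) => [|x lx xr]; first exact: addr_ge0.
by apply: le_trans (normc_le _) (lerD _ _); [exact: h1|exact: h2].
Qed.

Lemma cac_L2 l r F : l <= r -> cac l r F -> L2 `[l, r] F.
Proof.
move=> lr cF; have [m1 m2] := cac_measurable cF; have [M M0 FM] := cac_bounded lr cF.
apply: (@L2_bounded _ _ _ M) => //; first exact: mu_itv_fin.
by move=> x; rewrite /= in_itv/= => /andP[]; exact: FM.
Qed.

Lemma cac_ae_derivable l r F : l <= r -> cac l r F ->
  {ae mu, forall x, l < x < r -> exists d, cderiv F x d}.
Proof.
move=> lr [F1 F2].
apply: ae_imp2 (ac_ae_derivable lr F1) (ac_ae_derivable lr F2).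
move=> x h1 h2 lxr; have := h1 lxr; have := h2 lxr.
move=> /derivableP d2 /derivableP d1.
by exists (('D_1 (fun y => Re (F y)) x) +i* ('D_1 (fun y => Im (F y)) x)).
Qed.

(** Solutions of [- f'' + q f = v] on an interval closed at both ends: [f1] is
    the derivative of [f], and the equation holds almost everywhere. *)
Definition sol_piece l r (q : R -> R) f f1 v :=
  [/\ cac l r f, cac l r f1, forall x, l < x < r -> cderiv f x (f1 x) &
      {ae mu, forall x, l < x < r ->
        exists2 d, cderiv f1 x d & v x = - d + (q x)%:C * f x}].

Lemma sol_pieceB l r q f f1 v g g1 w :
  sol_piece l r q f f1 v -> sol_piece l r q g g1 w ->
  sol_piece l r q (fun x => f x - g x) (fun x => f1 x - g1 x)
    (fun x => v x - w x).
Proof.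
move=> [f_ f1_ df dv] [g_ g1_ dg dw]; split.
- by apply: cacD => //; exact: cacN.
- by apply: cacD => //; exact: cacN.
- by move=> x lxr; apply: cderivD; [exact: df|apply: cderivN; exact: dg].
- apply: ae_imp2 dv dw => x h1 h2 lxr.
  have [d d1 ->] := h1 lxr; have [e e1 ->] := h2 lxr.
  exists (d - e); first by apply: cderivD => //; exact: cderivN.
  by ring.
Qed.

Let green_algebra (d g u : R[i]) (s : R) :
  Im (d * conjc u + g * conjc g) = (- 1) * Im ((- d + s%:C * u) * conjc u).
Proof. by case: d g u => [? ?] [? ?] [? ?] /=; ring. Qed.

(** As [q |f|^2] and [|f'|^2] are real, [Im (v conj f)] is the derivative of
    [- Im (f' conj f)] almost everywhere. *)
Lemma sol_piece_green l r q f f1 v : l <= r -> sol_piece l r q f f1 v ->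
  L2 `[l, r] v ->
  \int[mu]_(x in `[l, r]) Im (v x * conjc (f x)) =
  Im (f1 l * conjc (f l)) - Im (f1 r * conjc (f r)).
Proof.
move=> lr [f_ f1_ df dv] Lv.
have Lf : L2 `[l, r] (fun x => conjc (f x)) by apply/L2_conj/cac_L2.
have [_ iv] := L2_mul_integrable (measurable_itv _) Lv Lf.
have [_ acG] : cac l r (fun x => f1 x * conjc (f x)).
  by apply: cacM => //; exact: cac_conj.
have iNv : mu.-integrable `[l, r] (EFin \o (fun x => (- 1) * Im (v x * conjc (f x)))).
  exact: intRZ.
have := ac_FTC2 lr acG iNv; rewrite RintegralZl// mulN1r => h.
apply/eqP; rewrite -eqr_opp -h ?opprB//; apply: ae_imp dv => x dvx lxr e de.
have [d f1d vE] := dvx lxr.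
have [_ dG] := cderivM f1d (cderiv_conj (df _ lxr)).
have <- := derive_val (is_derive := de); rewrite (derive_val (is_derive := dG)).
by rewrite vE; exact: green_algebra.
Qed.

End pieces.

(** * The energy estimate across the transmission point *)

Section energy.
Context {R : realType}.
Implicit Types (h k : R -> R).
Notation mu := (@lebesgue_measure R).
Local Notation Re := (@complex.Re R).
Local Notation Im := (@complex.Im R).
Local Notation normc := (@Normc.normc R).
Variable P : problem R.
Hypothesis hP : standing P.

Local Notation a := (pa P).
Local Notation b := (pb P).
Local Notation c := (pc P).
Local Notation gg := (gamma1 P * gamma2 P).
Local Notation dd := (delta1 P * delta2 P).

Let lac : a < c := lt_ac hP.
Let lcb : c < b := lt_cb hP.

Lemma sub_left : `[a, c]%classic `<=` `[a, b]%classic.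
Proof. by apply: subset_itvl; rewrite bnd_simp ltW. Qed.

Lemma sub_right : `[c, b]%classic `<=` `[a, b]%classic.
Proof. by apply: subset_itvr; rewrite bnd_simp ltW. Qed.

(** The weighted integral occurring in the inner product of [H_1]. *)
Definition wint h := gg * (\int[mu]_(x in `[a, c]) h x) +
  dd * (\int[mu]_(x in `[c, b]) h x).

Local Notation intab h := (mu.-integrable `[a, b] (EFin \o h)).

Lemma intab_left h : intab h -> mu.-integrable `[a, c] (EFin \o h).
Proof. by apply: integrableS => //; exact: sub_left. Qed.

Lemma intab_right h : intab h -> mu.-integrable `[c, b] (EFin \o h).
Proof. by apply: integrableS => //; exact: sub_right. Qed.

Lemma wintD h k : intab h -> intab k -> wint (fun x => h x + k x) = wint h + wint k.
Proof.
move=> ih ik; rewrite /wint !RintegralD//; first ring;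
  by [exact: intab_left|exact: intab_right].
Qed.

Lemma wintZ (m : R) h : intab h -> wint (fun x => m * h x) = m * wint h.
Proof.
move=> ih; rewrite /wint !RintegralZl//; first ring;
  by [exact: intab_left|exact: intab_right].
Qed.

Lemma le_wint h k : intab h -> intab k -> (forall x, h x <= k x) -> wint h <= wint k.
Proof.
move=> ih ik hk; apply: lerD; apply: ler_wpM2l.
- exact/ltW/(gamma_gt0 hP).
- by apply: le_Rintegral => //; exact: intab_left.
- exact/ltW/(delta_gt0 hP).
- by apply: le_Rintegral => //; exact: intab_right.
Qed.

Definition sqnorm (U : H1rep R) : R :=
  wint (fun x => normc (U.1 x) ^+ 2) + dd / rho P * normc U.2 ^+ 2.

Lemma H1norm_sqnorm U : H1norm P U = Num.sqrt (sqnorm U).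
Proof.
rewrite /H1norm; congr Num.sqrt; rewrite /H1inner /sqnorm /wint /Cintegral.
rewrite !gtr0_norm ?(gamma_gt0 hP) ?(delta_gt0 hP)//.
have E (z : R[i]) : Re (z * conjc z) = normc z ^+ 2.
  by rewrite sqr_normc ReM Re_conj Im_conj; ring.
rewrite !ReD !ReM /= !mul0r !subr0; congr (_ + _).
  by congr (_ * _ + _ * _); apply: eq_Rintegral => x _; rewrite E.
by rewrite -ReM E.
Qed.

(** The conditions at [a] and [c] defining the domain of [A], for the two
    continuous extensions [fl] and [fr] of an element to [[a, c]] and [[c, b]],
    with derivatives [fl1] and [fr1] and image [v] under [tau]. *)
Definition dom_pieces fl fl1 fr fr1 (v : R -> R[i]) : Prop :=
  [/\ sol_piece a c (q P) fl fl1 v, sol_piece c b (q P) fr fr1 v,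
      (alpha1 P)%:C * fl a + (alpha2 P)%:C * fl1 a = 0,
      (gamma1 P)%:C * fl c = (delta1 P)%:C * fr c &
      (gamma2 P)%:C * fl1 c = (delta2 P)%:C * fr1 c].

(** The concomitant [Im (f' conj f)] vanishes at [a], and its weighted jump
    at [c] is zero, so only its value at [b] is left. *)
Lemma wint_dom_pieces fl fl1 fr fr1 v (u : R -> R[i]) :
  dom_pieces fl fl1 fr fr1 v -> L2 `[a, b] v ->
  {ae mu, forall x, a < x < c -> u x = fl x} ->
  {ae mu, forall x, c < x < b -> u x = fr x} -> L2 `[a, b] u ->
  wint (fun x => Im (v x * conjc (u x))) = - (dd * Im (fr1 b * conjc (fr b))).
Proof.
move=> [sl sr bca tc tc1] Lv ul ur Lu.
have Lvl : L2 `[a, c] v by apply: L2_subset Lv => //; exact: sub_left.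
have Lvr : L2 `[c, b] v by apply: L2_subset Lv => //; exact: sub_right.
have Lul : L2 `[a, c] u by apply: L2_subset Lu => //; exact: sub_left.
have Lur : L2 `[c, b] u by apply: L2_subset Lu => //; exact: sub_right.
have [fl_ _ _ _] := sl; have [fr_ _ _ _] := sr.
have il (g : R -> R[i]) l r : L2 `[l, r] v -> L2 `[l, r] g ->
    mu.-integrable `[l, r] (EFin \o (fun x => Im (v x * conjc (g x)))).
  by move=> h1 /L2_conj h2; have [] := L2_mul_integrable (measurable_itv _) h1 h2.
have El : \int[mu]_(x in `[a, c]) Im (v x * conjc (u x)) =
    \int[mu]_(x in `[a, c]) Im (v x * conjc (fl x)).
  apply: ae_eq_Rintegral; [exact: il|apply: il => //; exact/cac_L2/fl_/ltW|].
  by apply: ae_imp ul => x h lx; rewrite h.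
have Er : \int[mu]_(x in `[c, b]) Im (v x * conjc (u x)) =
    \int[mu]_(x in `[c, b]) Im (v x * conjc (fr x)).
  apply: ae_eq_Rintegral; [exact: il|apply: il => //; exact/cac_L2/fr_/ltW|].
  by apply: ae_imp ur => x h lx; rewrite h.
rewrite /wint El Er (sol_piece_green (ltW lac) sl Lvl).
rewrite (sol_piece_green (ltW lcb) sr Lvr).
(* The nonzero real vector (alpha1, alpha2) is orthogonal to the real and the
   imaginary part of (fl a, fl1 a), which are therefore proportional. *)
have -> : Im (fl1 a * conjc (fl a)) = 0.
  apply/eqP/negPn/negP => W0; apply: (alpha_neq0 hP).
  move: bca W0; move: (fl a) (fl1 a) => [r s] [r1 s1] /= [] e1 e2 /eqP W0.
  congr pair; apply/eqP; apply: contra_notT W0 => n0; apply: (mulfI n0).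
    rewrite mulr0; have e3 : alpha1 P * r = - (alpha2 P * r1) by lra.
    have e4 : alpha1 P * s = - (alpha2 P * s1) by lra.
    transitivity (s1 * (alpha1 P * r) - r1 * (alpha1 P * s)); first by ring.
    by rewrite e3 e4; ring.
  rewrite mulr0; have e3 : alpha2 P * r1 = - (alpha1 P * r) by lra.
  have e4 : alpha2 P * s1 = - (alpha1 P * s) by lra.
  transitivity ((alpha2 P * s1) * r - (alpha2 P * r1) * s); first by ring.
  by rewrite e3 e4; ring.
have jump : gg * Im (fl1 c * conjc (fl c)) = dd * Im (fr1 c * conjc (fr c)).
  move: tc tc1; move: (fl c) (fl1 c) (fr c) (fr1 c).
  move=> [r s] [r1 s1] [r' s'] [r1' s1'] /= [] e1 e2 [] e3 e4.
  have {}e1 : gamma1 P * r = delta1 P * r' by lra.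
  have {}e2 : gamma1 P * s = delta1 P * s' by lra.
  have {}e3 : gamma2 P * r1 = delta2 P * r1' by lra.
  have {}e4 : gamma2 P * s1 = delta2 P * s1' by lra.
  transitivity ((gamma2 P * s1) * (gamma1 P * r) - (gamma2 P * r1) * (gamma1 P * s)).
    by ring.
  by rewrite e1 e2 e3 e4; ring.
by rewrite sub0r mulrN jump; ring.
Qed.

(** The value at [b] left by [wint_dom_pieces] is the one produced by the
    second components, so [Im lambda * |U|^2 = Im <F, U>]; the bound follows
    from [2 m Im (w conj z) <= |w|^2 + m^2 |z|^2] with [m = Im lambda]. *)
Lemma sqnorm_estimate fl fl1 fr fr1 (lambda : R[i]) (U F : H1rep R) :
  L2 `[a, b] U.1 -> L2 `[a, b] F.1 ->
  dom_pieces fl fl1 fr fr1 (fun x => lambda * U.1 x - F.1 x) ->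
  {ae mu, forall x, a < x < c -> U.1 x = fl x} ->
  {ae mu, forall x, c < x < b -> U.1 x = fr x} ->
  U.2 = (beta1' P)%:C * fr b - (beta2' P)%:C * fr1 b ->
  lambda * U.2 - F.2 = - ((beta1 P)%:C * fr b - (beta2 P)%:C * fr1 b) ->
  Im lambda ^+ 2 * sqnorm U <= sqnorm F.
Proof.
move=> LU LF dp Ul Ur U2 F2; set m := Im lambda.
have mab : measurable (`[a, b]%classic : set R) by exact: measurable_itv.
have LV : L2 `[a, b] (fun x => lambda * U.1 x - F.1 x).
  by apply: L2B => //; exact: L2Z.
have := wint_dom_pieces dp LV Ul Ur LU.
have iU := L2_integrable mab LU; have iF := L2_integrable mab LF.
have [_ iFU] := L2_mul_integrable mab LF (L2_conj LU).
have E (z w : R[i]) : Im ((lambda * z - w) * conjc z) =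
    m * normc z ^+ 2 + (- 1) * Im (w * conjc z).
  by rewrite sqr_normc /m ImM ImD ImN ReD ReN ReM !ImM Re_conj Im_conj; ring.
have -> : wint (fun x => Im ((lambda * U.1 x - F.1 x) * conjc (U.1 x))) =
    wint (fun x => m * normc (U.1 x) ^+ 2 + (- 1) * Im (F.1 x * conjc (U.1 x))).
  by congr wint; apply/funext => x; rewrite E.
rewrite wintD; [|exact: intRZ|exact: intRZ].
rewrite !wintZ// => E1.
have E2 : m * normc U.2 ^+ 2 + (- 1) * Im (F.2 * conjc U.2) =
    rho P * Im (fr1 b * conjc (fr b)).
  rewrite -E F2 U2 /rho.
  move: (fr b) (fr1 b) => [u1 u2] [v1 v2] /=; ring.
have rho0 : rho P != 0 by rewrite gt_eqF// (rho_gt0 hP).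
(* The concomitant at b enters both parts of the norm with opposite weights. *)
have key : m * sqnorm U = wint (fun x => Im (F.1 x * conjc (U.1 x))) +
    dd / rho P * Im (F.2 * conjc U.2).
  rewrite /sqnorm; move: E1 E2.
  set I1 := wint _; set I2 := wint _; set n := normc _ ^+ 2; set i2 := Im (F.2 * _).
  set k := Im _ => E1 E2.
  have e1 : m * I1 = I2 - dd * k by lra.
  have e2 : m * n = i2 + rho P * k by lra.
  by rewrite mulrDr e1 (mulrCA m) e2; field.
have amgm (z w : R[i]) : 2 * m * Im (w * conjc z) <=
    normc w ^+ 2 + m ^+ 2 * normc z ^+ 2.
  rewrite !sqr_normc ImM Re_conj Im_conj.
  have := sqr_ge0 (Im w - m * Re z); have := sqr_ge0 (Re w + m * Im z).
  move: (Re w) (Im w) (Re z) (Im z) => r s r' s'; lra.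
have h1 : 2 * m * wint (fun x => Im (F.1 x * conjc (U.1 x))) <=
    wint (fun x => normc (F.1 x) ^+ 2) + m ^+ 2 * wint (fun x => normc (U.1 x) ^+ 2).
  rewrite -!wintZ// -wintD//; last exact: intRZ.
  apply: le_wint; [exact: intRZ|apply: intRD => //; exact: intRZ|].
  by move=> x; exact: amgm.
have h2 : dd / rho P * (2 * m * Im (F.2 * conjc U.2)) <=
    dd / rho P * (normc F.2 ^+ 2 + m ^+ 2 * normc U.2 ^+ 2).
  by rewrite ler_wpM2l// divr_ge0// ltW// ?(delta_gt0 hP)// (rho_gt0 hP).
have : 2 * m * (m * sqnorm U) <= sqnorm F + m ^+ 2 * sqnorm U.
  rewrite key /sqnorm; move: h1 h2; set I1 := wint _; set I2 := wint _.
  set I3 := wint _; set kk := dd / rho P; set n1 := normc _ ^+ 2.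
  set n2 := normc _ ^+ 2; set im := Im _ => h1 h2; lra.
lra.
Qed.

Lemma H1norm_estimate fl fl1 fr fr1 (lambda : R[i]) (U F : H1rep R) :
  Im lambda != 0 ->
  L2 `[a, b] U.1 -> L2 `[a, b] F.1 ->
  dom_pieces fl fl1 fr fr1 (fun x => lambda * U.1 x - F.1 x) ->
  {ae mu, forall x, a < x < c -> U.1 x = fl x} ->
  {ae mu, forall x, c < x < b -> U.1 x = fr x} ->
  U.2 = (beta1' P)%:C * fr b - (beta2' P)%:C * fr1 b ->
  lambda * U.2 - F.2 = - ((beta1 P)%:C * fr b - (beta2 P)%:C * fr1 b) ->
  H1norm P U <= `|Im lambda|^-1 * H1norm P F.
Proof.
move=> l0 LU LF dp Ul Ur U2 F2; have m0 : 0 < `|Im lambda| by rewrite normr_gt0.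
rewrite ler_pdivlMl// !H1norm_sqnorm -sqrtr_sqr -sqrtrM ?sqr_ge0//.
by rewrite ler_wsqrtr//; exact: (sqnorm_estimate LU LF dp).
Qed.

Let sum3_eq0 (x y z : R) : 0 <= x -> 0 <= y -> 0 <= z -> x + y + z <= 0 ->
  [/\ x = 0, y = 0 & z = 0].
Proof. by move=> x0 y0 z0 xyz; split; lra. Qed.

(** A nonnegative function with integral zero vanishes almost everywhere, and all
    the weights are positive. *)
Lemma sqnorm_eq0 (U : H1rep R) : L2 `[a, b] U.1 -> sqnorm U <= 0 ->
  {ae mu, forall x, `[a, b]%classic x -> U.1 x = 0} /\ U.2 = 0.
Proof.
move=> LU U0; have iU := L2_integrable (measurable_itv _) LU.
have normc0 (z : R[i]) : normc z ^+ 2 = 0 -> z = 0.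
  by move=> /eqP; rewrite sqrf_eq0 => /eqP; exact: Normc.eq0_normc.
have i1 : 0 <= gg * \int[mu]_(x in `[a, c]) (normc (U.1 x) ^+ 2).
  apply: mulr_ge0; first exact/ltW/(gamma_gt0 hP).
  by apply: Rintegral_ge0 => x _; exact: sqr_ge0.
have i2 : 0 <= dd * \int[mu]_(x in `[c, b]) (normc (U.1 x) ^+ 2).
  apply: mulr_ge0; first exact/ltW/(delta_gt0 hP).
  by apply: Rintegral_ge0 => x _; exact: sqr_ge0.
have kk0 : 0 < dd / rho P by rewrite divr_gt0// ?(delta_gt0 hP)// (rho_gt0 hP).
have i3 : 0 <= dd / rho P * normc U.2 ^+ 2 by rewrite mulr_ge0 ?sqr_ge0// ltW.
move: U0; rewrite /sqnorm /wint => U0.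
have [e1 e2 e3] : [/\ gg * \int[mu]_(x in `[a, c]) (normc (U.1 x) ^+ 2) = 0,
  dd * \int[mu]_(x in `[c, b]) (normc (U.1 x) ^+ 2) = 0 &
  dd / rho P * normc U.2 ^+ 2 = 0] by exact: sum3_eq0.
split; last by apply: normc0; apply: (mulfI (lt0r_neq0 kk0)); rewrite e3 mulr0.
have aux l r : mu.-integrable `[l, r] (EFin \o (fun x => normc (U.1 x) ^+ 2)) ->
    \int[mu]_(x in `[l, r]) (normc (U.1 x) ^+ 2) = 0 ->
    {ae mu, forall x, `[l, r]%classic x -> U.1 x = 0}.
  move=> ilr I0.
  have [+ _] := @ae_eq_integral_abs _ _ _ mu `[l, r]%classic
    (measurable_itv _) _ (measurable_int _ ilr).
  move=> /(_ _)/wrap[].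
    move: I0; rewrite /Rintegral; set I := (\int[mu]_(x in _) _)%E => I0.
    have : I \is a fin_num by exact: integrable_fin_num.
    move=> /fineK; rewrite I0 => I00; transitivity I => //; rewrite /I.
    by apply: eq_integral => x _ /=; rewrite ger0_norm// sqr_ge0.
  by apply: ae_imp => x h /h [] /normc0.
have h1 := aux _ _ (intab_left iU) (mulfI (lt0r_neq0 (gamma_gt0 hP)) (etrans e1 (esym (mulr0 _)))).
have h2 := aux _ _ (intab_right iU) (mulfI (lt0r_neq0 (delta_gt0 hP)) (etrans e2 (esym (mulr0 _)))).
apply: ae_imp2 h1 h2 => x; rewrite /= !in_itv/= => g1 g2 /andP[ax xb].
by have [xc|/ltW cx] := leP x c; [apply: g1; rewrite ax|apply: g2; rewrite cx].
Qed.

End energy.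

(** * Classical solutions on one interval *)

Section regular_pieces.
Context {R : realType}.
Implicit Types (f F : R -> R[i]) (l r : R) (g : R -> R).
Local Notation Re := (@complex.Re R).
Local Notation Im := (@complex.Im R).
Local Notation normc := (@Normc.normc R).

Lemma within_continuous_bounded l r g : l <= r -> {within `[l, r], continuous g} ->
  exists2 M, 0 <= M & forall x, l <= x -> x <= r -> `|g x| <= M.
Proof.
move=> lr cg; have [s _ hs] := EVT_max lr cg; have [t _ ht] := EVT_min lr cg.
exists (`|g s| + `|g t|) => [|x lx xr]; first exact: addr_ge0.
have xlr : x \in `[l, r] by rewrite in_itv/= lx.
have := hs _ xlr; have := ht _ xlr; rewrite ler_norml => h1 h2.
have := ler_norm (g s); have := ler_norm (- g t); rewrite normrN => h3 h4.
by have := normr_ge0 (g s); have := normr_ge0 (g t) => *; apply/andP; split; lra.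
Qed.

Lemma lipschitz_of_derive l r g (M : R) : {within `[l, r], continuous g} ->
  (forall x, l < x < r -> exists2 d, is_derive x 1 g d & `|d| <= M) ->
  forall x y, l <= x -> x <= y -> y <= r -> `|g y - g x| <= M * (y - x).
Proof.
move=> cg dg x y lx; rewrite le_eqVlt => /predU1P[->|xy] yr.
  by rewrite !subrr normr0 mulr0.
have dg' z : z \in `]x, y[ -> is_derive z 1 g ('D_1 g z).
  rewrite in_itv/= => /andP[xz zy]; have [|d dz _] := dg z.
    by rewrite (le_lt_trans lx xz) (lt_le_trans zy yr).
  by rewrite (derive_val (is_derive := dz)).
have cg' : {within `[x, y], continuous g}.
  apply: continuous_subspaceW cg => z; rewrite /= !in_itv/= => /andP[xz zy].
  by rewrite (le_trans lx xz) (le_trans zy yr).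
have [z + ->] := MVT xy dg' cg'; rewrite in_itv/= => /andP[xz zy].
rewrite normrM (gtr0_norm (x := y - x)) ?subr_gt0// ler_pM2r ?subr_gt0//.
have [|d dz dM] := dg z; first by rewrite (le_lt_trans lx xz) (lt_le_trans zy yr).
by rewrite (derive_val (is_derive := dz)).
Qed.

Definition cwithin l r F :=
  {within `[l, r], continuous (fun x => Re (F x))} /\
  {within `[l, r], continuous (fun x => Im (F x))}.

Lemma cwithin_bounded l r F : l <= r -> cwithin l r F ->
  exists2 M, 0 <= M & forall x, l <= x -> x <= r -> normc (F x) <= M.
Proof.
move=> lr [F1 F2]; have [M1 M10 h1] := within_continuous_bounded lr F1.
have [M2 M20 h2] := within_continuous_bounded lr F2.
exists (M1 + M2) => [|x lx xr]; first exact: addr_ge0.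
by apply: le_trans (normc_le _) (lerD _ _); [exact: h1|exact: h2].
Qed.

Lemma cwithin_cderiv l r F : l < r ->
  (forall x, l < x < r -> exists d, cderiv F x d) ->
  cvgC l^'+ F (F l) -> cvgC r^'- F (F r) -> cwithin l r F.
Proof.
move=> lr dF /cvgC_ReIm[l1 l2] /cvgC_ReIm[r1 r2].
split; apply/(continuous_within_itvP _ lr); split => // x;
  rewrite in_itv/= => /dF[d [d1 d2]].
  by apply/differentiable_continuous/derivable1_diffP; case: d1.
by apply/differentiable_continuous/derivable1_diffP; case: d2.
Qed.

Lemma cwithin_cac l r F (F1 : R -> R[i]) (M : R) : 0 <= M -> cwithin l r F ->
  (forall x, l < x < r -> cderiv F x (F1 x)) ->
  (forall x, l < x < r -> normc (F1 x) <= M) -> cac l r F.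
Proof.
move=> M0 [c1 c2] dF FM.
split; apply: (ac_lip M0); apply: lipschitz_of_derive => // x lxr;
  have [d1 d2] := dF _ lxr.
  by exists (Re (F1 x)) => //; apply: le_trans (Re_le_normc _) (FM _ lxr).
by exists (Im (F1 x)) => //; apply: le_trans (Im_le_normc _) (FM _ lxr).
Qed.

Lemma normcM (z w : R[i]) : normc (z * w) = normc z * normc w.
Proof. exact: Normc.normcM. Qed.

Lemma normcD (z w : R[i]) : normc (z + w) <= normc z + normc w.
Proof. by have := ler_normD z w; rewrite !normc_norm -rmorphD/= lecR. Qed.

Lemma normcN (z : R[i]) : normc (- z) = normc z.
Proof. by case: z => r s /=; rewrite !sqrrN. Qed.

(** The equation bounds the second derivative, so [F] and [F1] are Lipschitz,
    hence absolutely continuous. *)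
Lemma ode_piece l r q F (F1 : R -> R[i]) (lambda : R[i]) (Q : R) : l < r ->
  cwithin l r F -> cwithin l r F1 ->
  (forall x, l < x < r -> cderiv F x (F1 x)) ->
  (forall x, l < x < r -> cderiv F1 x (((q x)%:C - lambda) * F x)) ->
  (forall x, l < x < r -> `|q x| <= Q) ->
  sol_piece l r q F F1 (fun x => lambda * F x).
Proof.
move=> lr cF cF1 dF dF1 qQ.
have [M M0 FM] := cwithin_bounded (ltW lr) cF.
have [M1 M10 F1M] := cwithin_bounded (ltW lr) cF1.
split => //.
- by apply: cwithin_cac M10 cF dF _ => x /andP[lx xr]; exact/F1M/ltW/xr/ltW.
- have Q0 : 0 <= Q.
    apply: le_trans (normr_ge0 _) (qQ ((l + r) / 2) _).
    by rewrite midf_lt//= midf_lt.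
  apply: (@cwithin_cac _ _ _ _ ((Q + normc lambda) * M)) cF1 dF1 _.
    by rewrite mulr_ge0// addr_ge0// normc_ge0.
  move=> x lxr; have /andP[lx xr] := lxr; rewrite normcM.
  apply: ler_pM; [exact: normc_ge0|exact: normc_ge0| |].
    apply: le_trans (normcD _ _) _; rewrite normcN lerD2r.
    by rewrite /= expr0n addr0 sqrtr_sqr qQ.
  by apply: FM; exact: ltW.
- apply: aeW => x lxr; exists (((q x)%:C - lambda) * F x); first exact: dF1.
  by ring.
Qed.

(** A limit at [x] along [D] is a limit from the right as soon as [D] contains
    points immediately to the right of [x]. *)
Lemma at_right_within (D : set R) (x y : R) : x < y ->
  `]x, y[%classic `<=` D -> within D x^' `<=` x^'+.
Proof.
move=> xy xyD A DA; near=> z.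
have zx : x < z by near: z; exact: nbhs_right_gt.
have zy : z < y by near: z; exact: nbhs_right_lt.
have : D z -> A z.
  suff : z != x -> D z -> A z by apply; rewrite gt_eqF.
  by near: z; apply: cvg_within; exact: DA.
by apply; apply: xyD; rewrite /= in_itv/= zx.
Unshelve. all: by end_near. Qed.

Lemma at_left_within (D : set R) (x y : R) : x < y ->
  `]x, y[%classic `<=` D -> within D y^' `<=` y^'-.
Proof.
move=> xy xyD A DA; near=> z.
have zy : z < y by near: z; exact: nbhs_left_lt.
have xz : x < z by near: z; exact: nbhs_left_gt.
have : D z -> A z.
  suff : z != y -> D z -> A z by apply; rewrite lt_eqF.
  by near: z; apply: cvg_within; exact: DA.
by apply; apply: xyD; rewrite /= in_itv/= zy xz.
Unshelve. all: by end_near. Qed.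

Lemma has_deriv_cvg (D : set R) F x (d : R[i]) :
  has_deriv D F x d -> cvgC (within D x^') F (F x).
Proof.
move=> /cvgC_ReIm[h1 h2].
have xx : (y - x) @[y --> within D x^'] --> (0 : R).
  rewrite -[X in _ --> X](subrr x); apply: cvgB; last exact: cvg_cst.
  by move=> A /= Ax; apply: cvg_within; exact: nbhs_dnbhs.
have yx : \forall y \near within D x^', y - x != 0.
  apply: cvg_within; near=> y; rewrite subr_eq0; near: y; exact: nbhs_dnbhs_neq.
apply/cvgC_ReIm; split.
  have k : Re (diff_quotient F x y) * (y - x) + Re (F x)
      @[y --> within D x^'] --> Re (F x).
    rewrite -[X in _ --> X]add0r -(mulr0 (Re d)).
    by apply: cvgD; [exact: cvgM|exact: cvg_cst].
  apply: cvg_trans k; apply: near_eq_cvg.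
  by apply: filterS yx => y yx; rewrite /= Re_diff_quotient divfK ?subrK.
have k : Im (diff_quotient F x y) * (y - x) + Im (F x)
    @[y --> within D x^'] --> Im (F x).
  rewrite -[X in _ --> X]add0r -(mulr0 (Im d)).
  by apply: cvgD; [exact: cvgM|exact: cvg_cst].
apply: cvg_trans k; apply: near_eq_cvg.
by apply: filterS yx => y yx; rewrite /= Im_diff_quotient divfK ?subrK.
Unshelve. all: by end_near. Qed.

End regular_pieces.

(** * The two sides of the transmission point *)

Section problem_pieces.
Context {R : realType}.
Notation mu := (@lebesgue_measure R).
Local Notation Re := (@complex.Re R).
Local Notation Im := (@complex.Im R).
Local Notation normc := (@Normc.normc R).
Variable P : problem R.
Hypothesis hP : standing P.
Implicit Types (f u v : R -> R[i]).

Local Notation a := (pa P).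
Local Notation b := (pb P).
Local Notation c := (pc P).

Let lac : a < c := lt_ac hP.
Let lcb : c < b := lt_cb hP.

Lemma dom_left x : a <= x -> x < c -> dom P x.
Proof. by move=> ax xc; left; rewrite /= in_itv/= ax. Qed.

Lemma dom_right x : c < x -> x <= b -> dom P x.
Proof. by move=> cx xb; right; rewrite /= in_itv/= cx. Qed.

Lemma dom_cases x : dom P x -> (a <= x < c) \/ (c < x <= b).
Proof. by case; rewrite /= in_itv/=; [left|right]. Qed.

Lemma nbhs_dom_left x : a < x < c -> nbhs x (dom P).
Proof.
move=> /andP[ax xc]; apply: filterS (near_itvoo ax xc) => y /andP[ay yc].
exact/dom_left/yc/ltW.
Qed.

Lemma nbhs_dom_right x : c < x < b -> nbhs x (dom P).
Proof.
move=> /andP[cx xb]; apply: filterS (near_itvoo cx xb) => y /andP[cy yb].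
exact/dom_right/ltW.
Qed.

Lemma dom_at_right x : a <= x -> x < c -> within (dom P) x^' `<=` x^'+.
Proof.
move=> ax xc; apply: (at_right_within xc) => y; rewrite /= in_itv/= => /andP[xy yc].
by apply: dom_left => //; exact/ltW/(le_lt_trans ax).
Qed.

Lemma dom_at_left x : c < x -> x <= b -> within (dom P) x^' `<=` x^'-.
Proof.
move=> cx xb; apply: (at_left_within cx) => y; rewrite /= in_itv/= => /andP[cy yx].
by apply: dom_right => //; exact/ltW/(lt_le_trans yx).
Qed.

Lemma proper_dom x : dom P x -> ProperFilter (within (dom P) x^').
Proof.
move=> /dom_cases[/andP[ax xc]|/andP[cx xb]]; apply: Build_ProperFilter => h.
  by have [y []] := filter_ex (dom_at_right ax xc h).
by have [y []] := filter_ex (dom_at_left cx xb h).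
Qed.

Lemma D1E f x (d : R[i]) : dom P x -> has_deriv (dom P) f x d ->
  derivable_on (dom P) f x /\ D1 P f x = d.
Proof. by move=> /proper_dom pD; exact: has_deriv_deriv_on. Qed.

Lemma D1_cderiv_left f x : a < x < c -> derivable_on (dom P) f x ->
  cderiv f x (D1 P f x).
Proof.
by move=> axc /derivable_on_has_deriv; rewrite has_deriv_cderiv//; exact: nbhs_dom_left.
Qed.

Lemma D1_cderiv_right f x : c < x < b -> derivable_on (dom P) f x ->
  cderiv f x (D1 P f x).
Proof.
by move=> axc /derivable_on_has_deriv; rewrite has_deriv_cderiv//; exact: nbhs_dom_right.
Qed.

(** Each side of [c] becomes a problem on a closed interval once functions are
    extended to [c] by their one-sided limits. *)
Definition extl f x := if x == c then limit c^'- f else f x.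
Definition extr f x := if x == c then limit c^'+ f else f x.

Lemma extlE f x : x < c -> extl f x = f x.
Proof. by move=> xc; rewrite /extl lt_eqF. Qed.

Lemma extrE f x : c < x -> extr f x = f x.
Proof. by move=> xc; rewrite /extr gt_eqF. Qed.

Lemma extl_near f x : x < c -> \forall y \near x, f y = extl f y.
Proof.
move=> xc; have x1 : x - 1 < x by rewrite ltrBlDr ltrDl.
by apply: filterS (near_itvoo x1 xc) => y /andP[_ yc]; rewrite extlE.
Qed.

Lemma extr_near f x : c < x -> \forall y \near x, f y = extr f y.
Proof.
move=> cx; have x1 : x < x + 1 by rewrite ltrDl.
by apply: filterS (near_itvoo cx x1) => y /andP[cy _]; rewrite extrE.
Qed.

Lemma extl_cvg_end f : has_limit c^'- f -> cvgC c^'- (extl f) (extl f c).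
Proof.
move=> h; rewrite {2}/extl eqxx; apply: cvg_trans h.
by apply: near_eq_cvg; near=> y; rewrite extlE//; near: y; exact: nbhs_left_lt.
Unshelve. all: by end_near. Qed.

Lemma extr_cvg_end f : has_limit c^'+ f -> cvgC c^'+ (extr f) (extr f c).
Proof.
move=> h; rewrite {2}/extr eqxx; apply: cvg_trans h.
by apply: near_eq_cvg; near=> y; rewrite extrE//; near: y; exact: nbhs_right_gt.
Unshelve. all: by end_near. Qed.

Lemma extl_cvg_start f : cvgC a^'+ f (f a) -> cvgC a^'+ (extl f) (extl f a).
Proof.
rewrite extlE//; apply: cvg_trans.
by apply: near_eq_cvg; near=> y; rewrite extlE//; near: y; exact: nbhs_right_lt.
Unshelve. all: by end_near. Qed.

Lemma extr_cvg_start f : cvgC b^'- f (f b) -> cvgC b^'- (extr f) (extr f b).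
Proof.
rewrite extrE//; apply: cvg_trans.
by apply: near_eq_cvg; near=> y; rewrite extrE//; near: y; exact: nbhs_left_gt.
Unshelve. all: by end_near. Qed.

Lemma Re_sub_le (z w : R[i]) : `|Re z - Re w| <= normc (z - w).
Proof. by rewrite -ReN -ReD; exact: Re_le_normc. Qed.

Lemma Im_sub_le (z w : R[i]) : `|Im z - Im w| <= normc (z - w).
Proof. by rewrite -ImN -ImD; exact: Im_le_normc. Qed.

Lemma extl_cac f : abs_cont `[a, c[ f -> has_limit c^'- f -> cac a c (extl f).
Proof.
move=> acf /extl_cvg_end/cvgC_ReIm[e1 e2].
have sub : `[a, (a + c) / 2]%classic `<=` `[a, c[%classic.
  by apply: subset_itvl; rewrite bnd_simp midf_lt.
have [s1 s2] : Re (extl f x) @[x --> a^'+] --> Re (extl f a) /\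
    Im (extl f x) @[x --> a^'+] --> Im (extl f a).
  apply/cvgC_ReIm/extl_cvg_start; apply: abs_cont_cvg_right sub acf.
  by rewrite midf_lt.
have subo : `]a, c[%classic `<=` `[a, c[%classic by apply: subset_itvr; rewrite bnd_simp.
split; [apply: (ac_of_abs_cont lac acf subo Re_sub_le)|
  apply: (ac_of_abs_cont lac acf subo Im_sub_le)] => // x /andP[_ xc];
  by rewrite extlE.
Qed.

Lemma extr_cac f : abs_cont `]c, b] f -> has_limit c^'+ f -> cac c b (extr f).
Proof.
move=> acf /extr_cvg_end/cvgC_ReIm[e1 e2].
have sub : `[(c + b) / 2, b]%classic `<=` `]c, b]%classic.
  by apply: subset_itvr; rewrite bnd_simp midf_lt.
have [s1 s2] : Re (extr f x) @[x --> b^'-] --> Re (extr f b) /\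
    Im (extr f x) @[x --> b^'-] --> Im (extr f b).
  apply/cvgC_ReIm/extr_cvg_start; apply: abs_cont_cvg_left sub acf.
  by rewrite midf_lt.
have subo : `]c, b[%classic `<=` `]c, b]%classic by apply: subset_itvl; rewrite bnd_simp.
split; [apply: (ac_of_abs_cont lcb acf subo Re_sub_le)|
  apply: (ac_of_abs_cont lcb acf subo Im_sub_le)] => // x /andP[cx _];
  by rewrite extrE.
Qed.

(** The extended derivative is absolutely continuous, hence differentiable
    almost everywhere, and [D1] computes its derivative there. *)
Lemma DA_dom_pieces f v : DA_fun P f ->
  {ae mu, forall x, `[a, b]%classic x -> v x = tau P f x} ->
  dom_pieces P (extl f) (extl (D1 P f)) (extr f) (extr (D1 P f)) v.
Proof.
move=> [df [acl acr] [ac1l ac1r] _ [bca [[ll lr] [l1l l1r] t0 t1]]] vE.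
have cl := extl_cac acl ll; have cl1 := extl_cac ac1l l1l.
have cr := extr_cac acr lr; have cr1 := extr_cac ac1r l1r.
split; [|(split=> //)| |by rewrite /extl /extr eqxx..].
- split => //.
  + move=> x axc; have /andP[ax xc] := axc; rewrite extlE//.
    exact: cderiv_near (extl_near f xc)
      (D1_cderiv_left axc (df _ (dom_left (ltW ax) xc))).
  + apply: ae_imp2 vE (cac_ae_derivable (ltW lac) cl1) => x vx dx axc.
    have /andP[ax xc] := axc; have [d dd] := dx axc; exists d => //.
    have {}dd : has_deriv (dom P) (D1 P f) x d.
      apply/has_deriv_cderiv; first exact: nbhs_dom_left.
      by apply: cderiv_near dd; apply: filterS (extl_near (D1 P f) xc) => y ->.
    have [_ D1D1] := D1E (dom_left (ltW ax) xc) dd.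
    rewrite vx ?extlE// /tau ?D1D1//.
    by rewrite /= in_itv/= (ltW ax) (ltW (lt_trans xc lcb)).
- move=> x axc; have /andP[cx xb] := axc; rewrite extrE//.
  exact: cderiv_near (extr_near f cx)
    (D1_cderiv_right axc (df _ (dom_right cx (ltW xb)))).
- apply: ae_imp2 vE (cac_ae_derivable (ltW lcb) cr1) => x vx dx axc.
  have /andP[cx xb] := axc; have [d dd] := dx axc; exists d => //.
  have {}dd : has_deriv (dom P) (D1 P f) x d.
    apply/has_deriv_cderiv; first exact: nbhs_dom_right.
    by apply: cderiv_near dd; apply: filterS (extr_near (D1 P f) cx) => y ->.
  have [_ D1D1] := D1E (dom_right cx (ltW xb)) dd.
  rewrite vx ?extrE// /tau ?D1D1//.
  by rewrite /= in_itv/= (ltW xb) (ltW (lt_trans lac cx)).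
- by rewrite !extlE.
Qed.

End problem_pieces.

(** * Estimate and uniqueness for the resolvent *)

Section resolvent_estimate.
Context {R : realType}.
Notation mu := (@lebesgue_measure R).
Local Notation Im := (@complex.Im R).
Local Notation normc := (@Normc.normc R).
Variable P : problem R.
Hypothesis hP : standing P.
Implicit Types (f u v : R -> R[i]) (U F : H1rep R) (lambda : R[i]).

Local Notation a := (pa P).
Local Notation b := (pb P).
Local Notation c := (pc P).

Let lac : a < c := lt_ac hP.
Let lcb : c < b := lt_cb hP.

Let mab : measurable (`[a, b]%classic : set R).
Proof. exact: measurable_itv. Qed.

(** The equation [(lambda - A) U = F] in terms of the continuous extensions of
    an element of the domain. The extensions and their derivatives are
    arguments, so that solutions can be subtracted. *)
Definition represents fl fl1 fr fr1 lambda U F : Prop :=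
  [/\ L2 `[a, b] U.1,
      dom_pieces P fl fl1 fr fr1 (fun x => lambda * U.1 x - F.1 x),
      {ae mu, forall x, a < x < c -> U.1 x = fl x},
      {ae mu, forall x, c < x < b -> U.1 x = fr x} &
      U.2 = (beta1' P)%:C * fr b - (beta2' P)%:C * fr1 b /\
      lambda * U.2 - F.2 = - ((beta1 P)%:C * fr b - (beta2 P)%:C * fr1 b)].

Lemma lambda_sub_A_represents lambda U F : in_H1 P F -> lambda_sub_A P lambda U F ->
  exists f, represents (extl P f) (extl P (D1 P f)) (extr P f) (extr P (D1 P f))
    lambda U F.
Proof.
move=> LF [V [LU LV [f DAf [[U1 U2] [V1 V2]]]] [F1 F2]]; exists f.
have vE : {ae mu, forall x, `[a, b]%classic x -> lambda * U.1 x - F.1 x = tau P f x}.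
  apply: ae_imp2 V1 F1 => x h1 h2 xab; have /= <- := h2 xab; have /= <- := h1 xab.
  by rewrite opprB addrC subrK.
split => //.
- exact: DA_dom_pieces.
- apply: ae_imp U1 => x h /andP[ax xc]; rewrite extlE// h//.
  by rewrite /= in_itv/= (ltW ax) (ltW (lt_trans xc lcb)).
- apply: ae_imp U1 => x h /andP[cx xb]; rewrite extrE// h//.
  by rewrite /= in_itv/= (ltW xb) (ltW (lt_trans lac cx)).
- rewrite !extrE//; split; first by rewrite U2.
  by rewrite -F2 /= V2 /= /bform opprB addrC subrK.
Qed.

Lemma represents_estimate fl fl1 fr fr1 lambda U F : Im lambda != 0 ->
  in_H1 P F -> represents fl fl1 fr fr1 lambda U F ->
  H1norm P U <= `|Im lambda|^-1 * H1norm P F.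
Proof.
by move=> l0 LF [LU dp Ul Ur [U2 F2]]; exact: (H1norm_estimate hP l0 LU LF dp).
Qed.

Lemma represents_homogeneous fl fl1 fr fr1 lambda U : Im lambda != 0 ->
  represents fl fl1 fr fr1 lambda U (fun=> 0, 0) ->
  {ae mu, forall x, `[a, b]%classic x -> U.1 x = 0} /\ U.2 = 0.
Proof.
move=> l0 [LU dp Ul Ur [U2 F2]].
have L0 : L2 `[a, b] (fun=> 0 : R[i]).
  by apply: (@L2_bounded _ _ _ (normc 0)) => //; exact: mu_itv_fin.
have := sqnorm_estimate hP LU (F := (fun=> 0, 0)) L0 dp Ul Ur U2 F2.
have -> : sqnorm P (fun=> 0, 0) = 0.
  rewrite /sqnorm /wint /= !expr0n/= addr0 sqrtr0 expr0n/= mulr0 addr0.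
  by rewrite !Rintegral_cst// !mul0r !mulr0 addr0.
move=> h; apply: (sqnorm_eq0 hP LU).
by rewrite -(pmulr_rle0 _ (x := Im lambda ^+ 2))// exprn_even_gt0.
Qed.

Lemma dom_piecesB fl fl1 fr fr1 v gl gl1 gr gr1 w :
  dom_pieces P fl fl1 fr fr1 v -> dom_pieces P gl gl1 gr gr1 w ->
  dom_pieces P (fun x => fl x - gl x) (fun x => fl1 x - gl1 x)
    (fun x => fr x - gr x) (fun x => fr1 x - gr1 x) (fun x => v x - w x).
Proof.
move=> [fl_ fr_ fa fc fc1] [gl_ gr_ ga gc gc1]; split.
- exact: sol_pieceB.
- exact: sol_pieceB.
- by rewrite !mulrBr addrACA -opprD fa ga subrr.
- by rewrite !mulrBr fc gc.
- by rewrite !mulrBr fc1 gc1.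
Qed.

Lemma lambda_sub_A_unique lambda F U1 U2 : Im lambda != 0 -> in_H1 P F ->
  lambda_sub_A P lambda U1 F -> lambda_sub_A P lambda U2 F -> H1eq P U1 U2.
Proof.
move=> l0 LF /(lambda_sub_A_represents LF)[f [LU dp Ul Ur [U2E F2E]]].
move=> /(lambda_sub_A_represents LF)[g [LW dq Wl Wr [W2E G2E]]].
pose D : H1rep R := (fun x => U1.1 x - U2.1 x, U1.2 - U2.2).
have [] := @represents_homogeneous
    (fun x => extl P f x - extl P g x) (fun x => extl P (D1 P f) x - extl P (D1 P g) x)
    (fun x => extr P f x - extr P g x) (fun x => extr P (D1 P f) x - extr P (D1 P g) x)
    lambda D l0.
  split.
  - exact: L2B.
  - have := dom_piecesB dp dq; congr dom_pieces.
    by apply/funext => x /=; ring.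
  - by apply: ae_imp2 Ul Wl => x h1 h2 lx; rewrite /= h1 ?h2.
  - by apply: ae_imp2 Ur Wr => x h1 h2 lx; rewrite /= h1 ?h2.
  - split; first by rewrite /= U2E W2E; ring.
    rewrite /= subr0 mulrBr.
    rewrite (_ : _ - _ = (lambda * U1.2 - F.2) - (lambda * U2.2 - F.2)); last by ring.
    by rewrite F2E G2E; ring.
move=> D1 /eqP; rewrite subr_eq0 => /eqP D2; split => //.
by apply: ae_imp D1 => x h xab; apply/eqP; rewrite -subr_eq0; apply/eqP/h.
Qed.

End resolvent_estimate.

(** * Restriction, Wronskian and vanishing on one interval *)

Section piece_lemmas.
Context {R : realType}.
Notation mu := (@lebesgue_measure R).
Implicit Types (l r : R) (f g v w : R -> R[i]).

Lemma ac_itv_sub l r l' r' (h : R -> R) : l <= l' -> r' <= r ->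
  ac_itv l r h -> ac_itv l' r' h.
Proof.
move=> ll rr ach e e0; have [d d0 hd] := ach _ e0; exists d => // s /andP[ss sno].
apply: hd; apply/andP; split => //; apply: sub_all ss => p /and3P[lp -> pr].
by rewrite (le_trans ll lp) (le_trans pr rr).
Qed.

Lemma cac_sub l r l' r' f : l <= l' -> r' <= r -> cac l r f -> cac l' r' f.
Proof. by move=> ll rr [f1 f2]; split; exact: ac_itv_sub ll rr _. Qed.

Lemma sol_piece_sub l r l' r' q f f1 v : l <= l' -> r' <= r ->
  sol_piece l r q f f1 v -> sol_piece l' r' q f f1 v.
Proof.
move=> ll rr [f_ f1_ df dv].
have sub x : l' < x < r' -> l < x < r.
  by move=> /andP[lx xr]; rewrite (le_lt_trans ll lx) (lt_le_trans xr rr).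
split; [exact: cac_sub f_|exact: cac_sub f1_|by move=> x /sub/df|].
by apply: ae_imp dv => x h /sub.
Qed.

Lemma sol_piece_eq l r q f f1 v w : {ae mu, forall x, l < x < r -> v x = w x} ->
  sol_piece l r q f f1 v -> sol_piece l r q f f1 w.
Proof.
move=> vw [f_ f1_ df dv]; split => //.
by apply: ae_imp2 vw dv => x h1 h2 lx; have [d dd e] := h2 lx; exists d; rewrite -?h1.
Qed.

Let cac_ae_cst l r f : l <= r -> cac l r f ->
  {ae mu, forall x, l < x < r -> cderiv f x 0} -> f r = f l.
Proof.
move=> lr [f1 f2] df; apply: complex_eq; apply/eqP; rewrite -subr_eq0 -normr_le0.
  have := ac_lipschitz lr (lexx 0) f1; rewrite mul0r; apply.
  apply: ae_imp df => x h /h[d1 _] d dd.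
  by rewrite -(derive_val (is_derive := dd)) (derive_val (is_derive := d1)) normr0.
have := ac_lipschitz lr (lexx 0) f2; rewrite mul0r; apply.
apply: ae_imp df => x h /h[_ d1] d dd.
by rewrite -(derive_val (is_derive := dd)) (derive_val (is_derive := d1)) normr0.
Qed.

(** The Wronskian is absolutely continuous, and its derivative vanishes
    wherever both second derivatives exist. *)
Lemma wronskian_piece l r q f f1 g g1 (lambda : R[i]) x :
  sol_piece l r q f f1 (fun x => lambda * f x) ->
  sol_piece l r q g g1 (fun x => lambda * g x) -> l <= x -> x <= r ->
  f x * g1 x - f1 x * g x = f l * g1 l - f1 l * g l.
Proof.
move=> sf sg lx xr.
have [f_ f1_ df dv] := sol_piece_sub (lexx l) xr sf.
have [g_ g1_ dg dw] := sol_piece_sub (lexx l) xr sg.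
apply: (@cac_ae_cst l x (fun y => f y * g1 y - f1 y * g y)) => //.
  by apply: cacD; [exact: cacM|apply: cacN; exact: cacM].
apply: ae_imp2 dv dw => y h1 h2 ly; have [d dd e1] := h1 ly; have [e de e2] := h2 ly.
have := cderivD (cderivM (df _ ly) de) (cderivN (cderivM dd (dg _ ly))).
rewrite (_ : _ + _ = 0)//.
have -> : d = ((q y)%:C - lambda) * f y.
  by apply/eqP; rewrite -subr_eq0 mulrBl e1; apply/eqP; ring.
have -> : e = ((q y)%:C - lambda) * g y.
  by apply/eqP; rewrite -subr_eq0 mulrBl e2; apply/eqP; ring.
by ring.
Qed.

Lemma ae_ex (Q : R -> Prop) s t : {ae mu, forall x, Q x} -> s < t ->
  exists2 x, s < x < t & Q x.
Proof.
move=> [N [mN N0 QN]] st; apply: contrapT => nex.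
have sub : `]s, t[%classic `<=` N.
  move=> x; rewrite /= in_itv/= => sxt; apply: QN => /= Qx; apply: nex.
  by exists x.
have : (mu `]s, t[ <= mu N)%E by apply: le_measure; rewrite ?inE.
rewrite N0 lebesgue_measure_itv/= lte_fin st -EFinD lee_fin.
by rewrite leNgt subr_gt0 st.
Qed.

(** A property that holds almost everywhere holds arbitrarily close to any
    point on its right. *)
Lemma ac_ae_eq0 l r (h : R -> R) : ac_itv l r h ->
  {ae mu, forall x, l < x < r -> h x = 0} ->
  forall x, l <= x -> x < r -> h x = 0.
Proof.
move=> ach h0 x lx xr; apply/eqP; rewrite -normr_le0; apply/ler_addgt0Pr => e e0; rewrite add0r.
have [d d0 hd] := ac_uniform ach e0.
have xt : x < Num.min r (x + d) by rewrite lt_min xr ltrDl.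
have [y /andP[xy +] hy] := ae_ex h0 xt; rewrite lt_min => /andP[yr yd].
have := hd x y lx (ltW xy) (ltW yr).
rewrite hy ?(le_lt_trans lx xy)// sub0r normrN; apply; lra.
Qed.

Lemma cac_ae_eq0 l r f : cac l r f -> {ae mu, forall x, l < x < r -> f x = 0} ->
  forall x, l <= x -> x < r -> f x = 0.
Proof.
move=> [f1 f2] f0 x lx xr; apply: complex_eq; rewrite /=.
  by apply: (ac_ae_eq0 f1) => //; apply: ae_imp f0 => y h /h ->.
by apply: (ac_ae_eq0 f2) => //; apply: ae_imp f0 => y h /h ->.
Qed.

End piece_lemmas.

(** * Solutions satisfying the transmission conditions *)

Section solutions.
Context {R : realType}.
Variable P : problem R.
Hypothesis hP : standing P.
Implicit Types (f u v : R -> R[i]) (U F : H1rep R) (lambda : R[i]).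

Local Notation a := (pa P).
Local Notation b := (pb P).
Local Notation c := (pc P).

Let lac : a < c := lt_ac hP.
Let lcb : c < b := lt_cb hP.

(** By continuity away from [c] and the finite limit at [c]. *)
Lemma q_bounded_left : exists Q, forall x, a < x < c -> `|q P x| <= Q.
Proof.
have /cvgrPdist_lt/(_ _ ltr01) := q_liml hP; set L := lim _.
rewrite near_withinE => /nbhs_ballP[d /= d0 hd].
pose t := Num.max a (c - d / 2).
have tc : t < c by rewrite gt_max lac ltrBlDr ltrDl divr_gt0.
have at_ : a <= t by rewrite le_max lexx.
have ct : {within `[a, t], continuous (q P)}.
  by apply: continuous_subspaceW (q_contl hP); apply: subset_itvl; rewrite bnd_simp.
have [M M0 hM] := within_continuous_bounded at_ ct.
exists (M + (`|L| + 1)) => x /andP[ax xc].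
have := normr_ge0 L; have [xt|tx] := leP x t.
  by have := hM _ (ltW ax) xt; lra.
have : `|L - q P x| < 1.
  apply: hd => //; rewrite /ball/= gtr0_norm ?subr_gt0//.
  by move: tx; rewrite gt_max => /andP[_]; lra.
by have := ler_distD L 0 (q P x); rewrite !sub0r !normrN; lra.
Qed.

Lemma q_bounded_right : exists Q, forall x, c < x < b -> `|q P x| <= Q.
Proof.
have /cvgrPdist_lt/(_ _ ltr01) := q_limr hP; set L := lim _.
rewrite near_withinE => /nbhs_ballP[d /= d0 hd].
pose t := Num.min b (c + d / 2).
have tc : c < t by rewrite lt_min lcb ltrDl divr_gt0.
have tb : t <= b by rewrite ge_min lexx.
have ct : {within `[t, b], continuous (q P)}.
  by apply: continuous_subspaceW (q_contr hP); apply: subset_itvr; rewrite bnd_simp.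
have [M M0 hM] := within_continuous_bounded tb ct.
exists (M + (`|L| + 1)) => x /andP[cx xb].
have := normr_ge0 L; have [tx|xt] := leP t x.
  by have := hM _ tx (ltW xb); lra.
have : `|L - q P x| < 1.
  apply: hd => //; rewrite /ball/= ltr0_norm ?subr_lt0// opprB.
  by move: xt; rewrite lt_min => /andP[_]; lra.
by have := ler_distD L 0 (q P x); rewrite !sub0r !normrN; lra.
Qed.

Section one_solution.
Variables (lambda : R[i]) (u : R -> R[i]).
Hypotheses (solu : solves P lambda u) (tru : transmission P u).

Let du x : dom P x -> has_deriv (dom P) u x (D1 P u x).
Proof. by move=> /solu[h _ _]; exact: derivable_on_has_deriv h. Qed.

Let du1 x : dom P x -> has_deriv (dom P) (D1 P u) x (((q P x)%:C - lambda) * u x).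
Proof.
move=> /solu[_ h tu]; have := derivable_on_has_deriv h.
suff -> : deriv_on (dom P) (D1 P u) x = ((q P x)%:C - lambda) * u x by [].
by rewrite -[LHS]/(D1 P (D1 P u) x) mulrBl -tu /tau; ring.
Qed.

Let cvg_a f (d : R[i]) : has_deriv (dom P) f a d -> cvgC a^'+ f (f a).
Proof.
by move=> /has_deriv_cvg h; apply: cvg_trans h => A /=; exact: dom_at_right.
Qed.

Let cvg_b f (d : R[i]) : has_deriv (dom P) f b d -> cvgC b^'- f (f b).
Proof.
by move=> /has_deriv_cvg h; apply: cvg_trans h => A /=; exact: dom_at_left.
Qed.

Let doma : dom P a. Proof. exact: dom_left. Qed.
Let domb : dom P b. Proof. exact: dom_right. Qed.

Let ext_derl f x (d : R[i]) : a < x < c -> has_deriv (dom P) f x d ->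
  cderiv (extl P f) x d.
Proof.
move=> axc; have /andP[_ xc] := axc => dd; apply: cderiv_near (extl_near f xc) _.
have [h _] := @has_deriv_cderiv _ _ f x d (nbhs_dom_left axc); exact: h.
Qed.

Let ext_derr f x (d : R[i]) : c < x < b -> has_deriv (dom P) f x d ->
  cderiv (extr P f) x d.
Proof.
move=> axc; have /andP[cx _] := axc => dd; apply: cderiv_near (extr_near f cx) _.
have [h _] := @has_deriv_cderiv _ _ f x d (nbhs_dom_right axc); exact: h.
Qed.

Lemma solution_left : sol_piece a c (q P) (extl P u) (extl P (D1 P u))
  (fun x => lambda * extl P u x).
Proof.
have [[ll _] [l1 _] _ _] := tru; have [Q qQ] := q_bounded_left.
have inl x : a < x < c -> dom P x.
  by move=> /andP[ax xc]; apply: dom_left => //; exact: ltW.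
have d0 x : a < x < c -> cderiv (extl P u) x (extl P (D1 P u) x).
  move=> axc; have /andP[_ xc] := axc; rewrite [X in cderiv _ _ X]extlE//.
  exact: ext_derl (du (inl _ axc)).
have d1 x : a < x < c -> cderiv (extl P (D1 P u)) x (((q P x)%:C - lambda) * extl P u x).
  move=> axc; have /andP[_ xc] := axc; rewrite [extl P u x]extlE//.
  exact: ext_derl (du1 (inl _ axc)).
apply: (@ode_piece _ _ _ _ _ _ _ Q lac _ _ d0 d1 qQ).
- apply: (cwithin_cderiv lac); [by move=> x /d0 ?; eexists; eassumption| |].
    exact: extl_cvg_start (cvg_a (du doma)).
  exact: extl_cvg_end.
- apply: (cwithin_cderiv lac); [by move=> x /d1 ?; eexists; eassumption| |].
    exact: extl_cvg_start (cvg_a (du1 doma)).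
  exact: extl_cvg_end.
Qed.

Lemma solution_right : sol_piece c b (q P) (extr P u) (extr P (D1 P u))
  (fun x => lambda * extr P u x).
Proof.
have [[_ lr] [_ l1] _ _] := tru; have [Q qQ] := q_bounded_right.
have inr x : c < x < b -> dom P x.
  by move=> /andP[cx xb]; apply: dom_right => //; exact: ltW.
have d0 x : c < x < b -> cderiv (extr P u) x (extr P (D1 P u) x).
  move=> axc; have /andP[cx _] := axc; rewrite [X in cderiv _ _ X]extrE//.
  exact: ext_derr (du (inr _ axc)).
have d1 x : c < x < b -> cderiv (extr P (D1 P u)) x (((q P x)%:C - lambda) * extr P u x).
  move=> axc; have /andP[cx _] := axc; rewrite [extr P u x]extrE//.
  exact: ext_derr (du1 (inr _ axc)).
apply: (@ode_piece _ _ _ _ _ _ _ Q lcb _ _ d0 d1 qQ).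
- apply: (cwithin_cderiv lcb); [by move=> x /d0 ?; eexists; eassumption| |].
    exact: extr_cvg_end.
  exact: extr_cvg_start (cvg_b (du domb)).
- apply: (cwithin_cderiv lcb); [by move=> x /d1 ?; eexists; eassumption| |].
    exact: extr_cvg_end.
  exact: extr_cvg_start (cvg_b (du1 domb)).
Qed.

Lemma ext_transmission :
  (gamma1 P)%:C * extl P u c = (delta1 P)%:C * extr P u c /\
  (gamma2 P)%:C * extl P (D1 P u) c = (delta2 P)%:C * extr P (D1 P u) c.
Proof. by have [_ _ t0 t1] := tru; rewrite /extl /extr eqxx. Qed.

End one_solution.

End solutions.

(** * The Wronskian at nonreal parameters *)

Section wronskian_w.
Context {R : realType}.
Local Notation Re := (@complex.Re R).
Local Notation Im := (@complex.Im R).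
Local Notation normc := (@Normc.normc R).
Variable P : problem R.
Hypothesis hP : standing P.
Variables (phi chi : R -> R[i] -> R[i]) (lambda : R[i]).
Hypothesis hphi : phi_solution P lambda (phi^~ lambda).
Hypothesis hchi : chi_solution P lambda (chi^~ lambda).

Local Notation a := (pa P).
Local Notation b := (pb P).
Local Notation c := (pc P).
Local Notation gg := ((gamma1 P * gamma2 P)%:C : R[i]).
Local Notation dd := ((delta1 P * delta2 P)%:C : R[i]).
Local Notation ph := (phi^~ lambda).
Local Notation ch := (chi^~ lambda).
Local Notation w := (w P phi chi lambda).

Let lac : a < c := lt_ac hP.
Let lcb : c < b := lt_cb hP.

Local Notation pl := (extl P ph).
Local Notation pl1 := (extl P (D1 P ph)).
Local Notation pr := (extr P ph).
Local Notation pr1 := (extr P (D1 P ph)).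
Local Notation cl := (extl P ch).
Local Notation cl1 := (extl P (D1 P ch)).
Local Notation cr := (extr P ch).
Local Notation cr1 := (extr P (D1 P ch)).

Lemma phi_left : sol_piece a c (q P) pl pl1 (fun x => lambda * pl x).
Proof. by have [s t _ _] := hphi; exact: solution_left. Qed.
Lemma phi_right : sol_piece c b (q P) pr pr1 (fun x => lambda * pr x).
Proof. by have [s t _ _] := hphi; exact: solution_right. Qed.
Lemma chi_left : sol_piece a c (q P) cl cl1 (fun x => lambda * cl x).
Proof. by have [s t _ _] := hchi; exact: solution_left. Qed.
Lemma chi_right : sol_piece c b (q P) cr cr1 (fun x => lambda * cr x).
Proof. by have [s t _ _] := hchi; exact: solution_right. Qed.

Lemma w_left x : a <= x -> x <= c -> gg * (pl x * cl1 x - pl1 x * cl x) = w.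
Proof.
move=> ax xc; rewrite (wronskian_piece phi_left chi_left ax xc).
by rewrite !extlE.
Qed.

(** The transmission conditions carry [gamma1 gamma2] times the Wronskian at
    [c] on the left to [delta1 delta2] times the Wronskian on the right. *)
Lemma w_right x : c <= x -> x <= b -> dd * (pr x * cr1 x - pr1 x * cr x) = w.
Proof.
move=> cx xb; rewrite (wronskian_piece phi_right chi_right cx xb).
rewrite -(w_left (ltW lac) (lexx c)).
have [_ tp _ _] := hphi; have [_ tc _ _] := hchi.
have [p0 p1] := ext_transmission tp; have [c0 c1] := ext_transmission tc.
rewrite !rmorphM /=.
transitivity ((delta1 P)%:C * pr c * ((delta2 P)%:C * cr1 c) -
  ((delta2 P)%:C * pr1 c) * ((delta1 P)%:C * cr c)); first by ring.
by rewrite -p0 -p1 -c0 -c1; ring.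
Qed.

(** The value at [c] is arbitrary. *)
Lemma piecewise_measurable (u ul ur : R -> R) :
  measurable_fun `[a, c] ul -> measurable_fun `[c, b] ur ->
  (forall x, a <= x < c -> u x = ul x) -> (forall x, c < x <= b -> u x = ur x) ->
  measurable_fun `[a, b] u.
Proof.
move=> ml mr uul uur.
have -> : `[a, b]%classic = `[a, c[%classic `|` ([set c] `|` `]c, b]%classic).
  apply/seteqP; split => x /=; rewrite !in_itv/=.
    move=> /andP[ax xb]; have [xc|cx|->] := ltgtP x c; [left|right;right|right;left] => //.
      by rewrite ax.
  by move=> [/andP[-> /ltW xc]|[->|/andP[/ltW cx ->]]];
    rewrite ?(le_trans xc (ltW lcb)) ?(ltW lac) ?(ltW lcb) ?(le_trans (ltW lac) cx).
apply/measurable_funU => //; first exact: measurableU.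
split.
  apply: (eq_measurable_fun ul).
    by move=> x; rewrite inE/= in_itv/= => axc; rewrite uul.
  by apply: measurable_funS ml => //; apply: subset_itvl; rewrite bnd_simp.
apply/measurable_funU => //; split; first exact: measurable_fun_set1.
apply: (eq_measurable_fun ur).
  by move=> x; rewrite inE/= in_itv/= => axc; rewrite uur.
by apply: measurable_funS mr => //; apply: subset_itvr; rewrite bnd_simp.
Qed.

Lemma piecewise_L2 (u ul ur : R -> R[i]) : cac a c ul -> cac c b ur ->
  (forall x, a <= x < c -> u x = ul x) -> (forall x, c < x <= b -> u x = ur x) ->
  [/\ measurable_fun `[a, b] (fun x => Re (u x)),
      measurable_fun `[a, b] (fun x => Im (u x)) &
      exists M, forall x, `[a, b]%classic x -> normc (u x) <= M].
Proof.
move=> aul aur uul uur; have [rl il] := cac_measurable aul.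
have [rr ir] := cac_measurable aur; split.
- by apply: (piecewise_measurable rl rr) => x h; [rewrite uul|rewrite uur].
- by apply: (piecewise_measurable il ir) => x h; [rewrite uul|rewrite uur].
- have [M M0 hM] := cac_bounded (ltW lac) aul.
  have [N N0 hN] := cac_bounded (ltW lcb) aur.
  exists (M + N + normc (u c)) => x; rewrite /= in_itv/= => /andP[ax xb].
  have uc0 := normc_ge0 (u c); have [xc|cx|->] := ltgtP x c.
  + by rewrite uul ?ax//; have := hM _ ax (ltW xc); lra.
  + by rewrite uur ?cx//; have := hN _ (ltW cx) xb; lra.
  + lra.
Qed.

(** The boundary condition at [b], which involves [lambda], says that the
    Wronskian with [chi] vanishes at [b]. *)
Lemma chi_end_phi (z z1 : R[i]) :
  lambda * ((beta1' P)%:C * z - (beta2' P)%:C * z1) +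
  ((beta1 P)%:C * z - (beta2 P)%:C * z1) = z * cr1 b - z1 * cr b.
Proof.
have [_ _ cb c1b] := hchi; rewrite !extrE// cb c1b; ring.
Qed.

Lemma dd_neq0 : dd != 0.
Proof. by rewrite fmorph_eq0 gt_eqF// (delta_gt0 hP). Qed.

(** If [w] vanished, [phi] would satisfy the boundary condition at [b] as well,
    so it would give an eigenvector of [A] for a nonreal eigenvalue. By the
    estimate it would vanish almost everywhere, against its initial values at
    [a]. *)
Lemma w_neq0 : Im lambda != 0 -> w != 0.
Proof.
move=> l0; apply/negP => /eqP w0.
have [sp tp pa' p1a] := hphi.
have [acl acl1 dl _] := phi_left; have [acr _ _ _] := phi_right.
have [mr mi [M hM]] := @piecewise_L2 ph pl pr acl acr
  (fun x h => ltac:(by case/andP : h => _ h; rewrite extlE))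
  (fun x h => ltac:(by case/andP : h => h _; rewrite extrE)).
have [] := @represents_homogeneous _ _ hP pl pl1 pr pr1 lambda
    (ph, (beta1' P)%:C * pr b - (beta2' P)%:C * pr1 b) l0.
  split => /=.
  - apply: (@L2_bounded _ _ _ M) => //; exact: mu_itv_fin.
  - have [p0 p1] := ext_transmission tp; split => //.
    + apply: sol_piece_eq phi_left; apply: aeW => x /andP[_ xc].
      by rewrite extlE// subr0.
    + apply: sol_piece_eq phi_right; apply: aeW => x /andP[cx _].
      by rewrite extrE// subr0.
    + by rewrite !extlE// pa' p1a; ring.
  - by apply: aeW => x /andP[_ xc]; rewrite extlE.
  - by apply: aeW => x /andP[cx _]; rewrite extrE.
  - split => //; rewrite subr0; apply/eqP; rewrite -addr_eq0 chi_end_phi.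
    apply/eqP/(mulfI dd_neq0).
    by rewrite mulr0 (w_right (ltW lcb) (lexx b)).
move=> ph0 _.
(* By continuity phi is zero everywhere to the left of c, and so is phi'. *)
have pl0 : forall x, a <= x -> x < c -> pl x = 0.
  apply: (cac_ae_eq0 acl); apply: ae_imp ph0 => x h /andP[ax xc]; rewrite extlE//; apply: h.
  by rewrite /= in_itv/= (ltW ax) (ltW (lt_trans xc lcb)).
have pl10 : forall x, a <= x -> x < c -> pl1 x = 0.
  apply: (cac_ae_eq0 acl1); apply: aeW => x axc; have /andP[ax xc] := axc.
  have [d1 d2] := dl _ axc.
  have [e1 e2] : cderiv pl x 0.
    apply: cderiv_near (cderiv_cst 0 x); apply: filterS (near_itvoo ax xc).
    by move=> y /andP[ay yc]; rewrite pl0// ltW.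
  apply: complex_eq.
    by rewrite -(derive_val (is_derive := d1)) (derive_val (is_derive := e1)).
  by rewrite -(derive_val (is_derive := d2)) (derive_val (is_derive := e2)).
apply: (alpha_neq0 hP).
have := pl0 a (lexx a) lac; rewrite extlE// pa' => -[->].
have := pl10 a (lexx a) lac; rewrite extlE// p1a => /eqP; rewrite oppr_eq0 => /eqP[->].
by [].
Qed.

Lemma cvgCZ (F : set_system R) (f : R -> R[i]) (k l : R[i]) : Filter F ->
  cvgC F f l -> cvgC F (fun x => k * f x) (k * l).
Proof.
move=> FF /cvgC_ReIm[h1 h2]; apply/cvgC_ReIm; split.
  rewrite ReM; under eq_fun do rewrite ReM.
  by apply: cvgB; apply: cvgM => //; exact: cvg_cst.
rewrite ImM; under eq_fun do rewrite ImM.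
by apply: cvgD; apply: cvgM => //; exact: cvg_cst.
Qed.

(** For [x < b], the function [G_1(x, .)] is a multiple of [chi] near [b]. *)
Lemma green_bform'E x : w != 0 -> dom P x ->
  green_bform' P phi chi lambda x = (rho P)%:C * phi x lambda / w.
Proof.
move=> w0 Dx; rewrite /green_bform'; case: eqP => // /eqP xb.
have ltxb : x < b.
  rewrite lt_neqAle xb; case: (dom_cases Dx) => /andP[_]; last by [].
  by move=> /ltW /le_trans; apply; exact: ltW.
have [sc tc cb c1b] := hchi; have domb : dom P b by exact: dom_right.
have [dcb _ _] := sc _ domb.
pose k := ph x / w.
have gE y : x < y -> green P phi chi lambda x y = k * ch y.
  by move=> xy; rewrite /green leNgt xy/= mulrAC.
have dg : has_deriv (dom P) (green P phi chi lambda x) b (k * D1 P ch b).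
  have xy : \forall y \near within (dom P) b^', x < y.
    by apply: cvg_within; apply: nbhs_dnbhs; exact: lt_nbhsr.
  have h : cvgC (within (dom P) b^') (fun y => k * diff_quotient ch b y)
      (k * D1 P ch b).
    by apply: cvgCZ; exact: derivable_on_has_deriv dcb.
  rewrite /has_deriv; apply: cvg_trans h.
  apply: near_eq_cvg; apply: filterS xy => y xy.
  by rewrite /diff_quotient !gE// mulrA mulrBr.
have [_ gb] := D1E domb dg.
rewrite /bform' gb gE// cb c1b /k /rho !rmorphB !rmorphM /=.
by field.
Qed.

End wronskian_w.

(** * Integrals of complex functions *)

Section complex_integral.
Context {R : realType}.
Notation mu := (@lebesgue_measure R).
Local Notation Re := (@complex.Re R).
Local Notation Im := (@complex.Im R).
Implicit Types (l r x : R) (f g h : R -> R[i]) (k : R[i]).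

Definition cintegrable (D : set R) h :=
  mu.-integrable D (EFin \o (fun x => Re (h x))) /\
  mu.-integrable D (EFin \o (fun x => Im (h x))).

Lemma cintegrable_sub l r l' r' h : l <= l' -> r' <= r ->
  cintegrable `[l, r] h -> cintegrable `[l', r'] h.
Proof.
move=> ll rr [h1 h2].
have sub : `[l', r']%classic `<=` `[l, r]%classic.
  move=> x; rewrite /= !in_itv/= => /andP[lx xr].
  by rewrite (le_trans ll lx) (le_trans xr rr).
by split; [exact: integrableS h1|exact: integrableS h2].
Qed.

Lemma CintegralZ l r h k : cintegrable `[l, r] h ->
  Cintegral `[l, r] (fun x => k * h x) = k * Cintegral `[l, r] h.
Proof.
move=> [h1 h2]; rewrite /Cintegral; apply: complex_eq; rewrite ?ReM ?ImM /=.
  under eq_Rintegral do rewrite ReM.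
  by rewrite RintegralB ?RintegralZl//; exact: intRZ.
under eq_Rintegral do rewrite ImM.
by rewrite RintegralD ?RintegralZl//; exact: intRZ.
Qed.

Lemma cintegrableZ l r h k : cintegrable `[l, r] h ->
  cintegrable `[l, r] (fun x => k * h x).
Proof.
move=> [h1 h2].
have E1 : (fun x => Re (k * h x)) = fun x => Re k * Re (h x) - Im k * Im (h x).
  by apply/funext => x; rewrite ReM.
have E2 : (fun x => Im (k * h x)) = fun x => Re k * Im (h x) + Im k * Re (h x).
  by apply/funext => x; rewrite ImM.
rewrite /cintegrable E1 E2; split.
  by apply: intRB => //; exact: intRZ.
by apply: intRD => //; exact: intRZ.
Qed.

Lemma eq_Cintegral (D : set R) f g : (forall x, D x -> f x = g x) ->
  Cintegral D f = Cintegral D g.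
Proof.
by move=> fg; rewrite /Cintegral; congr (_ +i* _); apply: eq_Rintegral => x;
  rewrite inE => /fg ->.
Qed.

Lemma Cintegral_point x h : Cintegral `[x, x] h = 0.
Proof. by rewrite /Cintegral set_itv1 !Rintegral_set1. Qed.

Lemma Cintegral_split l r x h : l <= x -> x <= r -> cintegrable `[l, r] h ->
  Cintegral `[l, r] h = Cintegral `[l, x] h + Cintegral `[x, r] h.
Proof.
have E (k : R -> R) : l <= x -> x <= r -> mu.-integrable `[l, r] (EFin \o k) ->
    \int[mu]_(t in `[l, r]) k t =
    \int[mu]_(t in `[l, x]) k t + \int[mu]_(t in `[x, r]) k t.
  move=> lx xr ki.
  have /= := Rintegral_itvB ki (x := x); rewrite !bnd_simp => /(_ lx xr) h1.
  rewrite -[LHS](subrK (\int[mu]_(t in `[l, x]) k t)) addrC; congr (_ + _).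
  rewrite h1 Rintegral_itv_obnd_cbnd//.
  by apply: integrableS ki => //; apply: subset_itvr; rewrite bnd_simp.
move=> lx xr [h1 h2]; rewrite /Cintegral (E _ lx xr h1) (E _ lx xr h2).
by apply: complex_eq.
Qed.

Let integrable_glue l r x (h k : R -> R) :
  mu.-integrable `[l, r] (EFin \o h) -> mu.-integrable `[l, r] (EFin \o k) ->
  mu.-integrable `[l, r] (EFin \o (fun y => if y <= x then h y else k y)).
Proof.
move=> hi ki.
have mh : measurable_fun `[l, r] h by have /measurable_EFinP := measurable_int _ hi.
have mk : measurable_fun `[l, r] k by have /measurable_EFinP := measurable_int _ ki.
apply: (@integrable_dominated _ _ _ (fun y => `|h y| + `|k y|)) => //.
- apply: measurable_fun_if => //.
  + exact: measurable_fun_ler.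
  + by apply: measurable_funS mh => //; exact: subIsetl.
  + by apply: measurable_funS mk => //; exact: subIsetl.
- by apply: intRD => //; [exact: (integrable_abse hi)|exact: (integrable_abse ki)].
- by move=> y _; case: ifP => _; rewrite (lerDl, lerDr).
Qed.

(** Both closed intervals contain [x], whence the condition [f x = g x]. *)
Lemma Cintegral_glue l r x f g : l <= x -> x <= r ->
  cintegrable `[l, r] f -> cintegrable `[l, r] g -> f x = g x ->
  Cintegral `[l, r] (fun y => if y <= x then f y else g y) =
  Cintegral `[l, x] f + Cintegral `[x, r] g.
Proof.
move=> lx xr [f1 f2] [g1 g2] fgx; rewrite (Cintegral_split lx xr); last first.
  have E (c : R[i] -> R) : (fun y => c (if y <= x then f y else g y)) =
      (fun y => if y <= x then c (f y) else c (g y)).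
    by apply/funext => y; case: ifP.
  by rewrite /cintegrable (E Re) (E Im); split; exact: integrable_glue.
congr (_ + _); apply: eq_Cintegral => y; rewrite /= in_itv/= => /andP[].
  by move=> _ ->.
rewrite le_eqVlt => /predU1P[<- _|xy _]; first by rewrite lexx.
by rewrite leNgt xy.
Qed.

Lemma Cintegral_cac l r h : cintegrable `[l, r] h ->
  cac l r (fun x => Cintegral `[l, x] h).
Proof. by move=> [h1 h2]; split; exact: ac_parameterized_integral. Qed.

Lemma Cintegral_cderiv l r h : cintegrable `[l, r] h ->
  {ae mu, forall x, l < x < r -> cderiv (fun x => Cintegral `[l, x] h) x (h x)}.
Proof.
move=> [h1 h2].
have d1 := @integral_ae_derive R l r 0 (fun x => Re (Cintegral `[l, x] h)) _ h1
  (fun x _ _ => ltac:(by rewrite add0r)).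
have d2 := @integral_ae_derive R l r 0 (fun x => Im (Cintegral `[l, x] h)) _ h2
  (fun x _ _ => ltac:(by rewrite add0r)).
by apply: ae_imp2 d1 d2 => x e1 e2 lx; split; [exact: e1|exact: e2].
Qed.

End complex_integral.

(** * Variation of parameters *)

Section resolvent_piece.
Context {R : realType}.
Notation mu := (@lebesgue_measure R).
Implicit Types (l r : R).

(** The function [h t - k x * t] has a small derivative almost everywhere near
    [x], so its increments are small there: an almost everywhere derivative
    that is continuous is a derivative everywhere, the end points included. *)
Lemma ac_continuous_derive l r (h k : R -> R) : ac_itv l r h -> ac_itv l r k ->
  {ae mu, forall x, l < x < r -> is_derive x 1 h (k x)} ->
  forall x, l <= x -> x <= r ->
  (h y - h x) / (y - x) @[y --> within `[l, r] x^'] --> k x.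
Proof.
move=> ach ack hk x lx xr.
have main y z e : l <= y -> y < z -> z <= r -> 0 <= e ->
    (forall t, y <= t -> t <= z -> `|k t - k x| <= e) ->
    `|(h z - h y) / (z - y) - k x| <= e.
  move=> ly yz zr e0 ke; have zy0 : 0 < z - y by rewrite subr_gt0.
  have acH : ac_itv y z (fun t => h t - k x * t).
    apply: ac_itvB; first exact: ac_itv_sub ly zr ach.
    apply: (@ac_lip _ _ _ _ `|k x|) => // s t _ st _.
    by rewrite -mulrBr normrM (ger0_norm (x := t - s)) ?subr_ge0.
  have := ac_lipschitz (ltW yz) e0 acH; rewrite (_ : _ - _ =
    ((h z - h y) / (z - y) - k x) * (z - y)); last first.
    by rewrite mulrBl divfK ?gt_eqF//; ring.
  rewrite normrM (gtr0_norm zy0) ler_pM2r//; apply.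
  apply: ae_imp hk => t ht /andP[yt tz].
  have ltr_ : l < t < r by rewrite (le_lt_trans ly yt) (lt_le_trans tz zr).
  have dk : is_derive t 1 (fun t => h t - k x * t) (k t - k x).
    have := ht ltr_ => ht'; apply: is_derive_eq; rewrite /GRing.scale/=; ring.
  move=> d dd; rewrite -(derive_val (is_derive := dd)) (derive_val (is_derive := dk)).
  by apply: ke; exact: ltW.
apply/cvgrPdist_le => e e0; have [d d0 kd] := ac_uniform ack e0.
have kd' s t : l <= s -> s <= r -> l <= t -> t <= r -> `|s - t| < d -> `|k s - k t| <= e.
  move=> ls sr lt_ tr; have [st|/ltW ts] := leP s t.
    move=> std; rewrite distrC; apply: kd => //; apply: le_lt_trans std.
    by rewrite distrC; exact: ler_norm.
  by move=> std; apply: kd => //; apply: le_lt_trans std; exact: ler_norm.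
have neqx : \forall y \near within `[l, r] x^', y != x.
  by apply: cvg_within; near=> y; near: y; exact: nbhs_dnbhs_neq.
near=> y; have yx : y != x by near: y.
have ylr : `[l, r]%classic y by near: y; exact: withinT.
have xyd : `|x - y| < d.
  by near: y; apply: cvg_within; apply: nbhs_dnbhs; exact: nbhsx_ballx.
move: ylr; rewrite /= in_itv/= => /andP[ly yr]; rewrite distrC.
move: yx; rewrite neq_lt => /orP[yx|xy].
  rewrite (_ : _ / _ = (h x - h y) / (x - y)); last first.
    by rewrite -[in LHS]opprB -[X in _ / X]opprB invrN mulrNN.
  apply: main => // [|t yt tx]; first exact: ltW.
  apply: kd' => //; [exact: le_trans ly yt|exact: le_trans tx xr|].
  by apply: le_lt_trans xyd; rewrite distrC !ger0_norm ?subr_ge0//; lra.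
apply: main => // [|t xt ty]; first exact: ltW.
apply: kd' => //; [exact: le_trans lx xt|exact: le_trans ty yr|].
by apply: le_lt_trans xyd; rewrite (distrC x) !ger0_norm ?subr_ge0//; lra.
Unshelve. all: by end_near. Qed.

Lemma cac_continuous_deriv l r (F G : R -> R[i]) : cac l r F -> cac l r G ->
  {ae mu, forall x, l < x < r -> cderiv F x (G x)} ->
  forall x, l <= x -> x <= r -> has_deriv `[l, r] F x (G x).
Proof.
move=> [F1 F2] [G1 G2] FG x lx xr.
have d1 := ae_imp (fun y (h : l < y < r -> cderiv F y (G y)) ly =>
  let: conj e _ := h ly in e) FG.
have d2 := ae_imp (fun y (h : l < y < r -> cderiv F y (G y)) ly =>
  let: conj _ e := h ly in e) FG.
apply/cvgC_ReIm; split.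
  under eq_fun do rewrite Re_diff_quotient.
  exact: (ac_continuous_derive F1 G1 d1 lx xr).
under eq_fun do rewrite Im_diff_quotient.
exact: (ac_continuous_derive F2 G2 d2 lx xr).
Qed.

Variables (l r : R) (q : R -> R) (p w0 lambda : R[i]) (f f1 g g1 F A B : R -> R[i]).
Hypotheses (lr : l < r) (w00 : w0 != 0).
Hypothesis sf : sol_piece l r q f f1 (fun x => lambda * f x).
Hypothesis sg : sol_piece l r q g g1 (fun x => lambda * g x).
Hypothesis wE : forall x, l <= x -> x <= r -> p * (f x * g1 x - f1 x * g x) = w0.
Hypotheses (acA : cac l r A) (acB : cac l r B).
Hypothesis dA : {ae mu, forall x, l < x < r -> cderiv A x (p * (f x * F x))}.
Hypothesis dB : {ae mu, forall x, l < x < r -> cderiv B x (- (p * (g x * F x)))}.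

Let u x := w0^-1 * (g x * A x + f x * B x).
Let u1 x := w0^-1 * (g1 x * A x + f1 x * B x).

Let cderivZ (k d : R[i]) h x : cderiv h x d -> cderiv (fun y => k * h y) x (k * d).
Proof. by move=> /(cderivM (cderiv_cst k x)); rewrite mul0r add0r. Qed.

(** Variation of parameters: the derivatives of the two coefficients cancel in
    the first derivative of [u], and reproduce the Wronskian, hence the right-hand
    side, in the second one. *)
Lemma variation_of_parameters :
  sol_piece l r q u u1 (fun x => lambda * u x - F x) /\
  forall x, l <= x -> x <= r -> has_deriv `[l, r] u x (u1 x).
Proof.
have [f_ f1_ df ddf] := sf; have [g_ g1_ dg ddg] := sg.
have acu : cac l r u.
  by apply: cacM (ltW lr) (cac_cst _ _ _) _; apply: cacD; apply: cacM => //; exact: ltW.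
have acu1 : cac l r u1.
  by apply: cacM (ltW lr) (cac_cst _ _ _) _; apply: cacD; apply: cacM => //; exact: ltW.
have du : {ae mu, forall x, l < x < r -> cderiv u x (u1 x)}.
  apply: ae_imp2 dA dB => x hA hB lx.
  have := cderivZ w0^-1 (cderivD (cderivM (dg _ lx) (hA lx)) (cderivM (df _ lx) (hB lx))).
  by congr cderiv; rewrite /u1; ring.
have hdu := cac_continuous_deriv acu acu1 du; split => //; split => //.
  move=> x lx; have /andP[lx' xr] := lx.
  have nb : nbhs x `[l, r]%classic.
    apply: filterS (near_itvoo lx' xr) => y.
    by rewrite /= in_itv/= => /andP[/ltW -> /ltW ->].
  have [h _] := has_deriv_cderiv u (u1 x) nb.
  by apply: h; apply: hdu; exact: ltW.
apply: ae_imp3 dA dB (ae_imp2 (fun x h1 h2 => conj h1 h2) ddf ddg) => x hA hB [hf hg] lx.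
have [d dd ef] := hf lx; have [e de eg] := hg lx.
have /andP[lx' xr] := lx.
exists (((q x)%:C - lambda) * u x + F x); last by ring.
have := cderivZ w0^-1 (cderivD (cderivM de (hA lx)) (cderivM dd (hB lx))).
congr cderiv; rewrite /u.
have -> : d = ((q x)%:C - lambda) * f x.
  by apply/eqP; rewrite -subr_eq0 mulrBl ef; apply/eqP; ring.
have -> : e = ((q x)%:C - lambda) * g x.
  by apply/eqP; rewrite -subr_eq0 mulrBl eg; apply/eqP; ring.
rewrite -[F x in RHS](mulKf w00) -{4}(wE (ltW lx') (ltW xr)); ring.
Qed.

End resolvent_piece.

(** * The explicit resolvent *)

Section explicit_resolvent.
Context {R : realType}.
Notation mu := (@lebesgue_measure R).
Variable P : problem R.
Hypothesis hP : standing P.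
Variables (phi chi : R -> R[i] -> R[i]) (lambda : R[i]).
Hypothesis hphi : phi_solution P lambda (phi^~ lambda).
Hypothesis hchi : chi_solution P lambda (chi^~ lambda).
Variable F : H1rep R.
Hypothesis LF : in_H1 P F.

Local Notation a := (pa P).
Local Notation b := (pb P).
Local Notation c := (pc P).
Local Notation gg := ((gamma1 P * gamma2 P)%:C : R[i]).
Local Notation dd := ((delta1 P * delta2 P)%:C : R[i]).
Local Notation ph := (phi^~ lambda).
Local Notation ch := (chi^~ lambda).
Local Notation w := (w P phi chi lambda).
Hypothesis w0 : w != 0.

Let lac : a < c := lt_ac hP.
Let lcb : c < b := lt_cb hP.

Local Notation pl := (extl P ph).
Local Notation pl1 := (extl P (D1 P ph)).
Local Notation pr := (extr P ph).
Local Notation pr1 := (extr P (D1 P ph)).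
Local Notation cl := (extl P ch).
Local Notation cl1 := (extl P (D1 P ch)).
Local Notation cr := (extr P ch).
Local Notation cr1 := (extr P (D1 P ch)).

(** Solutions are bounded and [F] is square integrable. *)
Let solution_mul_integrable u : solves P lambda u -> transmission P u ->
  cintegrable `[a, b] (fun y => u y * F.1 y).
Proof.
move=> su tu; have [acl _ _ _] := solution_left hP su tu.
have [acr _ _ _] := solution_right hP su tu.
have [mr mi [M hM]] := @piecewise_L2 _ _ hP u _ _ acl acr
  (fun x h => ltac:(by case/andP : h => _ h; rewrite extlE))
  (fun x h => ltac:(by case/andP : h => h _; rewrite extrE)).
have Lu : L2 `[a, b] u.
  by apply: (@L2_bounded _ _ _ M) => //; exact: mu_itv_fin.
by have [] := L2_mul_integrable (measurable_itv _) Lu LF.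
Qed.

Let iphi : cintegrable `[a, b] (fun y => ph y * F.1 y).
Proof. by have [s t _ _] := hphi; exact: solution_mul_integrable. Qed.

Let ichi : cintegrable `[a, b] (fun y => ch y * F.1 y).
Proof. by have [s t _ _] := hchi; exact: solution_mul_integrable. Qed.

Let iphil := cintegrable_sub (lexx a) (ltW lcb) iphi.
Let iphir := cintegrable_sub (ltW lac) (lexx b) iphi.
Let ichil := cintegrable_sub (lexx a) (ltW lcb) ichi.
Let ichir := cintegrable_sub (ltW lac) (lexx b) ichi.

(** The coefficients of [chi] and [phi] in the resolvent on [[a, c]] and on
    [[c, b]]; they match at [c]. *)
Let Phil x := gg * Cintegral `[a, x] (fun y => ph y * F.1 y).
Let Chil x := gg * (Cintegral `[a, c] (fun y => ch y * F.1 y) -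
  Cintegral `[a, x] (fun y => ch y * F.1 y)) +
  dd * (Cintegral `[c, b] (fun y => ch y * F.1 y) + F.2).
Let Phir x := gg * Cintegral `[a, c] (fun y => ph y * F.1 y) +
  dd * Cintegral `[c, x] (fun y => ph y * F.1 y).
Let Chir x := dd * (Cintegral `[c, b] (fun y => ch y * F.1 y) -
  Cintegral `[c, x] (fun y => ch y * F.1 y) + F.2).

Let ul x := w^-1 * (cl x * Phil x + pl x * Chil x).
Let ul1 x := w^-1 * (cl1 x * Phil x + pl1 x * Chil x).
Let ur x := w^-1 * (cr x * Phir x + pr x * Chir x).
Let ur1 x := w^-1 * (cr1 x * Phir x + pr1 x * Chir x).

Local Notation u := (resolvent_fun P phi chi lambda F).

Let rho0 : (rho P)%:C != 0 :> R[i].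
Proof. by rewrite fmorph_eq0 gt_eqF// (rho_gt0 hP). Qed.

(** On either side of the diagonal, the Green function is a product of a
    function of [x] and a function of [y]. *)
Let glue_green l r x : l <= x -> x <= r ->
  cintegrable `[l, r] (fun y => ph y * F.1 y) ->
  cintegrable `[l, r] (fun y => ch y * F.1 y) ->
  Cintegral `[l, r] (fun y => green P phi chi lambda x y * F.1 y) =
  w^-1 * (ch x * Cintegral `[l, x] (fun y => ph y * F.1 y) +
    ph x * Cintegral `[x, r] (fun y => ch y * F.1 y)).
Proof.
move=> lx xr i1 i2.
rewrite (@eq_Cintegral _ _ _ (fun y => if y <= x then (w^-1 * ch x) * (ph y * F.1 y)
    else (w^-1 * ph x) * (ch y * F.1 y))); last first.
  by move=> y _; rewrite /green; case: ifP => _; ring.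
rewrite (Cintegral_glue lx xr) ?CintegralZ//; first by ring.
- exact: cintegrable_sub lx (lexx r) i2.
- exact: cintegrable_sub (lexx l) xr i1.
- exact: cintegrableZ.
- exact: cintegrableZ.
- by ring.
Qed.

Lemma resolvent_left x : a <= x < c -> u x = ul x.
Proof.
move=> /andP[ax xc].
rewrite /resolvent_fun (green_bform'E hP hchi w0 (dom_left ax xc)).
rewrite (glue_green ax (ltW xc) iphil ichil).
rewrite (@eq_Cintegral _ `[c, b] _ (fun y => (w^-1 * ph x) * (ch y * F.1 y))); last first.
  move=> y; rewrite /= in_itv/= => /andP[cy _]; rewrite /green leNgt (lt_le_trans xc cy)/=.
  ring.
rewrite CintegralZ// /ul /Phil /Chil !extlE//.
rewrite (Cintegral_split ax (ltW xc) ichil) !rmorphM /= fmorphV.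
by field; rewrite w0.
Qed.

Lemma resolvent_right x : c < x <= b -> u x = ur x.
Proof.
move=> /andP[cx xb].
rewrite /resolvent_fun (green_bform'E hP hchi w0 (dom_right cx xb)).
rewrite (glue_green (ltW cx) xb iphir ichir).
rewrite (@eq_Cintegral _ `[a, c] _ (fun y => (w^-1 * ch x) * (ph y * F.1 y))); last first.
  move=> y; rewrite /= in_itv/= => /andP[_ yc]; rewrite /green (le_trans yc (ltW cx))/=.
  ring.
rewrite CintegralZ// /ur /Phir /Chir !extrE//.
rewrite (Cintegral_split (ltW cx) xb ichir) !rmorphM /= fmorphV.
by field; rewrite w0.
Qed.

Let acPhil : cac a c Phil.
Proof. by apply: cacM (ltW lac) (cac_cst _ _ _) _; exact: Cintegral_cac. Qed.

Let acChil : cac a c Chil.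
Proof.
apply: cacD; last exact: cac_cst.
apply: cacM (ltW lac) (cac_cst _ _ _) _; apply: cacD; first exact: cac_cst.
by apply: cacN; exact: Cintegral_cac.
Qed.

Let acPhir : cac c b Phir.
Proof.
apply: cacD; first exact: cac_cst.
by apply: cacM (ltW lcb) (cac_cst _ _ _) _; exact: Cintegral_cac.
Qed.

Let acChir : cac c b Chir.
Proof.
apply: cacM (ltW lcb) (cac_cst _ _ _) _; apply: cacD; last exact: cac_cst.
by apply: cacD; [exact: cac_cst|apply: cacN; exact: Cintegral_cac].
Qed.

Let dPhil : {ae mu, forall x, a < x < c -> cderiv Phil x (gg * (pl x * F.1 x))}.
Proof.
apply: ae_imp (Cintegral_cderiv iphil) => x h axc; have /andP[_ xc] := axc.
by have := cderivM (cderiv_cst gg x) (h axc); rewrite mul0r add0r extlE.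
Qed.

Let dChil : {ae mu, forall x, a < x < c -> cderiv Chil x (- (gg * (cl x * F.1 x)))}.
Proof.
apply: ae_imp (Cintegral_cderiv ichil) => x h axc; have /andP[_ xc] := axc.
have := cderivD (cderivM (cderiv_cst gg x) (cderivD
  (cderiv_cst (Cintegral `[a, c] (fun y => ch y * F.1 y)) x) (cderivN (h axc))))
  (cderiv_cst (dd * (Cintegral `[c, b] (fun y => ch y * F.1 y) + F.2)) x).
by rewrite mul0r !add0r addr0 mulrN extlE.
Qed.

Let dPhir : {ae mu, forall x, c < x < b -> cderiv Phir x (dd * (pr x * F.1 x))}.
Proof.
apply: ae_imp (Cintegral_cderiv iphir) => x h axc; have /andP[cx _] := axc.
have := cderivD (cderiv_cst (gg * Cintegral `[a, c] (fun y => ph y * F.1 y)) x)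
  (cderivM (cderiv_cst dd x) (h axc)).
by rewrite mul0r !add0r extrE.
Qed.

Let dChir : {ae mu, forall x, c < x < b -> cderiv Chir x (- (dd * (cr x * F.1 x)))}.
Proof.
apply: ae_imp (Cintegral_cderiv ichir) => x h axc; have /andP[cx _] := axc.
have := cderivM (cderiv_cst dd x) (cderivD (cderivD
  (cderiv_cst (Cintegral `[c, b] (fun y => ch y * F.1 y)) x) (cderivN (h axc)))
  (cderiv_cst F.2 x)).
by rewrite mul0r !add0r addr0 mulrN extrE.
Qed.

Let piecel := variation_of_parameters lac w0 (phi_left hP hphi) (chi_left hP hchi)
  (w_left hP hphi hchi) acPhil acChil dPhil dChil.
Let piecer := variation_of_parameters lcb w0 (phi_right hP hphi) (chi_right hP hchi)
  (w_right hP hphi hchi) acPhir acChir dPhir dChir.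

Let soll : sol_piece a c (q P) ul ul1 (fun x => lambda * ul x - F.1 x).
Proof. by have [] := piecel. Qed.
Let solr : sol_piece c b (q P) ur ur1 (fun x => lambda * ur x - F.1 x).
Proof. by have [] := piecer. Qed.

Let near_left x : a <= x -> x < c ->
  \forall y \near x, dom P y -> `[a, c]%classic y /\ u y = ul y.
Proof.
move=> ax xc; have x1 : x - 1 < x by rewrite ltrBlDr ltrDl.
apply: filterS (near_itvoo x1 xc) => y /andP[_ yc] Dy.
have ay : a <= y.
  by case: (dom_cases Dy) => /andP[] // /ltW h _; exact/ltW/(lt_le_trans lac).
by split; [rewrite /= in_itv/= ay ltW|apply: resolvent_left; rewrite ay].
Qed.

Let near_right x : c < x -> x <= b ->
  \forall y \near x, dom P y -> `[c, b]%classic y /\ u y = ur y.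
Proof.
move=> cx xb; have x1 : x < x + 1 by rewrite ltrDl.
apply: filterS (near_itvoo cx x1) => y /andP[cy _] Dy.
have yb : y <= b.
  by case: (dom_cases Dy) => /andP[] // _ /ltW h; exact/ltW/(le_lt_trans h).
by split; [rewrite /= in_itv/= yb ltW|apply: resolvent_right; rewrite cy].
Qed.

Let du_left x : a <= x -> x < c -> has_deriv (dom P) u x (ul1 x).
Proof.
move=> ax xc; apply: has_deriv_transfer (near_left ax xc) _.
  by apply: resolvent_left; rewrite ax.
by have [_ h] := piecel; apply: h => //; exact: ltW.
Qed.

Let du_right x : c < x -> x <= b -> has_deriv (dom P) u x (ur1 x).
Proof.
move=> cx xb; apply: has_deriv_transfer (near_right cx xb) _.
  by apply: resolvent_right; rewrite cx.
by have [_ h] := piecer; apply: h => //; exact: ltW.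
Qed.

Let D1_left x : a <= x -> x < c -> D1 P u x = ul1 x.
Proof. by move=> ax xc; have [] := D1E (dom_left ax xc) (du_left ax xc). Qed.

Let D1_right x : c < x -> x <= b -> D1 P u x = ur1 x.
Proof. by move=> cx xb; have [] := D1E (dom_right cx xb) (du_right cx xb). Qed.

Let LU : L2 `[a, b] u.
Proof.
have [acl _ _ _] := soll; have [acr _ _ _] := solr.
have [mr mi [M hM]] := piecewise_L2 hP acl acr resolvent_left resolvent_right.
by apply: (@L2_bounded _ _ _ M) => //; exact: mu_itv_fin.
Qed.

Let LV : L2 `[a, b] (fun x => lambda * u x - F.1 x).
Proof. by apply: L2B => //; apply: L2Z. Qed.

Let tau_u : {ae mu, forall x, `[a, b]%classic x -> lambda * u x - F.1 x = tau P u x}.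
Proof.
have [_ _ _ dl] := soll; have [_ _ _ dr] := solr.
have hl : {ae mu, forall x, a < x < c -> lambda * u x - F.1 x = tau P u x}.
  apply: ae_imp dl => x h axc; have /andP[ax xc] := axc; have [d dd] := h axc.
  have {}dd : has_deriv (dom P) (D1 P u) x d.
    apply/has_deriv_cderiv; first exact: nbhs_dom_left.
    apply: cderiv_near dd; apply: filterS (near_itvoo ax xc) => y /andP[ay yc].
    by rewrite D1_left// ltW.
  have [_ D1D1] := D1E (dom_left (ltW ax) xc) dd.
  by rewrite resolvent_left ?(ltW ax)// /tau D1D1 resolvent_left ?(ltW ax).
have hr : {ae mu, forall x, c < x < b -> lambda * u x - F.1 x = tau P u x}.
  apply: ae_imp dr => x h axc; have /andP[cx xb] := axc; have [d dd] := h axc.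
  have {}dd : has_deriv (dom P) (D1 P u) x d.
    apply/has_deriv_cderiv; first exact: nbhs_dom_right.
    apply: cderiv_near dd; apply: filterS (near_itvoo cx xb) => y /andP[cy yb].
    by rewrite D1_right// ltW.
  have [_ D1D1] := D1E (dom_right cx (ltW xb)) dd.
  by rewrite resolvent_right ?cx ?(ltW xb)// /tau D1D1 resolvent_right ?cx ?(ltW xb).
have hlr := ae_imp2 (fun x h1 h2 => conj h1 h2) (ae_itvoo_cc hl) (ae_itvoo_cc hr).
apply: ae_imp hlr => x [h1 h2]; rewrite /= in_itv/= => /andP[ax xb].
have [xc|cx] := leP x c; first by apply: h1; rewrite /= in_itv/= ax.
by apply: h2; rewrite /= in_itv/= xb ltW.
Qed.

Let cac_cvg_end l r (f : R -> R[i]) : l < r -> cac l r f ->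
  cvgC l^'+ f (f l) /\ cvgC r^'- f (f r).
Proof.
move=> lr [f1 f2].
have /(continuous_within_itvP _ lr)[_ l1 r1] := ac_within_continuous f1.
have /(continuous_within_itvP _ lr)[_ l2 r2] := ac_within_continuous f2.
by split; apply/cvgC_ReIm.
Qed.

Let limit_left f g : (forall x, a <= x -> x < c -> f x = g x) -> cac a c g ->
  has_limit c^'- f /\ limit c^'- f = g c.
Proof.
move=> fg acg; have [_ gc] := cac_cvg_end lac acg; apply: cvg_has_limit.
apply: cvg_trans gc; apply: near_eq_cvg; near=> x.
have ax : a <= x by near: x; exact: nbhs_left_ge.
have xc : x < c by near: x; exact: nbhs_left_lt.
by rewrite fg.
Unshelve. all: by end_near. Qed.

Let limit_right f g : (forall x, c < x -> x <= b -> f x = g x) -> cac c b g ->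
  has_limit c^'+ f /\ limit c^'+ f = g c.
Proof.
move=> fg acg; have [gc _] := cac_cvg_end lcb acg; apply: cvg_has_limit.
apply: cvg_trans gc; apply: near_eq_cvg; near=> x.
have cx : c < x by near: x; exact: nbhs_right_gt.
have xb : x <= b by near: x; exact: nbhs_right_le.
by rewrite fg.
Unshelve. all: by end_near. Qed.

Let Phi_c : Phil c = Phir c.
Proof. by rewrite /Phir Cintegral_point mulr0 addr0. Qed.

Let Chi_c : Chil c = Chir c.
Proof. by rewrite /Chil /Chir Cintegral_point subrr mulr0 add0r subr0. Qed.

Lemma resolvent_DA : DA_fun P u.
Proof.
have [acl acl1 _ _] := soll; have [acr acr1 _ _] := solr.
have [ll ul_c] := limit_left (fun x ax xc => resolvent_left (introT andP (conj ax xc))) acl.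
have [lr ur_c] := limit_right (fun x cx xb => resolvent_right (introT andP (conj cx xb))) acr.
have [l1l ul1_c] := limit_left D1_left acl1.
have [l1r ur1_c] := limit_right D1_right acr1.
have sl : `[a, c[%classic `<=` `[a, c]%classic by apply: subset_itvl; rewrite bnd_simp.
have sr : `]c, b]%classic `<=` `[c, b]%classic by apply: subset_itvr; rewrite bnd_simp.
split.
- move=> x /dom_cases[/andP[ax xc]|/andP[cx xb]].
    by have [] := D1E (dom_left ax xc) (du_left ax xc).
  by have [] := D1E (dom_right cx xb) (du_right cx xb).
- split.
    by apply: (abs_cont_of_cac sl _ acl) => x; rewrite /= in_itv/=; exact: resolvent_left.
  by apply: (abs_cont_of_cac sr _ acr) => x; rewrite /= in_itv/=; exact: resolvent_right.
- split.
    apply: (abs_cont_of_cac sl _ acl1) => x; rewrite /= in_itv/= => /andP[]; exact: D1_left.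
  by apply: (abs_cont_of_cac sr _ acr1) => x; rewrite /= in_itv/= => /andP[]; exact: D1_right.
- by exists (fun x => lambda * u x - F.1 x); [exact: LV|exact: tau_u].
split.
  rewrite resolvent_left ?lexx// D1_left// /ul /ul1 /Phil Cintegral_point.
  have [_ _ pa' p1a] := hphi; rewrite !extlE// pa' p1a; ring.
have [_ tp _ _] := hphi; have [_ tc _ _] := hchi.
have [p0 p1] := ext_transmission tp; have [c0 c1] := ext_transmission tc.
split=> //.
  rewrite ul_c ur_c /ul /ur Phi_c Chi_c mulrCA mulrDr !mulrA.
  by rewrite p0 c0; ring.
rewrite ul1_c ur1_c /ul1 /ur1 Phi_c Chi_c mulrCA mulrDr !mulrA.
by rewrite p1 c1; ring.
Qed.

(** At [b] the coefficient of [chi] no longer depends on the first component of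
    [F], and [chi_end_phi] reduces the boundary condition to the value of the
    Wronskian. *)
Let resolvent_bform : lambda * bform' P u - F.2 = - bform P u.
Proof.
apply/eqP; rewrite -subr_eq0 opprK; apply/eqP.
rewrite /bform' /bform resolvent_right ?lcb ?lexx// D1_right//.
have W := chi_end_phi hP hchi (ur b) (ur1 b).
rewrite addrAC; move: W => ->.
apply/eqP; rewrite subr_eq0; apply/eqP.
have Xb : Chir b = dd * F.2 by rewrite /Chir subrr add0r.
have wb := w_right hP hphi hchi (ltW lcb) (lexx b).
transitivity (w^-1 * (dd * (pr b * cr1 b - pr1 b * cr b)) * F.2).
  by rewrite /ur /ur1 Xb; ring.
by rewrite wb mulVf ?mul1r.
Qed.

Lemma resolvent_is_resolvent : is_resolvent P lambda F (with_bform' P u).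
Proof.
exists (fun x => lambda * u x - F.1 x, lambda * bform' P u - F.2); last first.
  split => /=; last by ring.
  by apply: aeW => x _ /=; ring.
split; [exact: LU|exact: LV|exists u; first exact: resolvent_DA].
split; first by split => //; apply: aeW.
by split; [exact: tau_u|exact: resolvent_bform].
Qed.

End explicit_resolvent.

(** * Regular points and the resolvent *)

Theorem mainTheorem3 (R : realType) (P : problem R) (hP : standing P)
    (phi chi : R -> R[i] -> R[i])
    (hphi : forall lambda : R[i], phi_solution P lambda (phi^~ lambda))
    (hchi : forall lambda : R[i], chi_solution P lambda (chi^~ lambda)) :
  forall lambda : R[i], complex.Im lambda != 0 ->
    [/\ regular_point P lambda,
        w P phi chi lambda != 0,
        forall x : R, dom P x ->
          green_bform' P phi chi lambda x =
            (rho P)%:C * phi x lambda / w P phi chi lambda &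
        forall F : H1rep R, in_H1 P F ->
          let u := resolvent_fun P phi chi lambda F in
          is_resolvent P lambda F (with_bform' P u) /\
          H1norm P (with_bform' P u) <=
            `|complex.Im lambda|^-1 * H1norm P F].
Proof.
move=> lambda l0; have w0 := w_neq0 hP (hphi lambda) (hchi lambda) l0.
have res F : in_H1 P F ->
    is_resolvent P lambda F (with_bform' P (resolvent_fun P phi chi lambda F)).
  by move=> LF; exact: resolvent_is_resolvent.
have bnd F U : in_H1 P F -> lambda_sub_A P lambda U F ->
    H1norm P U <= `|complex.Im lambda|^-1 * H1norm P F.
  move=> LF /(lambda_sub_A_represents hP LF)[f rf].
  exact: (represents_estimate hP l0 LF rf).
split => //.
- split.
  + by move=> F LF; exists (with_bform' P (resolvent_fun P phi chi lambda F)); exact: res.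
  + by move=> F U1 U2 LF; exact: lambda_sub_A_unique.
  + by exists `|complex.Im lambda|^-1.
- by move=> x Dx; exact: green_bform'E.
- move=> F LF u; split; first exact: res.
  by apply: bnd => //; exact: res.
Qed.
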